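(* Let $(d_m)_{m\ge 1}$ and $(n_m)_{m\ge1}$ be sequences of positive integers with $d_m\to\infty$ and $n_m\to\infty$ as $m\to\infty$, and for each $m$ let $x^{(m)}_1,\dots,x^{(m)}_{n_m}$ be points of the unit sphere $S^{d_m-1}\subset\mathbb{R}^{d_m}$. Assume that for every $\varepsilon>0$, $$\sum_{\substack{1\le i<j\le n_m\\ |\langle x^{(m)}_i,x^{(m)}_j\rangle|\ge\varepsilon}} \min\left(\frac{1}{\sqrt{1-|\langle x^{(m)}_i,x^{(m)}_j\rangle|}},\; n_m\right)=o(n_m^2)\qquad (m\to\infty).$$ For each $m$ let $U^{(m)}$ be a random vector uniformly distributed on $S^{d_m-1}$, and for $a\in\mathbb{R}$ let $\xi_a^{(m)}$ be the point process on $\mathbb{R}$ $$\xi_a^{(m)}=\sum_{j=1}^{n_m}\delta_{\,n_m\left(\langle x^{(m)}_j,\sqrt{d_m}\,U^{(m)}\rangle-a\right)}.$$ Then for every $a\in\mathbb{R}$, $\xi_a^{(m)}$ converges as $m\to\infty$ to the homogeneous Poisson process on $\mathbb{R}$ with intensity $\phi(a)=(2\pi)^{-1/2}\exp(-a^2/2)$ in the following sense: for every bounded Borel set $I\subset\mathbb{R}$, the random variables $\xi_a^{(m)}(I)$ converge in distribution to $\mathrm{Pois}(\phi(a)\,\mathrm{mes}\, I)$.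
   Context: Here $\delta_t$ denotes the unit point mass at $t\in\mathbb{R}$, so that $\xi^{(m)}_a(I)$ is the number of indices $j\in\{1,\dots,n_m\}$ with $n_m(\langle x^{(m)}_j,\sqrt{d_m}\,U^{(m)}\rangle-a)\in I$, counted with multiplicity if points coincide. $\langle\cdot,\cdot\rangle$ is the standard Euclidean inner product, $\mathrm{mes}$ is Lebesgue measure on $\mathbb{R}$, and $\mathrm{Pois}(\lambda)$ is the Poisson law with mean $\lambda$ (with $\mathrm{Pois}(0)$ the point mass at $0$). When $|\langle x_i,x_j\rangle|=1$, the quantity $1/\sqrt{1-|\langle x_i,x_j\rangle|}$ is interpreted as $+\infty$, so the minimum equals $n_m$. *)

(* Defs.v *)
From HB Require Import structures.
From mathcomp Require Import all_boot all_order all_algebra.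
From mathcomp Require Import all_classical all_reals all_analysis.

Set Implicit Arguments.
Unset Strict Implicit.
Unset Printing Implicit Defensive.

Import Order.TTheory GRing.Theory Num.Theory.
Import numFieldNormedType.Exports.

Local Open Scope classical_set_scope.
Local Open Scope ring_scope.

Definition dotp (R : realType) (d : nat) (u v : 'rV[R]_d) : R :=
  \sum_(i < d) u 0 i * v 0 i.

Definition unit_sphere (R : realType) (d : nat) : set 'rV[R]_d :=
  [set u | dotp u u = 1].

(* R^d with its Borel sigma-algebra; convertible to 'rV[R]_d. *)
Definition borel_rV (R : realType) (d : nat) :=
  g_sigma_algebraType (@open 'rV[R]_d).

Definition orthogonal_mx (R : realType) (d : nat) (Q : 'M[R]_d) : Prop :=
  Q *m Q^T = 1%:M.

(* The uniform law on S^(d-1) is the Borel probability measure carried by the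
   sphere that is invariant under the whole orthogonal group O(d).  Invariance
   under SO(d) would not suffice for d = 1. *)
Definition uniform_on_sphere (R : realType) (d : nat)
    (mu : probability (borel_rV R d) R) : Prop :=
  mu (@unit_sphere R d) = 1%E /\
  forall Q : 'M[R]_d, orthogonal_mx Q ->
    forall A : set (borel_rV R d), measurable A ->
      mu [set u : borel_rV R d | A ((u : 'rV[R]_d) *m Q)] = mu A.

(* min (1 / sqrt (1 - |c|), N), the first argument being +oo when |c| = 1
   (the library's 0^-1 is 0, hence the case distinction). *)
Definition pair_weight (R : realType) (N : nat) (c : R) : R :=
  if `|c| == 1 then N%:R else Num.min (Num.sqrt (1 - `|c|))^-1 N%:R.

Definition correlation_sum (R : realType) (n d : nat)
    (x : 'I_n -> 'rV[R]_d) (eps : R) : R :=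
  \sum_(i < n) \sum_(j < n | (i < j)%N && (eps <= `|dotp (x i) (x j)|))
    pair_weight n (dotp (x i) (x j)).

(* The realization at U = u of the point process xi_a. *)
Definition xi (R : realType) (n d : nat) (x : 'I_n -> 'rV[R]_d) (a : R)
    (u : 'rV[R]_d) (B : set R) : \bar R :=
  (\sum_(j < n) \d_((n%:R * (dotp (x j) (Num.sqrt d%:R *: u) - a))%R) B)%E.

Definition phi (R : realType) (a : R) : R :=
  (Num.sqrt (2 * pi))^-1 * expR (- (a ^+ 2 / 2)).

Definition nat_real (R : realType) (k : nat) : R := k%:R.

Lemma measurable_nat_real (R : realType) :
  measurable_fun [set: nat] (@nat_real R).
Proof. by []. Qed.

HB.instance Definition _ (R : realType) :=
  isMeasurableFun.Build _ _ nat R (@nat_real R) (@measurable_nat_real R).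

(* Poisson law on R.  The second argument of poisson_prob does not occur in its
   value, and poisson_prob 0 _ is the point mass at 0. *)
Definition Pois (R : realType) (lambda : R) : probability R R :=
  distribution (poisson_prob lambda 0%N) (@nat_real R).

(* Weak convergence of the laws of X m to mu. The X m may live on different
   probability spaces; the first conjunct says that they are random variables. *)
Definition cvg_in_distribution (R : realType) (disp : nat -> measure_display)
    (T : forall m, measurableType (disp m)) (P : forall m, probability (T m) R)
    (X : forall m, T m -> R) (mu : probability R R) : Prop :=
  (forall m, measurable_fun [set: T m] (X m)) /\
  forall f : R -> R, continuous f -> (exists M : R, forall y, `|f y| <= M) ->
    \int[P m]_w f (X m w) @[m --> \oo] --> \int[mu]_y f y.

(* Main.v *)
Require Import Defs.
From HB Require Import structures.
From mathcomp Require Import all_boot all_order all_algebra.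
From mathcomp Require Import all_classical all_reals all_analysis.
From mathcomp Require Import finmap measurable_realfun.
From mathcomp Require Import ring lra zify.

(** Write W for the number of points x_j whose coordinate sqrt d <x_j, U> falls
   in the window a + I / n, and lam for phi(a) mes I.  The key step is
     E[W f(W - 1)] ~ lam L   as soon as   E[f(W)] ~ L
   for every configuration with few correlated pairs, f >= 0 being bounded.
   Indeed E[W f(W - 1)] is the sum over j of E[1_{j is hit} f(W - 1)].  Given
   the coordinate of U along x_j, the rest of U is uniform on a sphere of one
   dimension less, where the other points, projected to the orthogonal
   complement of x_j and normalized, form a configuration of the same kind with
   slightly deformed windows; so the conditional expectation is close to L, while
   P(j is hit) is close to phi(a) mes(I) / n.  That the projected family still
   has few correlated pairs, for all but o(n) of the indices j, is where the
   weights 1 / sqrt(1 - c^2) enter: they compare, through a quasi-triangle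
   inequality for areas, the pairs made parallel by a projection with the pairs
   that were almost parallel from the start.
   Starting from f = 1, the step yields the factorial moments of W, truncated by
   W <= N to keep the test functions bounded; Bonferroni's inequalities then give
   P(W = 0) -> e^(-lam), and the step applied to the indicator of k - 1 gives
   P(W = k) -> e^(-lam) lam^k / k! by induction on k.

   The disintegration of the uniform law rests on the uniqueness of the
   O(d)-invariant probability, and the density (1 - y^2 / d)^((d - 3) / 2) of
   sqrt d <x, U> on an identity of Stein type between two coordinates of U. *)

Set Implicit Arguments.
Unset Strict Implicit.
Unset Printing Implicit Defensive.

Import Order.TTheory GRing.Theory Num.Theory.
Import numFieldNormedType.Exports.

Local Open Scope classical_set_scope.
Local Open Scope ring_scope.

(** The estimates must be uniform over a class of configurations stable under projection, since the
    step passes from a configuration to its slices along the x_j; hence windows may vary with the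
    point, and only their total length is prescribed. The weights are natural: two points with inner
    product c are hit together with probability O(min(1 / sqrt(1 - c^2), n) / n^2), so the
    hypothesis says that correlated pairs are seldom hit together. The obstacle is the projection
    along t: i and j become nearly parallel when i, j, t are nearly coplanar, and many t may lie
    close to the plane of i and j. Such t, when also nearly orthogonal to i, are nearly parallel to
    each other up to sign, so the sum of inverse areas over them is again a sum of the kind to be
    bounded. A stopping scale breaks this circle: the cutoff on the areas is refined dyadically and
    stopped as soon as the sum attached to (t, i) reaches L N, where it is still at most 2 L N.
    Pairs that stop are few, pairs that never stop are harmless. *)

Section DotProduct.
Context {R : realType} {d : nat}.
Implicit Types u v w : 'rV[R]_d.

Lemma dotpC u v : dotp u v = dotp v u.
Proof. by apply: eq_bigr => i _; rewrite mulrC. Qed.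

Lemma dotpDl u v w : dotp (u + v) w = dotp u w + dotp v w.
Proof. by rewrite /dotp -big_split; apply: eq_bigr => i _; rewrite mxE mulrDl. Qed.

Lemma dotpZl a u v : dotp (a *: u) v = a * dotp u v.
Proof. by rewrite /dotp mulr_sumr; apply: eq_bigr => i _; rewrite mxE mulrA. Qed.

Lemma dotpNl u v : dotp (- u) v = - dotp u v.
Proof. by rewrite -scaleN1r dotpZl mulN1r. Qed.

Lemma dotpBl u v w : dotp (u - v) w = dotp u w - dotp v w.
Proof. by rewrite dotpDl dotpNl. Qed.

Lemma dotpDr u v w : dotp w (u + v) = dotp w u + dotp w v.
Proof. by rewrite dotpC dotpDl !(dotpC w). Qed.

Lemma dotpZr a u v : dotp u (a *: v) = a * dotp u v.
Proof. by rewrite dotpC dotpZl (dotpC u). Qed.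

Lemma dotpNr u v : dotp u (- v) = - dotp u v.
Proof. by rewrite dotpC dotpNl dotpC. Qed.

Definition dotpE := (dotpDl, dotpDr, dotpZl, dotpZr, dotpNl, dotpNr).

Lemma dotp_ge0 u : 0 <= dotp u u.
Proof. by apply: sumr_ge0 => i _; rewrite -expr2 sqr_ge0. Qed.

Lemma dotp_eq0 u : dotp u u = 0 -> u = 0.
Proof.
move=> /eqP; rewrite psumr_eq0; last by move=> i _; rewrite -expr2 sqr_ge0.
move=> /allP u0; apply/rowP => i; rewrite mxE.
by have := u0 i (mem_index_enum _); rewrite /= mulf_eq0 orbb => /eqP.
Qed.

Lemma dotp_CS u v : dotp u v ^+ 2 <= dotp u u * dotp v v.
Proof.
have [v0|v0] := eqVneq (dotp v v) 0.
  rewrite (dotp_eq0 v0) (_ : dotp u 0 = 0) ?expr0n ?mulr_ge0 ?dotp_ge0//.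
  by rewrite -(scale0r (0 : 'rV[R]_d)) dotpZr mul0r.
have vp : 0 < dotp v v by rewrite lt_def v0 dotp_ge0.
have := dotp_ge0 (dotp v v *: u - dotp u v *: v).
rewrite !dotpE (dotpC v u) => h.
rewrite -subr_ge0 -(pmulr_rge0 _ vp); move: h; congr (_ <= _); ring.
Qed.

(* Gram determinant of three unit vectors with pairwise inner products a, b, c *)
Definition vol2 (a b c : R) := 1 + 2 * a * b * c - a ^+ 2 - b ^+ 2 - c ^+ 2.

Lemma dotp_sqr_le1 u v : dotp u u = 1 -> dotp v v = 1 -> dotp u v ^+ 2 <= 1.
Proof. by move=> u1 v1; have := dotp_CS u v; rewrite u1 v1 mulr1. Qed.

(** Cauchy-Schwarz for the components of [i] and [j] orthogonal to [t]; the difference of its two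
    sides is [vol2]. *)
Lemma vol2_ge0 (t i j : 'rV[R]_d) : dotp t t = 1 -> dotp i i = 1 -> dotp j j = 1 ->
  0 <= vol2 (dotp t i) (dotp t j) (dotp i j).
Proof.
move=> t1 i1 j1.
have := dotp_CS (i - dotp t i *: t) (j - dotp t j *: t).
rewrite !dotpE (dotpC j t) (dotpC i t) t1 i1 j1 -subr_ge0 /vol2.
by congr (_ <= _); ring.
Qed.

(* In the orthogonal complement of i: two vectors close to the line spanned by
   the projection of j span a small area. *)
Lemma vol2_quasi_triangle (i j t s : 'rV[R]_d) :
  dotp i i = 1 -> dotp j j = 1 -> dotp t t = 1 -> dotp s s = 1 ->
  (1 - dotp i j ^+ 2) * vol2 (dotp i t) (dotp i s) (dotp t s) <=
  3 * (vol2 (dotp i j) (dotp i t) (dotp j t) +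
       vol2 (dotp i j) (dotp i s) (dotp j s)).
Proof.
move=> i1 j1 t1 s1.
set U := 1 - _ ^+ 2; set A := vol2 (dotp i j) (dotp i t) _.
set B := vol2 (dotp i j) _ _; set G := vol2 (dotp i t) _ _.
have A0 : 0 <= A by exact: vol2_ge0.
have B0 : 0 <= B by exact: vol2_ge0.
have : 0 <= U by rewrite subr_ge0 dotp_sqr_le1.
rewrite le_eqVlt => /orP[/eqP <-|Up]; first by rewrite mul0r mulr_ge0// addr_ge0.
(* Components orthogonal to [i]. The parts of [p] and [q] orthogonal to [u] have squared norms
   [A / U] and [B / U] and inner product [K / U]; the bound [KAB] below is Cauchy-Schwarz for
   them. *)
pose p := t - dotp i t *: i; pose q := s - dotp i s *: i; pose u := j - dotp i j *: i.
pose P := dotp p u; pose Q := dotp q u; pose K := U * dotp p q - P * Q.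
have uu : dotp u u = U by rewrite !dotpE (dotpC j i) i1 j1 /U; ring.
have pp : U * dotp p p = P ^+ 2 + A.
  rewrite /P /A /vol2 !dotpE !(dotpC _ i) (dotpC t j) i1 t1 /U; ring.
have qq : U * dotp q q = Q ^+ 2 + B.
  rewrite /Q /B /vol2 !dotpE !(dotpC _ i) (dotpC s j) i1 s1 /U; ring.
have GE : dotp p p * dotp q q - dotp p q ^+ 2 = G.
  rewrite /G /vol2 !dotpE !(dotpC _ i) i1 s1 t1; ring.
have p1 : dotp p p <= 1.
  rewrite !dotpE (dotpC t i) i1 t1 -subr_ge0.
  by apply: le_trans (sqr_ge0 (dotp i t)) _; rewrite le_eqVlt; apply/orP; left; apply/eqP; ring.
have q1 : dotp q q <= 1.
  rewrite !dotpE (dotpC s i) i1 s1 -subr_ge0.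
  by apply: le_trans (sqr_ge0 (dotp i s)) _; rewrite le_eqVlt; apply/orP; left; apply/eqP; ring.
have PU : P ^+ 2 + A <= U by rewrite -pp ger_pMr.
have QU : Q ^+ 2 + B <= U by rewrite -qq ger_pMr.
clearbody p q u.
have KAB : K ^+ 2 <= A * B.
  have := dotp_CS (U *: p - P *: u) (U *: q - Q *: u).
  rewrite !dotpE uu (dotpC u p) (dotpC u q) -/P -/Q.
  rewrite [X in X ^+ 2 <= _](_ : _ = U * K); last by rewrite /K; ring.
  rewrite [X in _ <= X * _](_ : _ = U * A); last first.
    by rewrite -[A](addKr (P ^+ 2)) -pp; ring.
  rewrite [X in _ <= _ * X](_ : _ = U * B); last first.
    by rewrite -[B](addKr (Q ^+ 2)) -qq; ring.
  by rewrite [U * A * _]mulrACA -[U * U]expr2 exprMn ler_pM2l// exprn_gt0.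
have UG : U ^+ 2 * G = (P ^+ 2 + A) * (Q ^+ 2 + B) - (P * Q + K) ^+ 2.
  rewrite -pp -qq -GE /K; ring.
rewrite -(ler_pM2l Up) mulrA -expr2 UG.
move: (sqr_ge0 P) (sqr_ge0 Q) => P2 Q2.
clearbody K P Q A B G U => {pp qq GE uu}.
(* Expanding, [U ^+ 2 * G = P^2 B + Q^2 A + A B - 2 P Q K - K^2]. The cross term is at most
   [P^2 B + Q^2 A] by the arithmetic-geometric mean inequality, and [P^2], [Q^2] and [A] are at most
   [U]: the total is at most [U (2 A + 3 B)], whence the constant 3. *)
have PQK : - 2 * (P * Q * K) <= P ^+ 2 * B + Q ^+ 2 * A.
  have X0 : 0 <= P ^+ 2 * B + Q ^+ 2 * A by apply: addr_ge0; apply: mulr_ge0.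
  apply: le_trans (ler_norm _) _.
  rewrite -(@ler_pXn2r _ 2%N) ?nnegrE// real_normK ?num_real//.
  have -> : (- 2 * (P * Q * K)) ^+ 2 = 4 * (P ^+ 2 * Q ^+ 2) * K ^+ 2 by ring.
  apply: (@le_trans _ _ (4 * (P ^+ 2 * Q ^+ 2) * (A * B))).
    by apply: ler_wpM2l => //; apply: mulr_ge0 => //; apply: mulr_ge0.
  rewrite -subr_ge0; apply: le_trans (sqr_ge0 (P ^+ 2 * B - Q ^+ 2 * A)) _.
  by rewrite le_eqVlt; apply/orP; left; apply/eqP; ring.
have h1 : P ^+ 2 * B <= U * B by rewrite ler_wpM2r//; lra.
have h2 : Q ^+ 2 * A <= U * A by rewrite ler_wpM2r//; lra.
have h3 : A * B <= U * B by rewrite ler_wpM2r//; have := sqr_ge0 P; lra.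
have h4 : 0 <= U * A by rewrite mulr_ge0// ltW.
have := sqr_ge0 K.
lra.
Qed.

End DotProduct.

(** * Families with few correlated pairs, and their projections *)

(* min (1 / sqrt (1 - c^2), N), also when c^2 = 1 and the first argument is +oo *)
Definition wt {R : realType} (N : nat) (c : R) : R :=
  (Num.max (Num.sqrt (1 - c ^+ 2)) N%:R^-1)^-1.

Section Wt.
Context {R : realType}.
Implicit Types c : R.

Lemma wt_ge1 N c : (0 < N)%N -> 1 <= wt N c.
Proof.
move=> N0; have N0' : 0 < N%:R^-1 :> R by rewrite invr_gt0 ltr0n.
rewrite -[leLHS]invr1 lef_pV2 ?posrE ?lt_max ?N0' ?orbT// ge_max.
rewrite invf_le1 ?ltr0n// ler1n N0 andbT -[leRHS]sqrtr1 ler_wsqrtr//.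
by rewrite gerBl sqr_ge0.
Qed.

Lemma wt_ge0 N c : 0 <= wt N c.
Proof. by rewrite invr_ge0 le_max sqrtr_ge0. Qed.

Lemma wt_le_nat N c : (0 < N)%N -> wt N c <= N%:R.
Proof.
move=> N0; have N0' : 0 < N%:R^-1 :> R by rewrite invr_gt0 ltr0n.
rewrite -[leRHS]invrK lef_pV2 ?posrE ?lt_max ?N0' ?orbT//.
by rewrite le_max lexx orbT.
Qed.

End Wt.

(** * Counting the pairs whose projections are crowded *)

Section HeavyPairs.
Context {R : realType} {T : finType}.
Variables (N : nat) (A : {set T}) (c : T -> T -> R) (eta L : R).
Hypotheses (N_gt0 : (0 < N)%N) (cardA : (#|A| <= N)%N).
Hypotheses (eta_gt0 : 0 < eta) (eta_small : eta <= 4^-1) (etaL : eta <= L).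
Hypothesis cC : forall i j, c i j = c j i.
Hypothesis c_le1 : {in A &, forall i j, c i j ^+ 2 <= 1}.
Hypothesis vol_ge0 : {in A & &, forall t i j, 0 <= vol2 (c t i) (c t j) (c i j)}.
Hypothesis quasi : forall i j t s, i \in A -> j \in A -> t \in A -> s \in A ->
  (1 - c i j ^+ 2) * vol2 (c i t) (c i s) (c t s) <=
  3 * (vol2 (c i j) (c i t) (c j t) + vol2 (c i j) (c i s) (c j s)).

Definition bad (i j : T) := (i != j) && (eta <= `|c i j|).
Definition apart (i j : T) := `|c i j| < eta.
Definition vol (t i j : T) := Num.sqrt (vol2 (c t i) (c t j) (c i j)).

Hypothesis degree_le : {in A, forall i,
  \sum_(j in A | bad i j) wt N (c i j) <= eta * N%:R}.

(** For [t] apart from [i] and [j], the sine of the angle between the projections of [i] and [j]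
    along [t] is comparable to [vol t i j]. With [e] about [N^-1] this is therefore the weighted
    degree of [i] after projection along [t]. *)
Definition crowd (t i : T) (e : R) :=
  \sum_(j in A | apart t j && bad i j) (Num.max (vol t i j) e)^-1.

Definition mesh (k : nat) : R := (2 ^+ k)^-1.
(** The first dyadic scale below the cutoff [N^-1] of [wt]; its inverse is still at most [2 * N],
    which bounds every term of a crowd. *)
Definition depth := up_log 2 N.
(** Symmetric in [t] and [i], because the quasi-triangle inequality turns a sum over [t] of terms of
    [crowd t i] into a crowd with the roles exchanged, and both must stop at the same mesh. *)
Definition crowded (t i : T) (k : nat) :=
  (L * N%:R <= crowd t i (mesh k)) || (L * N%:R <= crowd i t (mesh k)).
(* Index of the coarsest dyadic mesh at which t or i sees a crowd of size L N. *)
Definition stop (t i : T) := find (crowded t i) (iota 0 depth.+1).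
Definition heavy (t i : T) := apart t i && has (crowded t i) (iota 0 depth.+1).

Lemma crowdedC t i k : crowded t i k = crowded i t k.
Proof. by rewrite /crowded orbC. Qed.

Lemma apartC t i : apart t i = apart i t. Proof. by rewrite /apart cC. Qed.
Lemma stopC t i : stop t i = stop i t.
Proof. by apply: eq_find => k; rewrite crowdedC. Qed.

Lemma heavyC t i : heavy t i = heavy i t.
Proof. by rewrite /heavy apartC; congr (_ && _); apply: eq_has => k; rewrite crowdedC. Qed.

Lemma mesh_gt0 k : 0 < mesh k. Proof. by rewrite invr_gt0 exprn_gt0. Qed.

Lemma N0R : 0 < N%:R :> R. Proof. by rewrite ltr0n. Qed.

Lemma invmesh_le k : (k <= depth)%N -> (mesh k)^-1 <= 2 * N%:R.
Proof.
move=> kd; rewrite invrK; apply: (@le_trans _ _ (2 ^+ depth)).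
  by rewrite ler_weXn2l// ler1n.
rewrite -natrX -natrM ler_nat /depth.
have [->|N1] := eqVneq N 1%N; first by rewrite up_log1.
have lN : (1 < N)%N by lia.
have := @up_log_gtn 2 N isT lN.
have : (0 < up_log 2 N)%N by rewrite up_log_gt0.
by case: (up_log 2 N) => // k' _ /=; rewrite expnS; lia.
Qed.

Lemma mesh_depth : mesh depth <= N%:R^-1.
Proof.
rewrite lef_pV2 ?posrE ?exprn_gt0 ?N0R// -natrX ler_nat.
exact: up_logP.
Qed.

Lemma max_gt0 x e : 0 < e -> 0 < Num.max x e :> R.
Proof. by rewrite lt_max => ->; rewrite orbT. Qed.

Lemma crowd_half t i k : crowd t i (mesh k.+1) <= 2 * crowd t i (mesh k).
Proof.
rewrite /crowd mulr_sumr; apply: ler_sum => j _.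
have h : mesh k.+1 = 2^-1 * mesh k by rewrite /mesh exprS invfM.
rewrite -{1}[2]invrK -invfM lef_pV2 ?posrE ?max_gt0 ?mulr_gt0 ?max_gt0 ?mesh_gt0//.
rewrite h le_max; have := sqrtr_ge0 (vol2 (c t i) (c t j) (c i j)).
rewrite -/(vol t i j) => v0; case: (leP (vol t i j) (mesh k)) => hv.
  by rewrite lexx orbT.
by apply/orP; left; lra.
Qed.

Lemma crowd_mesh0 t i : i \in A -> crowd t i (mesh 0) <= L * N%:R.
Proof.
move=> iA; apply: (@le_trans _ _ (eta * N%:R)); last by rewrite ler_wpM2r.
apply: le_trans (degree_le iA); rewrite /crowd.
rewrite [leRHS](bigID (apart t))/= -[leLHS]addr0 lerD//; last first.
  by apply: sumr_ge0 => *; exact: wt_ge0.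
rewrite (eq_bigl (fun j => (j \in A) && bad i j && apart t j)); last first.
  by move=> j; rewrite [apart t j && _]andbC andbA.
apply: ler_sum => j _; apply: le_trans (wt_ge1 _ N_gt0).
by rewrite invf_le1 ?max_gt0 ?mesh_gt0// le_max /mesh expr0 invr1 lexx orbT.
Qed.

Lemma heavyP t i : heavy t i -> [/\ apart t i, (stop t i <= depth)%N &
  crowded t i (stop t i)].
Proof.
move=> /andP[g h]; split => //; first by move: h; rewrite has_find size_iota ltnS.
have := nth_find 0%N h; rewrite nth_iota ?add0n//.
by move: h; rewrite has_find size_iota.
Qed.

(** One index before stopping the crowd is below [L * N], and halving the mesh at most doubles it;
    at index 0 the degree bound applies. *)
Lemma crowd_stop t i : i \in A -> heavy t i -> crowd t i (mesh (stop t i)) <= 2 * L * N%:R.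
Proof.
move=> iA h; have [g sd _] := heavyP h.
have L0 : 0 <= L by exact: le_trans (ltW eta_gt0) etaL.
case E : (stop t i) sd => [|k] sd.
  by apply: (le_trans (crowd_mesh0 _ iA)); rewrite ler_wpM2r// ler_peMl// ler1n.
apply: (le_trans (crowd_half t i k)); rewrite -mulrA ler_pM2l//.
have := @before_find _ 0%N (crowded t i) (iota 0 depth.+1) k.
rewrite -/(stop t i) E ltnS leqnn => /(_ isT).
rewrite nth_iota ?add0n; last by lia.
by move=> /negbT; rewrite negb_or -!ltNge => /andP[/ltW].
Qed.

Lemma vol_good t i j : t \in A -> i \in A -> j \in A ->
  apart t i -> apart t j -> apart i j -> 2^-1 <= vol t i j.
Proof.
move=> tA iA jA; rewrite /apart => ti tj ij.
have sq x : `|x| < eta -> x ^+ 2 <= eta ^+ 2.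
  by move=> /ltW h; rewrite -(real_normK (num_real x)) ler_pXn2r ?nnegrE//; exact: ltW.
rewrite -(@ler_pXn2r _ 2%N) ?nnegrE ?sqrtr_ge0// sqr_sqrtr; last exact: vol_ge0.
have := sq _ ti; have := sq _ tj; have := sq _ ij.
have e2 : eta ^+ 2 <= 16^-1.
  have := ler_pM (ltW eta_gt0) (ltW eta_gt0) eta_small eta_small.
  by rewrite -expr2; lra.
have p3 : - (2 * c t i * c t j * c i j) <= 2 * (4^-1 ^+ 3).
  apply: le_trans (ler_norm _) _; rewrite normrN !normrM ger0_norm//.
  rewrite -!mulrA ler_pM2l// exprS expr2.
  have le4 x : x < eta -> x <= 4^-1 by move=> /ltW/le_trans; exact.
  by apply: ler_pM => //; [exact: le4|apply: ler_pM => //; exact: le4].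
rewrite /vol2 => *; lra.
Qed.

(* Summing over the light ends t of heavy pairs (t, i), the nearest t (for the
   distance to the plane spanned by i and j, cut at the stopping mesh) controls
   the whole sum through its own crowd. *)
Lemma sum_heavy_le i j : i \in A -> j \in A -> bad i j ->
  \sum_(t in A | heavy t i) (Num.max (vol t i j) (mesh (stop t i)))^-1 <=
  wt N (c i j) * (8 * (L + 2) * N%:R).
Proof.
move=> iA jA bij.
have L0 : 0 <= L by exact: le_trans (ltW eta_gt0) etaL.
have NR := N0R.
pose a := Num.sqrt (1 - c i j ^+ 2).
(* If [i] and [j] are within [N^-1] of being parallel, their weight is [N], and bounding each of at
   most [N] terms by [2 * N] suffices. *)
have [aN|aN] := ltP a N%:R^-1.
  have -> : wt N (c i j) = N%:R by rewrite /wt -/a max_r ?invrK// ltW.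
  apply: (@le_trans _ _ (\sum_(t in A | heavy t i) (2 * N%:R))).
    apply: ler_sum => t /andP[tA /heavyP[_ sd _]].
    apply: le_trans (invmesh_le sd).
    by rewrite lef_pV2 ?posrE ?max_gt0 ?mesh_gt0// le_max lexx orbT.
  rewrite sumr_const -[leLHS]mulr_natl; apply: ler_pM => //.
  - rewrite ler_nat; apply: leq_trans cardA; apply: subset_leq_card.
    by apply/fintype.subsetP => t /andP[].
  - by rewrite ler_wpM2r//; lra.
have a0 : 0 < a by apply: lt_le_trans aN; rewrite invr_gt0.
have a1 : a <= 1 by rewrite -[leRHS]sqrtr1 ler_wsqrtr// gerBl sqr_ge0.
have -> : wt N (c i j) = a^-1 by rewrite /wt -/a max_l.
pose m t := Num.max (vol t i j / a) (mesh (stop t i)).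
have m0 t : 0 < m t by exact: max_gt0 (mesh_gt0 _).
have [t0 Pt0|none] := pickP (fun t => (t \in A) && heavy t i); last first.
  by rewrite big_pred0// !mulr_ge0 ?invr_ge0 ?addr_ge0// ltW.
have [s Ps smin] := @arg_minP _ R T t0 (fun t => (t \in A) && heavy t i) m Pt0.
move/andP: Ps => [sA sh].
have [sg sd _] := heavyP sh.
(* As [m s <= m t], the quasi-triangle inequality bounds the squared area by
   [3 * (1 + 1) * m t ^+ 2]; rounding 6 up to 16 gives the factor 4. *)
have vol_le t : t \in A -> heavy t i ->
    Num.max (vol i s t) (mesh (stop i s)) <= 4 * m t.
  move=> tA th; have := smin t; rewrite /= tA th => /(_ isT) mst.
  have mt0 := m0 t; rewrite ge_max; apply/andP; split; last first.
    rewrite stopC; apply: (@le_trans _ _ (m s)); first by rewrite le_max lexx orbT.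
    by lra.
  have vm u : u \in A -> heavy u i -> vol2 (c i j) (c i u) (c j u) <= a ^+ 2 * m u ^+ 2.
    move=> uA uh.
    have -> : vol2 (c i j) (c i u) (c j u) = vol u i j ^+ 2.
      rewrite sqr_sqrtr; last exact: vol_ge0.
      by rewrite (cC u i) (cC u j) /vol2; ring.
    rewrite -exprMn ler_pXn2r ?nnegrE ?sqrtr_ge0//; last by rewrite mulr_ge0 ?ltW.
    by rewrite mulrC -ler_pdivrMr// le_max lexx.
  have q := quasi iA jA sA tA.
  have a2 : 1 - c i j ^+ 2 = a ^+ 2 by rewrite sqr_sqrtr// subr_ge0 c_le1.
  have v2 : vol2 (c i s) (c i t) (c s t) <= (4 * m t) ^+ 2.
    have := vm s sA sh; have := vm t tA th; rewrite a2 in q => vt vs.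
    have ap : 0 < a ^+ 2 by rewrite exprn_gt0.
    have ms2 : m s ^+ 2 <= m t ^+ 2 by rewrite ler_pXn2r ?nnegrE//; exact: ltW.
    have := ler_wpM2l (ltW ap) ms2 => ams.
    rewrite -(ler_pM2l ap); apply: (le_trans q).
    have amt : 0 <= a ^+ 2 * m t ^+ 2 by rewrite mulr_ge0 ?sqr_ge0.
    rewrite [X in _ <= X](_ : _ = 16 * (a ^+ 2 * m t ^+ 2)); last by ring.
    by lra.
  have m4 : 0 <= 4 * m t by rewrite mulr_ge0// ltW.
  rewrite -(@ler_pXn2r _ 2%N) ?nnegrE ?sqrtr_ge0//.
  by rewrite sqr_sqrtr//; exact: vol_ge0.
(* Three kinds of [t]: those correlated with [s] form part of the crowd of [(i, s)] at its stopping
   mesh; [t = s] is a single term; the others are apart from [s] and [i], so that their area is at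
   least [2^-1]. *)
have vol_s : \sum_(t in A | heavy t i) (Num.max (vol i s t) (mesh (stop i s)))^-1 <=
    2 * (L + 2) * N%:R.
  have iN t : (Num.max (vol i s t) (mesh (stop i s)))^-1 <= 2 * N%:R.
    rewrite stopC; apply: le_trans (invmesh_le sd).
    by rewrite lef_pV2 ?posrE ?max_gt0 ?mesh_gt0// le_max lexx orbT.
  have i0 t : 0 <= (Num.max (vol i s t) (mesh (stop i s)))^-1.
    by rewrite invr_ge0 ltW// max_gt0// mesh_gt0.
  rewrite (bigID (bad s))/=.
  have -> : 2 * (L + 2) * N%:R = 2 * L * N%:R + (2 * N%:R + 2 * N%:R) by ring.
  apply: lerD.
    apply: le_trans (@crowd_stop i s sA _); last by rewrite heavyC.
    rewrite /crowd [leRHS](bigID (fun t => heavy t i))/= -[leLHS]addr0 lerD//; last first.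
      by apply: sumr_ge0.
    rewrite [leLHS]big_mkcond [leRHS]big_mkcond; apply: ler_sum => t _.
    case: ifP => [/andP[/andP[-> h] ->]|_]; last by case: ifP.
    by rewrite h; have [gti _ _] := heavyP h; rewrite apartC gti.
  rewrite (bigID (pred1 s))/= lerD//.
    apply: (@le_trans _ _ (\sum_(t | t == s) (Num.max (vol i s t) (mesh (stop i s)))^-1)); last first.
      by rewrite big_pred1_eq.
    rewrite [leLHS]big_mkcond [leRHS]big_mkcond; apply: ler_sum => t _.
    by case: ifP => [/andP[_ ->]//|_]; case: ifP.
  apply: (@le_trans _ _ (\sum_(t in A) 2)); last first.
    by rewrite sumr_const -[leLHS]mulr_natr ler_pM2l// ler_nat.
  rewrite [leLHS]big_mkcond [leRHS]big_mkcond; apply: ler_sum => t _.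
  case: ifP => [/andP[/andP[/andP[tA h]]]|_]; last by case: ifP.
  rewrite /bad eq_sym => nb ts; rewrite tA; move: nb; rewrite ts/= -ltNge => gst.
  have [gti _ _] := heavyP h.
  rewrite -[leRHS]invrK lef_pV2 ?posrE ?max_gt0 ?mesh_gt0// le_max.
  by rewrite vol_good// apartC.
apply: (@le_trans _ _ (a^-1 * (4 * \sum_(t in A | heavy t i)
    (Num.max (vol i s t) (mesh (stop i s)))^-1))); last first.
  have a0i : 0 <= a^-1 by rewrite invr_ge0 ltW.
  apply: ler_wpM2l => //.
  have -> : 8 * (L + 2) * N%:R = 4 * (2 * (L + 2) * N%:R) by ring.
  by rewrite ler_pM2l.
rewrite !mulr_sumr; apply: ler_sum => t /andP[tA th].
have am : a * m t <= Num.max (vol t i j) (mesh (stop t i)).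
  rewrite /m maxr_pMr; last exact: ltW.
  rewrite mulrCA divff ?gt_eqF// mulr1.
  rewrite ge_max !le_max lexx/=; apply/orP; right.
  by rewrite ger_pMl// mesh_gt0.
have mt0 := m0 t.
apply: (@le_trans _ _ (a^-1 * (m t)^-1)).
  by rewrite -invfM lef_pV2 ?posrE ?max_gt0 ?mesh_gt0 ?mulr_gt0.
rewrite ler_pM2l ?invr_gt0// -[4 in leRHS]invrK -invfM.
have := vol_le t tA th => vl.
rewrite lef_pV2 ?posrE ?mulr_gt0 ?invr_gt0 ?max_gt0 ?mesh_gt0//.
rewrite mulrC ler_pdivrMr// mulrC//.
Qed.

(** With the sums interchanged, the inner sum over [t] is bounded by the weight of the bad pair
    [(i, j)], and the degree bound then sums these weights. *)
Lemma sum_crowd_le :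
  \sum_(t in A) \sum_(i in A | heavy t i) crowd t i (mesh (stop t i)) <=
  8 * (L + 2) * eta * N%:R ^+ 3.
Proof.
have L0 : 0 <= L by exact: le_trans (ltW eta_gt0) etaL.
have NR := N0R.
have -> : \sum_(t in A) \sum_(i in A | heavy t i) crowd t i (mesh (stop t i)) =
    \sum_(i in A) \sum_(t in A | heavy t i) crowd t i (mesh (stop t i)).
  rewrite [LHS](exchange_big_dep (fun i => i \in A))/=; last by move=> t i _ /andP[].
  by apply: eq_bigr => i iA; apply: eq_bigl => t; rewrite iA.
apply: (@le_trans _ _ (\sum_(i in A) \sum_(j in A | bad i j)
    \sum_(t in A | heavy t i) (Num.max (vol t i j) (mesh (stop t i)))^-1)).
  apply: ler_sum => i iA.
  rewrite [leRHS](exchange_big_dep (fun t => (t \in A) && heavy t i))/=; last by [].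
  apply: ler_sum => t /andP[tA th]; rewrite /crowd.
  rewrite [leLHS]big_mkcond [leRHS]big_mkcond; apply: ler_sum => j _.
  have i0 : 0 <= (Num.max (vol t i j) (mesh (stop t i)))^-1.
    by rewrite invr_ge0 ltW// max_gt0// mesh_gt0.
  case: ifP => [/and3P[-> _ ->]|_]; last by case: ifP.
  by rewrite tA th.
apply: (@le_trans _ _ (\sum_(i in A) (eta * N%:R) * (8 * (L + 2) * N%:R))).
  apply: ler_sum => i iA.
  apply: (@le_trans _ _ (\sum_(j in A | bad i j) wt N (c i j) * (8 * (L + 2) * N%:R))).
    by apply: ler_sum => j /andP[jA bij]; exact: sum_heavy_le.
  rewrite -mulr_suml ler_wpM2r ?degree_le// !mulr_ge0 ?addr_ge0// ltW//.
rewrite sumr_const -[leLHS]mulr_natl.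
have -> : 8 * (L + 2) * eta * N%:R ^+ 3 = N%:R * (eta * N%:R * (8 * (L + 2) * N%:R)) by ring.
by rewrite ler_wpM2r ?ler_nat// !mulr_ge0 ?addr_ge0// ltW.
Qed.

(** Markov's inequality: at the stopping mesh [crowd t i] or [crowd i t] is at least [L * N].
    Counting both orders doubles the bound of [sum_crowd_le]. *)
Lemma card_heavy_le : L * \sum_(t in A) \sum_(i in A | heavy t i) 1 <=
  16 * (L + 2) * eta * N%:R ^+ 2.
Proof.
have NR := N0R.
rewrite -(ler_pM2r NR).
have -> : 16 * (L + 2) * eta * N%:R ^+ 2 * N%:R = 2 * (8 * (L + 2) * eta * N%:R ^+ 3) by ring.
apply: le_trans (ler_wpM2l _ sum_crowd_le) => //.
have -> : 2 * (\sum_(t in A) \sum_(i in A | heavy t i) crowd t i (mesh (stop t i))) =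
   \sum_(t in A) \sum_(i in A | heavy t i)
     (crowd t i (mesh (stop t i)) + crowd i t (mesh (stop t i))).
  rewrite mulrDl mul1r.
  under [RHS]eq_bigr do rewrite big_split.
  rewrite big_split; congr (_ + _).
  rewrite [RHS](exchange_big_dep (fun i => i \in A))//=; last by move=> t i _ /andP[].
  apply: eq_bigr => i iA; apply: eq_big => t; first by rewrite heavyC iA.
  by rewrite stopC.
rewrite mulrAC mulr_sumr; apply: ler_sum => t tA.
rewrite mulr_sumr; apply: ler_sum => i /andP[iA h]; rewrite mulr1.
have c0 u v k : 0 <= crowd u v (mesh k).
  by apply: sumr_ge0 => j _; rewrite invr_ge0 ltW// max_gt0// mesh_gt0.
have [_ _ /orP[]] := heavyP h => /le_trans; apply.
  by rewrite lerDl.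
by rewrite lerDr.
Qed.

(** A pair that never stops has a crowd below [L * N] at the last mesh too, and that mesh is finer
    than [N^-1]. *)
Lemma crowd_not_heavy t i : apart t i -> ~~ heavy t i ->
  \sum_(j in A | apart t j && bad i j) (Num.max (vol t i j) N%:R^-1)^-1 <= L * N%:R.
Proof.
rewrite /heavy => ->; rewrite andTb -all_predC => /allP /(_ depth).
rewrite mem_iota leq0n add0n ltnS leqnn => /(_ isT) /=.
rewrite negb_or -!ltNge => /andP[/ltW h _]; apply: le_trans h.
apply: ler_sum => j _; have NR := N0R.
rewrite lef_pV2 ?posrE ?max_gt0 ?mesh_gt0 ?invr_gt0//.
by rewrite ge_max !le_max lexx mesh_depth/= orbT.
Qed.

End HeavyPairs.

(* Inner product, after projection to the orthogonal complement of t and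
   normalization, of two unit vectors i and k *)
Definition proj_corr {R : realType} (cti ctk cik : R) : R :=
  (cik - cti * ctk) / (Num.sqrt (1 - cti ^+ 2) * Num.sqrt (1 - ctk ^+ 2)).

Section ProjCorr.
Context {R : realType}.
Implicit Types a b x eta : R.

Lemma abs_lt_sqr a eta : 0 <= eta -> `|a| < eta -> a ^+ 2 < eta ^+ 2.
Proof.
move=> eta0 h; rewrite -(real_normK (num_real a)).
by rewrite ltr_pXn2r ?nnegrE.
Qed.

Lemma onemsq_ge a : `|a| < 4^-1 -> 4^-1 < 1 - a ^+ 2.
Proof.
have q0 : 0 <= 4^-1 :> R by rewrite invr_ge0.
by move=> /(abs_lt_sqr q0); rewrite [(4^-1) ^+ 2]expr2; lra.
Qed.

Lemma sqrt_onemsq_ge a : `|a| < 4^-1 -> 2^-1 < Num.sqrt (1 - a ^+ 2).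
Proof.
move=> /onemsq_ge h; have h0 : 0 <= 1 - a ^+ 2 by lra.
rewrite -(@ltr_pXn2r _ 2%N) ?nnegrE ?sqrtr_ge0//.
by rewrite sqr_sqrtr// expr2; lra.
Qed.

Lemma wt_le2 N a : `|a| < 4^-1 -> wt N a <= 2.
Proof.
move=> /sqrt_onemsq_ge h; rewrite -[leRHS]invrK lef_pV2 ?posrE.
- by rewrite le_max ltW.
- by rewrite lt_max; apply/orP; left; apply: lt_trans h; rewrite invr_gt0.
- by rewrite invr_gt0.
Qed.

Lemma proj_corrE a b x : `|a| < 4^-1 -> `|b| < 4^-1 ->
  1 - proj_corr a b x ^+ 2 = vol2 a b x / ((1 - a ^+ 2) * (1 - b ^+ 2)).
Proof.
move=> /onemsq_ge ha /onemsq_ge hb; rewrite /proj_corr exprMn exprVn exprMn.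
rewrite !sqr_sqrtr; [|lra|lra]; rewrite /vol2.
by field; apply/andP; split; apply/eqP; lra.
Qed.

(** By [proj_corrE] the squared sine after projection is [vol2] divided by two factors at most 1. *)
Lemma wt_proj_le N a b x : (0 < N)%N -> `|a| < 4^-1 -> `|b| < 4^-1 ->
  wt N (proj_corr a b x) <= (Num.max (Num.sqrt (vol2 a b x)) N%:R^-1)^-1.
Proof.
move=> N0 ha hb; have N0' : 0 < N%:R^-1 :> R by rewrite invr_gt0 ltr0n.
rewrite lef_pV2 ?posrE ?lt_max ?N0' ?orbT//.
rewrite ge_max !le_max lexx orbT andbT; have [v0|v0] := leP (vol2 a b x) 0.
  by rewrite (ler0_sqrtr v0) sqrtr_ge0.
rewrite ler_wsqrtr// proj_corrE//.
move/onemsq_ge : ha => ha; move/onemsq_ge : hb => hb.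
rewrite ler_pdivlMr ?mulr_gt0//; [|lra|lra].
rewrite ger_pMr// mulr_ile1//; [lra|lra| |]; by rewrite gerBl sqr_ge0.
Qed.

Lemma proj_corr_lt eta a b x : 0 < eta -> eta <= 4^-1 -> `|a| < eta -> `|b| < eta ->
  `|x| < eta -> `|proj_corr a b x| < 8 * eta.
Proof.
move=> e0 e4 ha hb hx.
have /sqrt_onemsq_ge sa : `|a| < 4^-1 by exact: lt_le_trans e4.
have /sqrt_onemsq_ge sb : `|b| < 4^-1 by exact: lt_le_trans e4.
have s0 : 4^-1 < Num.sqrt (1 - a ^+ 2) * Num.sqrt (1 - b ^+ 2).
  apply: (@le_lt_trans _ _ (2^-1 * 2^-1)); first lra.
  by apply: ltr_pM => //; rewrite invr_ge0.
rewrite /proj_corr normrM normfV [X in _ / X]ger0_norm ?mulr_ge0 ?sqrtr_ge0//.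
rewrite ltr_pdivrMr; last lra.
have ab : `|a * b| <= eta * 4^-1.
  rewrite normrM; apply: ler_pM => //; first exact: ltW.
  exact: ltW (lt_le_trans hb e4).
apply: le_lt_trans (ler_normB _ _) _.
by have : 8 * eta * 4^-1 < 8 * eta * (Num.sqrt (1 - a ^+ 2) * Num.sqrt (1 - b ^+ 2));
  [rewrite ltr_pM2l// mulr_gt0//|lra].
Qed.

End ProjCorr.

(** The properties of Gram matrices of unit vectors on which the heavy-pair count rests, detached
    from the vectors. *)
Definition gram_like {R : realType} (T : finType) (A : {set T}) (c : T -> T -> R) :=
  [/\ forall i j, c i j = c j i,
      {in A &, forall i j, c i j ^+ 2 <= 1},
      {in A & &, forall t i j, 0 <= vol2 (c t i) (c t j) (c i j)} &
      forall i j t s, i \in A -> j \in A -> t \in A -> s \in A ->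
        (1 - c i j ^+ 2) * vol2 (c i t) (c i s) (c t s) <=
        3 * (vol2 (c i j) (c i t) (c j t) + vol2 (c i j) (c i s) (c j s))].

Definition sparse_corr {R : realType} (T : finType) (N : nat) (A : {set T})
    (c : T -> T -> R) (eta : R) :=
  {in A, forall i, \sum_(j in A | (i != j) && (eta <= `|c i j|)) wt N (c i j) <=
                   eta * N%:R}.

Lemma card_sum1 {R : realType} (T : finType) (P : pred T) :
  \sum_(i | P i) 1 = #|P|%:R :> R.
Proof. by rewrite sumr_const. Qed.

(* Projecting a sparsely correlated family along most of its members, and
   dropping a few points, keeps it sparsely correlated. *)
Lemma projection_sparse {R : realType} (eps : R) : 0 < eps -> exists2 eta : R,
  0 < eta <= eps &
  forall (T : finType) (N : nat) (A : {set T}) (c : T -> T -> R),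
    1 <= eta * N%:R -> (#|A| <= N)%N -> gram_like A c -> sparse_corr N A c eta ->
    exists (J : {set T}) (S : T -> {set T}),
    [/\ J \subset A, #|A :\: J|%:R <= eps * N%:R &
     {in J, forall t, [/\ S t \subset A, t \notin S t,
       #|A :\: S t|%:R <= eps * N%:R & {in S t, forall i, `|c t i| < eps}] /\
       \sum_(i in A | (i \notin S t) && (i != t)) wt N (c t i) <= eps * N%:R /\
       sparse_corr N (S t) (fun i k => proj_corr (c t i) (c t k) (c i k)) eps}].
Proof.
move=> eps00.
(* For [eps > 1] the data found at 1 serve: the bounds weaken, and a higher threshold leaves fewer
   correlated pairs. *)
wlog eps1 : eps eps00 / eps <= 1.
  move=> H; have [|eps1] := leP eps 1; first exact: H.
  have [eta /andP[e0 e1] He] := H 1 ltr01 (lexx 1).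
  exists eta; first by rewrite e0/= (le_trans e1)// ltW.
  move=> T N A c h1 h2 h3 h4; have [J [S [JA AJ HS]]] := He T N A c h1 h2 h3 h4.
  have le1 (x : R) : 0 <= x -> x <= 1 * N%:R -> x <= eps * N%:R.
    by move=> _ /le_trans; apply; rewrite ler_wpM2r// ltW.
  exists J, S; split => //; first exact: le1.
  move=> t tJ; have [[a1 a2 a3 a4] [a5 a6]] := HS t tJ; split; [|split].
  - split => //; first exact: le1.
    by move=> i iS; exact: lt_trans (a4 i iS) eps1.
  - by apply: le1 => //; apply: sumr_ge0 => i _; exact: wt_ge0.
  - move=> i iS; apply: le1; first by apply: sumr_ge0 => k _; exact: wt_ge0.
    apply: le_trans (a6 i iS); rewrite [leLHS]big_mkcond [leRHS]big_mkcond.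
    apply: ler_sum => k _; case: ifP => [/and3P[-> -> h]|_].
      by rewrite (le_trans (ltW eps1) h).
    by case: ifP => // _; exact: wt_ge0.
(* [e] is the level [L] of the heavy-pair count, and [eta = e ^+ 2] makes the number of heavy pairs
   at most [48 * e * N ^+ 2]. The value [eps ^+ 2 / 256] suits Markov's inequality at level
   [eps / 4 * N], because [49 * e <= 64 * e = eps ^+ 2 / 4]. *)
pose e := eps ^+ 2 / 16 / 16; pose eta := e ^+ 2.
have eps2 : eps ^+ 2 <= eps by rewrite expr2 ger_pMr.
have e0 : 0 < e by rewrite !divr_gt0// exprn_gt0.
have e256 : e <= 256^-1 by rewrite /e; lra.
have eeps : e <= eps / 256 by rewrite /e; lra.
have eta0 : 0 < eta by rewrite exprn_gt0.
have etae : eta <= e / 256 by rewrite /eta expr2 ler_pM2l.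
exists eta; first by rewrite eta0/=; lra.
move=> T N A c N1 cardA [cC c1 cv cq] deg.
have NR : 0 < N%:R :> R by rewrite -(pmulr_rgt0 _ eta0); exact: lt_le_trans N1.
have N0 : (0 < N)%N by rewrite -(ltr0n R).
have eta4 : eta <= 4^-1 by lra.
have etaL : eta <= e by lra.
pose B := bad c eta; pose G := apart c eta; pose hv := heavy N A c eta e.
have H1 : e * \sum_(t in A) \sum_(i in A | hv t i) 1 <= 16 * (e + 2) * eta * N%:R ^+ 2.
  exact: (card_heavy_le N0 cardA eta0 eta4 etaL cC c1 cv cq deg).
pose out t := #|[pred i | (i \in A) && ((i != t) && (B t i || hv t i))]|.
have sum_out : \sum_(t in A) (out t)%:R <= 49 * e * N%:R ^+ 2 :> R.
  apply: (@le_trans _ _ (\sum_(t in A) ((\sum_(i in A | B t i) wt N (c t i)) +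
                                        \sum_(i in A | hv t i) 1))).
    apply: ler_sum => t tA; rewrite /out -card_sum1.
    rewrite [leLHS]big_mkcond [X in _ <= X + _]big_mkcond [X in _ <= _ + X]big_mkcond/=.
    rewrite -big_split; apply: ler_sum => i _ /=.
    have w1 := wt_ge1 (c t i) N0.
    move: (wt N _) (B t i) (hv t i) (i \in A) (i != t) w1 => w [] [] [] [] w1 /=;
    by clear -w1; lra.
  rewrite big_split/=.
  have h1 : \sum_(t in A) \sum_(i in A | B t i) wt N (c t i) <= N%:R * (eta * N%:R).
    apply: (@le_trans _ _ (\sum_(t in A) (eta * N%:R))); first by apply: ler_sum.
    rewrite sumr_const -[leLHS]mulr_natl ler_wpM2r ?ler_nat// ltW// mulr_gt0//.
  have h2 : \sum_(t in A) \sum_(i in A | hv t i) 1 <= 48 * e * N%:R ^+ 2.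
    rewrite -(ler_pM2l e0); apply: le_trans H1 _.
    have -> : e * (48 * e * N%:R ^+ 2) = 48 * eta * N%:R ^+ 2 by rewrite /eta; ring.
    rewrite ler_pM2r ?exprn_gt0// ler_pM2r//; lra.
  have h3 : N%:R * (eta * N%:R) <= e * N%:R ^+ 2.
    have -> : N%:R * (eta * N%:R) = eta * N%:R ^+ 2 by ring.
    by rewrite ler_pM2r ?exprn_gt0//; lra.
  have -> : 49 * e * N%:R ^+ 2 = e * N%:R ^+ 2 + 48 * e * N%:R ^+ 2 by ring.
  by rewrite lerD// (le_trans h1).
pose J := [set t in A | (out t)%:R <= eps / 4 * N%:R].
pose S t := [set i in A | [&& i != t, G t i & ~~ hv t i]].
have good4 t i : G t i -> `|c t i| < 4^-1 by move=> /lt_le_trans; apply.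
have outE t i : i \in A -> i \notin S t -> i != t ->
    (i \in [pred i | (i \in A) && ((i != t) && (B t i || hv t i))]).
  move=> iA; rewrite !inE iA /= => + it; rewrite it /= negb_and negbK.
  by rewrite /B /bad eq_sym it /= /G /apart -leNgt.
exists J, S; split.
- by apply/fintype.subsetP => t; rewrite inE => /andP[].
- have d0 : 0 < eps / 4 * N%:R by rewrite mulr_gt0// divr_gt0.
  rewrite -(ler_pM2r d0); apply: (@le_trans _ _ (\sum_(t in A) (out t)%:R)).
    rewrite mulr_natl -sumr_const [leLHS]big_mkcond [leRHS]big_mkcond.
    apply: ler_sum => t _; rewrite !inE; case: (t \in A); rewrite ?andbF//= andbT.
    by case: ifP => //; rewrite -ltNge => /ltW.
  apply: (le_trans sum_out).
  have -> : eps * N%:R * (eps / 4 * N%:R) = 64 * e * N%:R ^+ 2 by rewrite /e; field.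
  by rewrite ler_pM2r ?exprn_gt0//; lra.
move=> t; rewrite inE => /andP[tA tout]; split; last split.
- split.
  + by apply/fintype.subsetP => i; rewrite inE => /andP[].
  + by rewrite !inE eqxx andbF.
  + apply: (@le_trans _ _ (1 + (out t)%:R)).
      rewrite -[1]/(1%:R) -natrD ler_nat.
      have sub : A :\: S t \subset
          t |: [set i in [pred i | (i \in A) && ((i != t) && (B t i || hv t i))]].
        apply/fintype.subsetP => i; rewrite finset.in_setD => /andP[iS iA].
        by rewrite finset.in_setU1 finset.in_set; case: eqVneq => //= it; exact: outE.
      apply: (leq_trans (subset_leq_card sub)); rewrite cardsU1 leq_add ?leq_b1//.
      by rewrite cardsE.
    have : 1 <= eps / 4 * N%:R by apply: (le_trans N1); rewrite ler_pM2r//; lra.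
    lra.
  + by move=> i; rewrite !inE => /and4P[_ _ g _]; apply: lt_le_trans g _; lra.
(* An excluded point is either correlated with [t], and the degree bound covers its weight, or apart
   from [t], and its weight is at most 2. *)
- apply: (@le_trans _ _ ((\sum_(i in A | B t i) wt N (c t i)) + 2 * (out t)%:R)).
    rewrite -card_sum1 mulr_sumr [leLHS]big_mkcond [X in _ <= X + _]big_mkcond.
    rewrite [X in _ <= _ + X]big_mkcond/= -big_split; apply: ler_sum => i _ /=.
    have w0 := wt_ge0 N (c t i).
    case: ifP => [/and3P[iA iS it]|_]; last by rewrite addr_ge0//; case: ifP.
    have := outE t i iA iS it; rewrite inE => ->; rewrite iA /=.
    case: ifP => nB; first lra.
    rewrite add0r mulr1 wt_le2// good4//.
    by move: nB; rewrite /B /bad eq_sym it/= /G /apart ltNge => ->.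
  have := deg t tA; rewrite -/(B t) => dt.
  have : eta * N%:R <= eps / 4 * N%:R by rewrite ler_pM2r//; lra.
  move: dt tout; rewrite /B /bad; lra.
move=> i iS; have [iA /and3P[it Gi ni]] : i \in A /\ [&& i != t, G t i & ~~ hv t i].
  by move: iS; rewrite inE => /andP.
apply: (@le_trans _ _ (e * N%:R)); last by rewrite ler_pM2r//; lra.
have NH := crowd_not_heavy N0 Gi ni.
apply: le_trans NH; rewrite [leLHS]big_mkcond [leRHS]big_mkcond.
apply: ler_sum => k _.
have p0 : 0 <= (Num.max (vol c t i k) N%:R^-1)^-1.
  by rewrite invr_ge0 le_max sqrtr_ge0.
case: ifP => [/and3P[kS ik hk]|_]; last by case: ifP.
have [kA /and3P[kt Gk nk]] : k \in A /\ [&& k != t, G t k & ~~ hv t k].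
  by move: kS; rewrite inE => /andP.
(* Points apart from each other and from [t] have projections with correlation below
   [8 * eta <= eps]; so a pair correlated after the projection was already bad. *)
have bik : bad c eta i k.
  rewrite /bad ik/= leNgt; apply/negP => h.
  have := proj_corr_lt eta0 eta4 Gi Gk h; rewrite ltNge (le_trans _ hk)//; lra.
rewrite kA bik andbT [apart _ _ _ _]Gk; apply: wt_proj_le => //; exact: good4.
Qed.

(** * Uniqueness of the uniform law on the sphere *)

Section BorelRowVectors.
Context {R : realType} {d : nat}.
Implicit Types (u v w : 'rV[R]_d).

Lemma measurable_open_rV (A : set (borel_rV R d)) :
  @open 'rV[R]_d A -> measurable A.
Proof. by move=> oA; exact: sub_sigma_algebra. Qed.

Lemma measurable_closed_rV (A : set (borel_rV R d)) :
  @closed 'rV[R]_d A -> measurable A.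
Proof.
move=> cA; rewrite -(setCK A); apply: measurableC.
by apply: measurable_open_rV; exact: closed_openC.
Qed.

Lemma measurable_into_rV disp (T : measurableType disp) (f : T -> borel_rV R d) :
  (forall V : set (borel_rV R d), @open 'rV[R]_d V -> measurable (f @^-1` V)) ->
  measurable_fun [set: T] f.
Proof.
move=> mf; apply: (@measurability _ _ _ (borel_rV R d) _ f (@open 'rV[R]_d)) => //.
by move=> _ [V oV <-]; rewrite setTI; exact: mf.
Qed.

Lemma continuous_measurable_rV (f : 'rV[R]_d -> R) :
  continuous f -> measurable_fun [set: borel_rV R d] (f : borel_rV R d -> R).
Proof.
move=> /continuousP cf; apply: (measurability _ (RGenOpens.measurableE R)).
move=> _ [_ [a [b ->] <-]]; rewrite setTI; apply: measurable_open_rV.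
by apply: cf; exact: interval_open.
Qed.

Lemma continuous_dotp v : continuous (fun u => dotp u v).
Proof.
apply: continuous_big => [|i _ u]; first exact: add_continuous.
by apply: continuousM; [exact: coord_continuous|exact: cst_continuous].
Qed.

Lemma continuous_dotpr v : continuous (fun u => dotp v u).
Proof. by under eq_fun do rewrite dotpC; exact: continuous_dotp. Qed.

Lemma continuous_dotp_self : continuous (fun u => dotp u u).
Proof.
apply: continuous_big => [|i _ u]; first exact: add_continuous.
by apply: continuousM; exact: coord_continuous.
Qed.

Lemma measurable_dotp v : measurable_fun [set: borel_rV R d] (fun u : borel_rV R d => dotp u v).
Proof. apply: (@continuous_measurable_rV (fun u => dotp u v)); exact: continuous_dotp. Qed.

Lemma measurable_dotp2 : measurable_fun [set: borel_rV R d * borel_rV R d]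
  (fun z : borel_rV R d * borel_rV R d => dotp z.1 z.2).
Proof.
have mc i : measurable_fun [set: borel_rV R d] (fun u : borel_rV R d => (u : 'rV[R]_d) 0 i).
  by apply: (@continuous_measurable_rV (fun u => u 0 i)); exact: coord_continuous.
apply: measurable_sum => i; apply: measurable_funM.
  by apply: measurableT_comp (mc i) _; exact: measurable_fst.
by apply: measurableT_comp (mc i) _; exact: measurable_snd.
Qed.

Lemma closed_unit_sphere : closed (@unit_sphere R d).
Proof.
rewrite (_ : @unit_sphere R d = (fun u => dotp u u) @^-1` [set 1])//.
apply: closed_comp => [u _|]; first exact: continuous_dotp_self.
exact: closed_eq.
Qed.

Lemma measurable_sphere : measurable (@unit_sphere R d : set (borel_rV R d)).
Proof. by apply: measurable_closed_rV; exact: closed_unit_sphere. Qed.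

Lemma coord_le_dotp u i : u 0 i ^+ 2 <= dotp u u.
Proof.
rewrite /dotp (bigD1 i)//= -expr2 lerDl.
by apply: sumr_ge0 => j _; rewrite -expr2 sqr_ge0.
Qed.

(** The norm of row vectors is the maximum norm; boundedness and balls are compared with the
    Euclidean length through this inequality. *)
Lemma mx_norm_le_dotp u : `|u| <= Num.sqrt (dotp u u).
Proof.
rewrite [leLHS]/Num.norm/= mx_normrE; apply/bigmax_leP; split; first exact: sqrtr_ge0.
move=> [i j] _ /=; rewrite (ord1 i) -sqrtr_sqr ler_wsqrtr//.
exact: coord_le_dotp.
Qed.

Lemma compact_unit_sphere : compact (@unit_sphere R d).
Proof.
apply: bounded_closed_compact closed_unit_sphere.
exists 1; split; first exact: num_real.
move=> x x1 u /= u1; apply: (le_trans (mx_norm_le_dotp u)).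
by rewrite u1 sqrtr1 ltW.
Qed.

Lemma continuous_mulmx n (Q : 'M[R]_(d, n)) : continuous (fun u => u *m Q).
Proof.
under eq_fun do rewrite mulmx_sum_row.
apply: continuous_big => [|i _ u]; first exact: add_continuous.
apply: (@continuous_comp _ _ _ (fun v : 'rV[R]_d => v 0 i) (fun k : R => k *: row i Q)).
  exact: coord_continuous.
exact: scalel_continuous.
Qed.

Lemma measurable_mulmx (Q : 'M[R]_d) : measurable_fun [set: borel_rV R d]
  (fun u : borel_rV R d => ((u : 'rV[R]_d) *m Q : borel_rV R d)).
Proof.
apply: measurable_into_rV => V oV; apply: measurable_open_rV.
by move: oV; apply: open_comp => u _; exact: continuous_mulmx.
Qed.

Lemma dotp_mulmx u v : dotp u v = (u *m v^T) 0 0.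
Proof. by rewrite mxE; apply: eq_bigr => i _; rewrite mxE. Qed.

Lemma dotp_orthogonal (Q : 'M[R]_d) u v : orthogonal_mx Q -> dotp (u *m Q) (v *m Q) = dotp u v.
Proof.
by move=> oQ; rewrite !dotp_mulmx trmx_mul mulmxA -(mulmxA u) oQ mulmx1.
Qed.

Lemma orthogonal_mxT (Q : 'M[R]_d) : orthogonal_mx Q -> orthogonal_mx Q^T.
Proof. by move=> oQ; rewrite /orthogonal_mx trmxK; exact: mulmx1C. Qed.

Definition reflection w : 'M[R]_d := 1%:M - 2 *: (w^T *m w).

Lemma mul_reflection w u : u *m reflection w = u - (2 * dotp u w) *: w.
Proof.
rewrite mulmxBr mulmx1 -scalemxAr mulmxA; congr (_ - _); rewrite -scalerA; congr (_ *: _).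
by rewrite [u *m w^T]mx11_scalar -dotp_mulmx mul_scalar_mx.
Qed.

Lemma reflection_orthogonal w : dotp w w = 1 -> orthogonal_mx (reflection w).
Proof.
move=> w1; have sym : (reflection w)^T = reflection w.
  by rewrite /reflection linearB/= trmx1 linearZ/= trmx_mul trmxK.
rewrite /orthogonal_mx sym; apply/row_matrixP => i; rewrite row_mul mul_reflection.
have -> : row i (reflection w) = row i 1%:M *m reflection w by rewrite -row_mul mul1mx.
rewrite mul_reflection dotpBl dotpZl w1 mulr1.
set x := dotp _ _; have -> : 2 * (x - 2 * x) = - (2 * x) by ring.
by rewrite scaleNr opprK subrK.
Qed.

(** The reflection in the hyperplane orthogonal to [u - v] exchanges the two unit vectors. *)
Lemma orthogonal_transitive u v : dotp u u = 1 -> dotp v v = 1 ->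
  exists2 Q : 'M[R]_d, orthogonal_mx Q & u *m Q = v.
Proof.
move=> u1 v1; have [->|uv] := eqVneq u v.
  by exists 1%:M; rewrite /orthogonal_mx ?trmx1 mulmx1.
have n0 : 0 < dotp (u - v) (u - v).
  rewrite lt_def dotp_ge0 andbT; apply: contra_neq uv => /dotp_eq0/eqP.
  by rewrite subr_eq0 => /eqP.
pose r := Num.sqrt (dotp (u - v) (u - v)).
have r0 : r != 0 by rewrite sqrtr_eq0 -ltNge.
have r2 : r ^+ 2 = dotp (u - v) (u - v) by rewrite sqr_sqrtr// ltW.
exists (reflection (r^-1 *: (u - v))).
  by apply: reflection_orthogonal; rewrite !dotpZl !dotpZr -r2; field.
rewrite mul_reflection dotpZr scalerA.
have -> : 2 * (r^-1 * dotp u (u - v)) * r^-1 = 1.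
  have E : 2 * dotp u (u - v) = r ^+ 2.
    by rewrite r2 !dotpE u1 v1 (dotpC v u); ring.
  rewrite mulrCA mulrAC E; field; exact: r0.
by rewrite scale1r opprB addrC subrK.
Qed.

End BorelRowVectors.

(* The caps {v | 1 - e < <u, v>} have a mass c_i(e) under m_i which does not
   depend on the unit vector u.  Fubini on m1 x m2 gives
   c_2(e) m1(K) <= c_1(e) m2(K_e) for the e-neighbourhood K_e of K, with
   equality on the whole sphere; then e -> 0. *)
Section InvariantUniqueness.
Context {R : realType} {d : nat}.
Local Notation S := (@unit_sphere R d : set (borel_rV R d)).

(** Not normalized, so as to cover the law of a direction restricted to an event. *)
Definition invariant_on_sphere (m : set (borel_rV R d) -> \bar R) :=
  m (~` S) = 0%E /\ forall Q : 'M[R]_d, orthogonal_mx Q ->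
  forall A : set (borel_rV R d), measurable A ->
    m [set u : borel_rV R d | A ((u : 'rV[R]_d) *m Q)] = m A.

Definition cap (e : R) (u : 'rV[R]_d) : set (borel_rV R d) :=
  S `&` [set v : borel_rV R d | 1 - e < dotp u v].

Lemma measurable_cap e u : measurable (cap e u).
Proof.
apply: measurableI; first exact: measurable_sphere.
have := measurable_dotp (d := d) u measurableT (measurable_itv `]1 - e, +oo[).
rewrite setTI; congr (measurable _).
by apply/seteqP; split=> v /=; rewrite in_itv/= andbT dotpC.
Qed.

Section OneMeasure.
Variable m : {finite_measure set (borel_rV R d) -> \bar R}.
Hypothesis minv : invariant_on_sphere m.

Lemma measure_sphereI A : measurable A -> m (S `&` A) = m A.
Proof.
move=> mA; rewrite -[in RHS](setIT A) -(setUv S) setIUr setIC measureU.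
- rewrite [X in (_ + X)%E](_ : _ = 0%E) ?adde0//; apply/eqP.
  rewrite eq_le measure_ge0 andbT -minv.1 le_measure//; apply/mem_set.
  + by apply: measurableI => //; apply: measurableC; exact: measurable_sphere.
  + by apply: measurableC; exact: measurable_sphere.
- by apply: measurableI => //; exact: measurable_sphere.
- by apply: measurableI => //; apply: measurableC; exact: measurable_sphere.
- by apply/seteqP; split=> // u [[_ Su] [_ nSu]].
Qed.

Lemma cap_measure e u v : S u -> S v -> m (cap e u) = m (cap e v).
Proof.
move=> Su Sv; have [Q oQ uQ] := orthogonal_transitive Su Sv.
rewrite -(minv.2 Q oQ (cap e v)); last exact: measurable_cap.
congr (m _); apply/seteqP; split=> w [Sw uw]; split.
- by rewrite /= /unit_sphere/= dotp_orthogonal.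
- by rewrite /= -uQ dotp_orthogonal.
- by have := Sw; rewrite /= /unit_sphere/= dotp_orthogonal.
- by move: uw; rewrite /= -uQ dotp_orthogonal.
Qed.

(** By compactness finitely many caps cover the sphere, and all of them have the same mass. *)
Lemma cap_gt0 e u : 0 < e -> S u -> (0 < m S)%E -> (0 < m (cap e u))%E.
Proof.
move=> e0 Su mS; rewrite lt0e measure_ge0 andbT; apply/eqP => c0.
have := @compact_unit_sphere R d; rewrite compact_cover.
move=> /(_ 'rV[R]_d S (fun v => [set w : 'rV[R]_d | 1 - e < dotp v w])) [].
- move=> v _; rewrite [X in open X](_ : _ = (dotp v) @^-1` [set x | x > 1 - e])//.
  by apply: open_comp => [w _|]; [exact: continuous_dotpr|exact: open_gt].
- by move=> w Sw; exists w => //=; rewrite (Sw : dotp w w = 1) ltrBlDr ltrDl.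
move=> D DS Dcov.
have : (m S <= m (\big[setU/set0]_(v <- D) (cap e v)))%E.
  apply: le_measure; [apply/mem_set; exact: measurable_sphere|apply/mem_set|].
    by apply: bigsetU_measurable => v _; exact: measurable_cap.
  move=> w Sw; have [v /= vD vw] := Dcov w Sw.
  by rewrite -bigcup_seq; exists v.
apply/negP; rewrite -ltNge; apply: le_lt_trans mS.
apply: (@le_trans _ _ (\sum_(v <- D) m (cap e v))%E).
  elim: (enum_fset D) => [|v s IH]; first by rewrite !big_nil measure0.
  rewrite !big_cons; apply: le_trans (measureU2 _ _ _) _.
  - exact: measurable_cap.
  - by apply: bigsetU_measurable => ? _; exact: measurable_cap.
  - exact: leeD2l.
rewrite big_seq big1// => v vD; rewrite (cap_measure e _ Su) ?c0//.
by have /set_mem := DS v vD.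
Qed.

End OneMeasure.

Definition thick (e : R) (K : set (borel_rV R d)) : set (borel_rV R d) :=
  S `&` [set v | exists2 u, (K `&` S) u & 1 - e < dotp u v].

Lemma measurable_thick e K : measurable (thick e K).
Proof.
apply: measurableI; first exact: measurable_sphere.
rewrite [X in measurable X](_ : _ =
  \bigcup_(u in K `&` S) [set v : 'rV[R]_d | 1 - e < dotp u v]); last first.
  by apply/seteqP; split=> v [u]; exists u.
apply: measurable_open_rV; apply: bigcup_open => u _.
rewrite [X in open X](_ : _ = (dotp u) @^-1` [set x | x > 1 - e])//.
by apply: open_comp => [w _|]; [exact: continuous_dotpr|exact: open_gt].
Qed.

Definition near_pairs (e : R) (K : set (borel_rV R d)) :
    set (borel_rV R d * borel_rV R d) :=
  [set z | [/\ (K `&` S) z.1, S z.2 & 1 - e < dotp z.1 z.2]].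

Lemma measurable_near_pairs e K : measurable K -> measurable (near_pairs e K).
Proof.
move=> mK.
have mKS : measurable (K `&` S) by apply: measurableI => //; exact: measurable_sphere.
rewrite [X in measurable X](_ : _ = ((K `&` S) `*` S) `&`
   (fun z : borel_rV R d * borel_rV R d => dotp z.1 z.2) @^-1` `]1 - e, +oo[%classic).
  apply: measurableI; first by apply: measurableX => //; exact: measurable_sphere.
  have := measurable_dotp2 (d := d) measurableT (measurable_itv `]1 - e, +oo[).
  by rewrite setTI.
by apply/seteqP; split=> -[u v]; rewrite /near_pairs /= in_itv/= andbT; [case|case=> -[]].
Qed.

Lemma cap_double (m1 m2 : {finite_measure set (borel_rV R d) -> \bar R}) e K u0 :
  invariant_on_sphere m1 -> invariant_on_sphere m2 -> measurable K -> S u0 ->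
  (m2 (cap e u0) * m1 K <= m1 (cap e u0) * m2 (thick e K))%E.
Proof.
move=> inv1 inv2 mK Su0.
have mKS : measurable (K `&` S) by apply: measurableI => //; exact: measurable_sphere.
have mN := measurable_near_pairs e mK.
have -> : (m2 (cap e u0) * m1 K = (m1 \x m2) (near_pairs e K))%E.
  rewrite /product_measure1.
  rewrite (eq_integral (fun u => (m2 (cap e u0) * (\1_(K `&` S) u)%:E)%E)); last first.
    move=> u _ /=; rewrite indicE; case: (boolP (u \in _)) => [/set_mem KSu|/negP KSu].
      rewrite mule1 -(cap_measure inv2 e KSu.2 Su0); congr (m2 _).
      by apply/seteqP; split=> v; [move=> /set_mem[]|move=> [Sv uv]; exact/mem_set].
    rewrite mule0 [X in m2 X](_ : _ = set0) ?measure0//.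
    apply/seteqP; split=> // v /set_mem[KSu' _ _].
    by apply: KSu; exact: mem_set.
  rewrite ge0_integralZl//; last exact: measurableT_comp.
  by rewrite -[in LHS](measure_sphereI inv1 mK) integral_indic// setIT setIC.
have -> : ((m1 \x m2) (near_pairs e K) = (m1 \x^ m2) (near_pairs e K))%E.
  apply: product_measure_unique => // A B mA mB; exact: product_measure2E.
rewrite /product_measure2.
apply: (@le_trans _ _ (\int[m2]_v (m1 (cap e u0) * (\1_(thick e K) v)%:E))%E).
  apply: ge0_le_integral => //.
  - exact: measurable_fun_ysection.
  - apply: emeasurable_funM; first exact: measurable_cst.
    by apply: measurableT_comp => //; apply: measurable_indic; exact: measurable_thick.
  move=> v _ /=; have mY : measurable (ysection (near_pairs e K) v) by exact: measurable_ysection.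
  rewrite indicE; case: (boolP (v \in _)) => [/set_mem [Sv [u [Ku Su] uv]]|/negP nv].
    rewrite mule1 -(cap_measure inv1 e Sv Su0).
    apply: le_measure; first exact/mem_set.
      by apply/mem_set; exact: measurable_cap.
    by move=> w /set_mem[[_ Sw] _ wv]; split=> //=; rewrite dotpC.
  rewrite mule0 [X in m1 X](_ : _ = set0) ?measure0//.
  apply/seteqP; split=> // u /set_mem[KSu' Sv uv].
  by apply: nv; apply/mem_set; split=> //; exists u.
rewrite ge0_integralZl//; last first.
  by apply: measurableT_comp => //; apply: measurable_indic; exact: measurable_thick.
by rewrite integral_indic// ?setIT//; exact: measurable_thick.
Qed.

(** For unit vectors [|v - u|^2 = 2 (1 - <u, v>)], so a point of every thickening is a limit of
    points of [K]. *)
Lemma bigcap_thick (K : set (borel_rV R d)) : @closed 'rV[R]_d K ->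
  \bigcap_k thick k.+1%:R^-1 K = K `&` S.
Proof.
move=> cK; apply/seteqP; split=> v; last first.
  by move=> [Kv Sv] k _; split=> //; exists v => //; rewrite (Sv : dotp v v = 1) ltrBlDr ltrDl.
move=> h; have Sv : S v by have [] := h 0%N I.
split=> //; apply: cK => B /nbhs_ballP[e /= e0 eB].
have [k ke] : exists k, 2 * k.+1%:R^-1 < e ^+ 2.
  have e2 : 0 < e ^+ 2 / 2 by rewrite divr_gt0// exprn_gt0.
  have [k _ /(_ k (leqnn k)) /= hk] := near_infty_natSinv_lt (PosNum e2).
  by exists k; rewrite -ltr_pdivlMl// mulrC.
have [_ [u [Ku Su] uv]] := h k I.
exists u; split=> //; apply: eB; rewrite mx_norm_ball /ball_/=.
apply: le_lt_trans (mx_norm_le_dotp _) _.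
rewrite -(@ltr_pXn2r _ 2%N) ?nnegrE ?sqrtr_ge0//; last exact: ltW.
rewrite sqr_sqrtr ?dotp_ge0//.
have -> : dotp (v - u) (v - u) = 2 * (1 - dotp u v).
  by rewrite !dotpE (Sv : dotp v v = 1) (Su : dotp u u = 1) (dotpC v u); ring.
by apply: lt_trans ke; rewrite ltr_pM2l// ltrBlDl -ltrBlDr.
Qed.

Lemma sphere_setT (m : {finite_measure set (borel_rV R d) -> \bar R}) :
  invariant_on_sphere m -> m setT = m S.
Proof. by move=> inv; have := measure_sphereI inv measurableT; rewrite setIT. Qed.

Lemma finite_measureP (m : {finite_measure set (borel_rV R d) -> \bar R}) A :
  measurable A -> exists2 r, 0 <= r & m A = r%:E.
Proof.
move=> mA; exists (fine (m A)); first by rewrite fine_ge0.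
by rewrite fineK// fin_num_measure.
Qed.

Lemma invariant_closed (m1 m2 : {finite_measure set (borel_rV R d) -> \bar R})
    (K : set (borel_rV R d)) :
  invariant_on_sphere m1 -> invariant_on_sphere m2 -> @closed 'rV[R]_d K ->
  (m1 K * m2 S <= m1 S * m2 K)%E.
Proof.
move=> inv1 inv2 cK.
have mK : measurable K by exact: measurable_closed_rV.
have mS : measurable S by exact: measurable_sphere.
have [S0|/set0P[u0 Su0]] := eqVneq S set0.
  by rewrite S0 !measure0 mule0 mul0e.
have [->|m2S] := eqVneq (m2 S) 0%E; first by rewrite mule0 mule_ge0.
have fm := finite_measureP.
(* The two inequalities between cap masses are multiplied, and the mass of the cap under [m2], which
   is positive, is cancelled. *)
have step e : 0 < e -> (m1 K * m2 S <= m1 S * m2 (thick e K))%E.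
  move=> e0.
  have c2gt0 : (0 < m2 (cap e u0))%E by apply: cap_gt0 => //; rewrite lt0e m2S/=.
  have H1 := cap_double e inv1 inv2 mK Su0.
  have H2 : (m1 (cap e u0) * m2 S <= m2 (cap e u0) * m1 S)%E.
    apply: le_trans (cap_double e inv2 inv1 mS Su0) _.
    rewrite lee_wpmul2l//; apply: le_measure; [apply/mem_set|exact/mem_set|by move=> v []].
    exact: measurable_thick.
  have [k k0 Ek] := fm m1 K mK; have [s s0 Es] := fm m2 S mS.
  have [t t0 Et] := fm m1 S mS; have [h h0 Eh] := fm m2 _ (measurable_thick e K).
  have [c1 c10 Ec1] := fm m1 _ (measurable_cap e u0).
  have [c2 c20 Ec2] := fm m2 _ (measurable_cap e u0).
  move: H1 H2 c2gt0; rewrite Ek Es Et Eh Ec1 Ec2 -!EFinM !lee_fin lte_fin.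
  move=> H1 H2 c2gt0; rewrite -(ler_pM2l c2gt0) !mulrA.
  apply: le_trans (ler_wpM2r s0 H1) _.
  by rewrite mulrAC ler_wpM2r.
have cvg := @nonincreasing_cvg_mu _ _ _ m2 (fun k => thick k.+1%:R^-1 K).
have : (m1 S * m2 (thick k.+1%:R^-1 K))%E @[k --> \oo] --> (m1 S * m2 (\bigcap_k thick k.+1%:R^-1 K))%E.
  apply: cvgeZl; first by rewrite fin_num_measure.
  apply: cvg.
  - by rewrite ltey_eq fin_num_measure//; exact: measurable_thick.
  - by move=> k; exact: measurable_thick.
  - by apply: bigcapT_measurable => k; exact: measurable_thick.
  - move=> i j ij; apply/subsetPset => v [Sv [u KSu uv]]; split=> //; exists u => //.
    apply: le_lt_trans uv; rewrite lerD2l lerN2 lef_pV2 ?posrE//.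
    by rewrite ler_nat ltnS.
have KE := measure_sphereI inv2 mK; rewrite setIC in KE.
rewrite bigcap_thick// KE; apply: cvge_ge.
by apply: nearW => k; exact: step.
Qed.

(** The cross-multiplied form covers unnormalized and even zero measures. Exchanging the two
    measures gives equality on closed sets; complements carry it to open sets, which form a
    generating pi-system. *)
Lemma invariant_unique (m1 m2 : {finite_measure set (borel_rV R d) -> \bar R}) A :
  invariant_on_sphere m1 -> invariant_on_sphere m2 -> measurable A ->
  (m1 A * m2 S = m1 S * m2 A)%E.
Proof.
move=> inv1 inv2 mA.
have mS : measurable S by exact: measurable_sphere.
have eqc (K : set (borel_rV R d)) : @closed 'rV[R]_d K -> (m1 K * m2 S = m1 S * m2 K)%E.
  move=> cK; apply/eqP; rewrite eq_le invariant_closed//=.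
  by rewrite muleC [leRHS]muleC invariant_closed.
have r1 : 0 <= fine (m1 S) by rewrite fine_ge0.
have r2 : 0 <= fine (m2 S) by rewrite fine_ge0.
have E1 : (fine (m1 S))%:E = m1 S by rewrite fineK// fin_num_measure.
have E2 : (fine (m2 S))%:E = m2 S by rewrite fineK// fin_num_measure.
have := @measure_unique _ R (borel_rV R d) (@open 'rV[R]_d) (fun=> setT).
move=> /(_ _ _ _ _ (mscale (NngNum r2) m1) (mscale (NngNum r1) m2)).
have e1 B : mscale (NngNum r2) m1 B = (m1 B * m2 S)%E by rewrite /mscale/= E2 muleC.
have e2 B : mscale (NngNum r1) m2 B = (m1 S * m2 B)%E by rewrite /mscale/= E1.
rewrite -e1 -e2 => ->//.
- by move=> B C; exact: openI.
- by move=> _; exact: openT.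
- by rewrite bigcup_const.
- move=> B oB; apply: (eq_trans (e1 B)); apply: (eq_trans _ (esym (e2 B))).
  have mB : measurable B by exact: measurable_open_rV.
  have mCB : measurable (~` B) by exact: measurableC.
  have H := eqc (~` B) (open_closedC oB); have HT := eqc setT closedT.
  have split (m : {finite_measure set (borel_rV R d) -> \bar R}) : (m setT = m B + m (~` B))%E.
    by rewrite -measureU ?setUv// setICr.
  move: H HT; rewrite !split.
  have [a1 _ ->] := finite_measureP m1 mB; have [a2 _ ->] := finite_measureP m2 mB.
  have [b1 _ ->] := finite_measureP m1 mCB; have [b2 _ ->] := finite_measureP m2 mCB.
  have [s1 _ ->] := finite_measureP m1 mS; have [s2 _ ->] := finite_measureP m2 mS.
  by rewrite -!EFinD -!EFinM => -[H] [HT]; congr _%:E; lra.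
- by move=> _; rewrite [X in (X < _)%E]e1 ltey_eq fin_numM// fin_num_measure.
Qed.

End InvariantUniqueness.

(** * The law of one coordinate *)

Section BoundedExpectation.
Context disp (T : measurableType disp) {R : realType} (P : probability T R).
Implicit Types f g : T -> R.

Lemma bounded_integrable f (M : R) : measurable_fun setT f -> (forall x, `|f x| <= M) ->
  P.-integrable setT (EFin \o f).
Proof.
move=> mf fM; apply: measurable_bounded_integrable => //.
  by rewrite ltey_eq fin_num_measure.
exists M; split; first exact: num_real.
by move=> x Mx y _ /=; exact: le_trans (fM y) (ltW Mx).
Qed.

Lemma bounded_cvg_Rintegral (f_ : nat -> T -> R) f (M : R) :
  (forall k, measurable_fun setT (f_ k)) -> (forall k x, `|f_ k x| <= M) ->
  (forall x, f_ k x @[k --> \oo] --> f x) ->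
  \int[P]_x f_ k x @[k --> \oo] --> \int[P]_x f x.
Proof.
move=> mf_ fM fc.
have mf : measurable_fun setT f by exact: (measurable_fun_cvg mf_) => x _.
have iM : P.-integrable setT (EFin \o (fun=> M)).
  exact: (@bounded_integrable _ `|M|) (measurable_cst _) (fun=> lexx _).
have [] := @dominated_convergence _ T R P setT measurableT
  (fun k => EFin \o f_ k) (EFin \o f) (EFin \o (fun=> M)).
- by move=> k; exact/measurable_EFinP.
- exact/measurable_EFinP.
- by apply: aeW => x _; apply: cvg_EFin; [exact: nearW|exact: fc].
- exact: iM.
- by apply: aeW => x k _; rewrite lee_fin.
move=> fi _ h; apply: fine_cvg; rewrite fineK//.
exact: integrable_fin_num.
Qed.

End BoundedExpectation.

Section UniformMoments.
Context {R : realType} {d : nat} (mu : probability (borel_rV R d) R).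
Hypothesis mu_unif : uniform_on_sphere mu.
Local Notation S := (@unit_sphere R d : set (borel_rV R d)).

Lemma uniform_invariant : invariant_on_sphere mu.
Proof.
split; last exact: mu_unif.2.
by rewrite probability_setC ?mu_unif.1 ?subee//; exact: measurable_sphere.
Qed.

Lemma Rintegral_orthogonal (Q : 'M[R]_d) (g : borel_rV R d -> R) (M : R) :
  orthogonal_mx Q -> measurable_fun setT g -> (forall u, `|g u| <= M) ->
  \int[mu]_u g ((u : 'rV[R]_d) *m Q) = \int[mu]_u g u.
Proof.
move=> oQ mg gM.
pose phi (u : borel_rV R d) : borel_rV R d := (u : 'rV[R]_d) *m Q.
have mphi : measurable_fun setT phi by exact: measurable_mulmx.
have gi := bounded_integrable mu mg gM.
have gi' : mu.-integrable setT ((EFin \o g) \o phi).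
  apply: (@bounded_integrable _ _ _ mu (g \o phi) M); first exact: measurableT_comp.
  by move=> u /=.
congr fine.
transitivity (\int[pushforward mu phi]_u (g u)%:E)%E.
  rewrite (integral_pushforward mphi) ?preimage_setT//.
  exact/measurable_EFinP.
apply: eq_measure_integral => A mA _; exact: mu_unif.2.
Qed.

Lemma ae_Rintegral (f g : borel_rV R d -> R) : {in S, f =1 g} ->
  measurable_fun setT f -> measurable_fun setT g ->
  \int[mu]_u f u = \int[mu]_u g u.
Proof.
move=> fg mf mg; congr fine; apply: ae_eq_integral => //.
- exact/measurable_EFinP.
- exact/measurable_EFinP.
exists (~` S); split.
- by apply: measurableC; exact: measurable_sphere.
- exact: uniform_invariant.1.
- move=> u /= h Su; apply: h => _; congr _%:E; apply: fg; exact/mem_set.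
Qed.

End UniformMoments.

Lemma mvt_two_points {R : realType} (F F' : R -> R) (r a b : R) :
  (forall x : R, `|x| <= r -> is_derive x 1 F (F' x)) -> `|a| <= r -> `|b| <= r ->
  exists c, [/\ `|c| <= r, `|c - a| <= `|b - a| & F b - F a = F' c * (b - a)].
Proof.
move=> dF.
have key x y : x <= y -> `|x| <= r -> `|y| <= r ->
    exists c, [/\ x <= c <= y, `|c| <= r & F y - F x = F' c * (y - x)].
  move=> xy; rewrite !ler_norml => /andP[x1 x2] /andP[y1 y2].
  have sub z : x <= z <= y -> `|z| <= r.
    by move=> /andP[xz zy]; rewrite ler_norml (le_trans x1)//= (le_trans zy).
  have [||c cxy Fc] := @MVT_segment R F F' x y xy.
  - by move=> z zxy; apply: dF; apply: sub; rewrite !(itvP zxy).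
  - apply: derivable_within_continuous => z zxy.
    by have [] : is_derive z 1 F (F' z) by apply: dF; apply: sub; rewrite !(itvP zxy).
  - by exists c; rewrite !(itvP cxy) sub// !(itvP cxy).
move=> ar br; have [ab|/ltW ba] := leP a b.
  have [c [/andP[ac cb] cr Fc]] := key _ _ ab ar br; exists c; split=> //.
  by rewrite !ger0_norm ?subr_ge0// lerD2r.
have [c [/andP[bc ca] cr Fc]] := key _ _ ba br ar; exists c; split=> //.
  by rewrite !ler0_norm ?subr_le0// lerN2 lerD2r.
by rewrite -opprB Fc; ring.
Qed.

(** The base point [C k * y] moves together with the increment, so differentiability at [y] does not
    suffice; the mean value theorem and the continuity of [F'] at [y] do. *)
Lemma difference_quotient_cvg {R : realType} (F F' : R -> R) (r y h : R) (C t : nat -> R) :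
  (forall x : R, `|x| <= r -> is_derive x 1 F (F' x)) -> {for y, continuous F'} ->
  C k @[k --> \oo] --> (1 : R) -> t k @[k --> \oo] --> (0 : R) -> (forall k, 0 < t k) ->
  (forall k, `|C k * y| <= r) -> (forall k, `|C k * y + t k * h| <= r) ->
  (F (C k * y + t k * h) - F (C k * y)) / t k @[k --> \oo] --> F' y * h.
Proof.
move=> dF cF' C1 t0 tp Cy Cyh.
have /choice[c cP] k : exists c, `|c - C k * y| <= `|t k * h| /\
    (F (C k * y + t k * h) - F (C k * y)) / t k = F' c * h.
  have [c [_ cC Fc]] := mvt_two_points dF (Cy k) (Cyh k).
  exists c; move: cC; rewrite [_ + _ - _]addrAC subrr add0r => cC; split=> //.
  rewrite Fc [_ + _ - _]addrAC subrr add0r; field; exact: lt0r_neq0.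
under eq_fun do rewrite (cP _).2.
have Cyc : C k * y @[k --> \oo] --> y by rewrite -[X in _ --> X]mul1r; exact: cvgMr_tmp.
have thc : `|t k * h| @[k --> \oo] --> (0 : R).
  by rewrite -(normr0 R) -(mul0r h); apply: cvg_norm; exact: cvgMr_tmp.
have cc : c k - C k * y @[k --> \oo] --> (0 : R).
  apply: norm_cvg0; apply: (squeeze_cvgr _ (cvg_cst 0) thc); apply: nearW => k.
  by rewrite normr_ge0 (cP k).1.
have cy : c k @[k --> \oo] --> y + 0.
  have cE : c = (fun k => C k * y + (c k - C k * y)).
    by apply/funext => k; rewrite addrC subrK.
  by rewrite cE; exact: cvgD.
rewrite addr0 in cy; apply: cvgMr_tmp; exact: (cvg_comp c F' cy cF').
Qed.

(** * A Stein identity for the first coordinate *)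

Section SteinIdentity.
Context {R : realType} {m : nat}.
Local Notation d := m.+4.
Variable mu : probability (borel_rV R d) R.
Hypothesis mu_unif : uniform_on_sphere mu.
Local Notation S := (@unit_sphere R d : set (borel_rV R d)).
Local Notation rd := (Num.sqrt d%:R : R).

Definition axis (i : 'I_d) (u : borel_rV R d) : R := (u : 'rV[R]_d) 0 i.
Definition height (u : borel_rV R d) : R := rd * axis 0 u.

Lemma measurable_coord i : measurable_fun setT (axis i).
Proof. by apply: (@continuous_measurable_rV _ _ (fun u => u 0 i)); exact: coord_continuous. Qed.

Lemma measurable_height : measurable_fun setT height.
Proof. apply: measurable_funM => //; exact: measurable_coord. Qed.

Lemma coord_le1 i u : S u -> `|axis i u| <= 1.
Proof.
move=> Su; rewrite -(@ler_pXn2r _ 2%N) ?nnegrE// real_normK ?num_real// expr1n.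
by rewrite -(Su : dotp u u = 1) coord_le_dotp.
Qed.

Lemma rd_gt0 : 0 < rd. Proof. by rewrite sqrtr_gt0 ltr0n. Qed.

Lemma height_le u : S u -> `|height u| <= rd.
Proof.
move=> Su; rewrite normrM ger0_norm ?sqrtr_ge0// ger_pMr ?rd_gt0//.
exact: coord_le1.
Qed.

Lemma dotp_delta (u : 'rV[R]_d) i : dotp u (delta_mx 0 i) = u 0 i.
Proof.
rewrite /dotp (bigD1 i)//= mxE !eqxx mulr1 big1 ?addr0// => j ji.
by rewrite mxE (negbTE ji) andbF mulr0.
Qed.

Lemma indic_sphere_orthogonal (Q : 'M[R]_d) (u : borel_rV R d) : orthogonal_mx Q ->
  \1_S ((u : 'rV[R]_d) *m Q : borel_rV R d) = \1_S u :> R.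
Proof.
move=> oQ; rewrite !indicE; congr (_%:R); congr nat_of_bool; apply/idP/idP => /set_mem h; apply/mem_set.
  by move: h; rewrite /unit_sphere/= dotp_orthogonal.
by rewrite /unit_sphere/= dotp_orthogonal.
Qed.

Section TwoCoordinates.
Variables (i : 'I_d) (F F' : R -> R) (M : R).
Hypotheses (i0 : i != 0) (mF : measurable_fun setT F).
Hypotheses (FM : forall x, `|F x| <= M) (FM' : forall x, `|F' x| <= M).
Hypothesis dF : forall x : R, `|x| <= rd -> is_derive x 1 F (F' x).
Hypothesis cF' : forall x : R, `|x| <= rd -> {for x, continuous F'}.

(** [q] and [p] are the sine and cosine of a small angle, [C] and [t] the cosine and sine of its
    double; [k.+2] keeps [q] below 1. *)
Let q (k : nat) : R := k.+2%:R^-1.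
Let p (k : nat) : R := Num.sqrt (1 - q k ^+ 2).
Let C (k : nat) : R := 1 - 2 * q k ^+ 2.
Let t (k : nat) : R := 2 * p k * q k.
(* The reflection in w k flips axis i and then rotates by an angle O(q k) in the
   plane of the axes 0 and i; as k -> oo, invariance under these reflections
   becomes an identity between derivatives. *)
Let w (k : nat) : 'rV[R]_d := p k *: delta_mx 0 i - q k *: delta_mx 0 0.

Lemma measurable_indic_sphere : measurable_fun setT (\1_S : borel_rV R d -> R).
Proof. by apply: measurable_indic; exact: measurable_sphere. Qed.

Lemma norm_coord_indic j (u : borel_rV R d) : `|axis j u * \1_S u| <= 1.
Proof.
rewrite indicE; case: (boolP (u \in _)) => [/set_mem Su|_]; last by rewrite mulr0 normr0.
by rewrite mulr1 coord_le1.
Qed.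

Let q_gt0 k : 0 < q k. Proof. by rewrite invr_gt0 ltr0n. Qed.
Let q_lt1 k : q k < 1. Proof. by rewrite invf_lt1 ?ltr0n// ltr1n. Qed.
Let q2_lt1 k : q k ^+ 2 < 1. Proof. by rewrite expr_lt1// ltW. Qed.
Let p_gt0 k : 0 < p k. Proof. by rewrite sqrtr_gt0 subr_gt0. Qed.
Let pq1 k : p k ^+ 2 = 1 - q k ^+ 2. Proof. by rewrite sqr_sqrtr// subr_ge0 ltW. Qed.
Let t_gt0 k : 0 < t k. Proof. by rewrite !mulr_gt0. Qed.

Let q_cvg : q k @[k --> \oo] --> (0 : R).
Proof. by have := @cvg_harmonic R; rewrite -(cvg_shiftn 1); under eq_fun do rewrite addn1. Qed.

Let C_cvg : C k @[k --> \oo] --> (1 : R).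
Proof.
rewrite -[X in _ --> X]subr0; apply: cvgB; first exact: cvg_cst.
have q2 : q k * q k @[k --> \oo] --> (0 * 0 : R) by exact: cvgM.
rewrite mulr0 in q2; rewrite -(mulr0 2); apply: cvgMl_tmp.
by under eq_fun do rewrite expr2.
Qed.

Let t_cvg : t k @[k --> \oo] --> (0 : R).
Proof.
have q2 : 2 * q k @[k --> \oo] --> (0 : R) by rewrite -(mulr0 2); exact: cvgMl_tmp.
apply: (squeeze_cvgr _ (cvg_cst 0) q2); apply: nearW => k; rewrite ltW//=.
rewrite /t -mulrA ler_pM2l// ger_pMl// -[leRHS]sqrtr1 ler_wsqrtr// gerBl.
exact: sqr_ge0.
Qed.

Lemma wE k : [/\ dotp (w k) (w k) = 1, forall u, dotp u (w k) = p k * u 0 i - q k * u 0 0,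
  w k 0 0 = - q k & w k 0 i = p k].
Proof.
have wu u : dotp u (w k) = p k * u 0 i - q k * u 0 0.
  by rewrite dotpDr dotpNr !dotpZr !dotp_delta.
have i0' : (0 == i) = false by rewrite eq_sym (negbTE i0).
have w0 : w k 0 0 = - q k by rewrite !mxE !eqxx i0' /= mulr0 mulr1 sub0r.
have wi : w k 0 i = p k by rewrite !mxE !eqxx (negbTE i0) /= mulr0 mulr1 subr0.
split=> //; rewrite wu w0 wi; have := pq1 k; rewrite expr2; lra.
Qed.

Lemma reflectE k (u : 'rV[R]_d) :
  (u *m reflection (w k)) 0 0 = C k * u 0 0 + t k * u 0 i /\
  (u *m reflection (w k)) 0 i = t k * u 0 0 - C k * u 0 i.
Proof.
have [w1 wu w0 wi] := wE k.
have E j : (u *m reflection (w k)) 0 j = u 0 j - 2 * dotp u (w k) * w k 0 j.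
  by rewrite mul_reflection !mxE.
rewrite !E wu w0 wi /C /t; split; first by ring.
by have := pq1 k; rewrite !expr2 => h; ring: h.
Qed.

(** The reflection along the axis [i] preserves the height and changes the sign of the integrand. *)
Lemma flip_zero (G : R -> R) : measurable_fun setT G -> (forall x, `|G x| <= M) ->
  \int[mu]_u (G (height u) * (axis i u * \1_S u)) = 0.
Proof.
move=> mG GM; set g := fun u => _; pose Q : 'M[R]_d := reflection (delta_mx 0 i).
have d1 : dotp (delta_mx 0 i : 'rV[R]_d) (delta_mx 0 i) = 1 by rewrite dotp_delta mxE !eqxx.
have oQ : orthogonal_mx Q by exact: reflection_orthogonal.
have mg : measurable_fun setT g.
  apply: measurable_funM; first by apply: measurableT_comp => //; exact: measurable_height.
  by apply: measurable_funM; [exact: measurable_coord|exact: measurable_indic_sphere].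
have gM u : `|g u| <= M.
  rewrite normrM -[leRHS]mulr1; apply: ler_pM => //; exact: norm_coord_indic.
have := Rintegral_orthogonal mu_unif oQ mg gM.
have -> : (fun u : borel_rV R d => g ((u : 'rV[R]_d) *m Q)) = (fun u => (-1) * g u).
  apply/funext => u; rewrite /g indic_sphere_orthogonal// /height /axis mul_reflection dotp_delta.
  have i0' : (0 == i) = false by rewrite eq_sym (negbTE i0).
  rewrite !mxE !eqxx i0' /= mulr0 subr0 mulr1.
  have -> : u 0 i - 2 * u 0 i = (-1) * u 0 i by ring.
  by rewrite !mulrA; congr (_ * _); ring.
rewrite RintegralZl//; last exact: (bounded_integrable mu mg gM).
by move=> h; lra.
Qed.

Lemma stein_pair :
  \int[mu]_u ((F (height u) * axis 0 u - F' (height u) * (rd * axis i u ^+ 2)) * \1_S u) = 0.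
Proof.
have rd0 := rd_gt0.
have M0 : 0 <= M by exact: le_trans (normr_ge0 _) (FM 0).
have C1 k : `|C k| <= 1.
  have q2 := ltW (q2_lt1 k); have := sqr_ge0 (q k).
  by rewrite ler_norml /C => h; apply/andP; split; lra.
(* [g k] is [F (height u) * axis i u] transported by the reflection in [w k]. [f k] is [g k / t k]
   plus a multiple of an integrand with zero mean by [flip_zero], chosen to make a difference
   quotient of [F] appear. The factor [\1_S] keeps both bounded off the sphere. *)
pose g k (u : borel_rV R d) := F (C k * height u + t k * (rd * axis i u)) *
  (t k * axis 0 u - C k * axis i u) * \1_S u.
pose f k (u : borel_rV R d) :=
  (F (C k * height u + t k * (rd * axis i u)) * axis 0 u
    - C k * ((F (C k * height u + t k * (rd * axis i u)) - F (C k * height u)) / t k)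
     * axis i u) * \1_S u.
have inS k u : S u -> `|C k * height u + t k * (rd * axis i u)| <= rd.
  move=> Su; have [w1 wu w0 wi] := wE k.
  have SQ : S ((u : 'rV[R]_d) *m reflection (w k)).
    by rewrite /unit_sphere/= dotp_orthogonal//; exact: reflection_orthogonal.
  apply: le_trans (height_le SQ); rewrite /height /axis (reflectE k u).1.
  by rewrite le_eqVlt; apply/orP; left; apply/eqP; congr (`|_|); ring.
have inS' k u : S u -> `|C k * height u| <= rd.
  by move=> Su; rewrite normrM -[leRHS]mul1r; apply: ler_pM => //; exact: height_le.
have mFC k : measurable_fun setT (fun u => F (C k * height u)).
  apply: measurableT_comp => //; apply: measurable_funM => //; exact: measurable_height.
have mFt k : measurable_fun setT (fun u => F (C k * height u + t k * (rd * axis i u))).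
  apply: measurableT_comp => //; apply: measurable_funD; apply: measurable_funM => //.
    exact: measurable_height.
  by apply: measurable_funM => //; exact: measurable_coord.
have mS := measurable_indic_sphere.
have mg k : measurable_fun setT (g k).
  apply: measurable_funM => //; apply: measurable_funM => //.
  by apply: measurable_funB; apply: measurable_funM => //; exact: measurable_coord.
have mf k : measurable_fun setT (f k).
  apply: measurable_funM => //; apply: measurable_funB.
    by apply: measurable_funM => //; exact: measurable_coord.
  apply: measurable_funM; last exact: measurable_coord.
  apply: measurable_funM => //; apply: measurable_funM => //; exact: measurable_funB.
have fM k u : `|f k u| <= M + rd * M.
  have B0 : 0 <= M + rd * M by rewrite addr_ge0// mulr_ge0// ltW.
  rewrite /f indicE; case: (boolP (u \in _)) => [/set_mem Su|_]; last by rewrite mulr0 normr0.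
  rewrite mulr1; apply: le_trans (ler_normB _ _) _; apply: lerD.
    by rewrite normrM -[leRHS]mulr1; apply: ler_pM => //; exact: coord_le1.
  have [c [_ _]] := mvt_two_points dF (inS' k u Su) (inS k u Su).
  rewrite [_ + _ - C k * height u]addrAC subrr add0r => ->.
  have -> : C k * (F' c * (t k * (rd * axis i u)) / t k) * axis i u =
     (C k * (axis i u * axis i u)) * (rd * F' c).
    by field; exact: lt0r_neq0.
  rewrite normrM -[leRHS]mul1r; apply: ler_pM => //.
    by rewrite !normrM mulr_ile1 ?mulr_ile1 ?mulr_ge0// coord_le1.
  by rewrite normrM gtr0_norm// ler_pM2l.
have gint k : \int[mu]_u g k u = 0.
  have [w1 wu w0 wi] := wE k.
  have oQ := reflection_orthogonal w1.
  pose G (u : borel_rV R d) := F (height u) * (axis i u * \1_S u).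
  have mG : measurable_fun setT G.
    apply: measurable_funM; first by apply: measurableT_comp => //; exact: measurable_height.
    by apply: measurable_funM => //; exact: measurable_coord.
  have GM u : `|G u| <= M.
    by rewrite normrM -[leRHS]mulr1; apply: ler_pM => //; exact: norm_coord_indic.
  rewrite -(flip_zero mF FM) -(Rintegral_orthogonal mu_unif oQ mG GM).
  congr Rintegral; apply/funext => u; rewrite /g /G indic_sphere_orthogonal//.
  rewrite [RHS]mulrA; congr (_ * _); rewrite /height /axis (reflectE k u).1 (reflectE k u).2.
  by congr (F _ * _); ring.
have fint k : \int[mu]_u f k u = 0.
  have -> : f k = (fun u => (t k)^-1 * g k u + (C k / t k) * (F (C k * height u) * (axis i u * \1_S u))).
    by apply/funext => u; rewrite /f /g; field; exact: lt0r_neq0.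
  have mFC' : measurable_fun setT (fun x => F (C k * x)) by exact: measurableT_comp.
  have FCM x : `|F (C k * x)| <= M by [].
  have z := @flip_zero (fun x => F (C k * x)) mFC' FCM.
  have gi : mu.-integrable setT (EFin \o g k).
    apply: (@bounded_integrable _ _ _ mu _ (M * (t k + 1))) => // u.
    rewrite /g -mulrA normrM; apply: ler_pM => //; rewrite mulrBl.
    apply: le_trans (ler_normB _ _) _; rewrite -[t k * _ * _]mulrA -[C k * _ * _]mulrA.
    apply: lerD; rewrite [leLHS]normrM.
      by rewrite gtr0_norm// ger_pMr// norm_coord_indic.
    by rewrite mulr_ile1// norm_coord_indic.
  have hi : mu.-integrable setT (EFin \o (fun u => F (C k * height u) * (axis i u * \1_S u))).
    apply: (@bounded_integrable _ _ _ mu _ M) => [|u].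
      by apply: measurable_funM => //; apply: measurable_funM => //; exact: measurable_coord.
    by rewrite normrM -[leRHS]mulr1; apply: ler_pM => //; exact: norm_coord_indic.
  rewrite RintegralD//; [|exact: (integrableZl measurableT _ gi)|exact: (integrableZl measurableT _ hi)].
  by rewrite RintegralZl// RintegralZl// gint z !mulr0 addr0.
have fc u : f k u @[k --> \oo] -->
    (F (height u) * axis 0 u - F' (height u) * (rd * axis i u ^+ 2)) * \1_S u.
  rewrite /f; case: (pselect (S u)) => Su; last first.
    rewrite indicE memNset// mulr0; under eq_fun do rewrite mulr0; exact: cvg_cst.
  rewrite indicE mem_set// mulr1; under eq_fun do rewrite mulr1.
  have hu := height_le Su.
  have dq := difference_quotient_cvg dF (cF' hu) C_cvg t_cvg t_gt0
    (fun k => inS' k u Su) (fun k => inS k u Su).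
  have Cd : C k * ((F (C k * height u + t k * (rd * axis i u)) - F (C k * height u)) / t k)
      @[k --> \oo] --> 1 * (F' (height u) * (rd * axis i u)) by exact: cvgM.
  rewrite mul1r in Cd.
  have Fc : F (C k * height u + t k * (rd * axis i u)) @[k --> \oo] --> F (height u).
    have cF : {for height u, continuous F}.
      by apply: differentiable_continuous; apply/derivable1_diffP; have [] := dF hu.
    have ac : C k * height u + t k * (rd * axis i u) @[k --> \oo] -->
        1 * height u + 0 * (rd * axis i u) by apply: cvgD; exact: cvgMr_tmp.
    rewrite mul1r mul0r addr0 in ac; exact: (cvg_comp _ F ac cF).
  have -> : F' (height u) * (rd * axis i u ^+ 2) = F' (height u) * (rd * axis i u) * axis i u by ring.
  by apply: cvgB; exact: cvgMr_tmp.
have := @bounded_cvg_Rintegral _ _ _ mu f _ _ mf fM fc.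
rewrite (_ : (fun k => _) = (fun=> 0)); last by apply/funext => k; exact: fint.
by move=> /cvg_lim => <- //; rewrite lim_cst.
Qed.

End TwoCoordinates.
End SteinIdentity.

(** * Compactly supported functions and their primitives *)

Section CompactSupport.
Context {R : realType}.
Implicit Types K : R -> R.

Lemma near_zero_outside K (r x : R) : (forall y, r <= `|y| -> K y = 0) -> r < `|x| ->
  \forall y \near x, K y = 0.
Proof.
move=> K0 rx; have op : open [set y : R | r < `|y|].
  rewrite [X in open X](_ : _ = (fun y : R => `|y|) @^-1` [set y | y > r])//.
  by apply: open_comp => [y _|]; [exact: norm_continuous|exact: open_gt].
have : nbhs x [set y : R | r < `|y|] by exact: open_nbhs_nbhs.
by apply: filterS => y /= /ltW; exact: K0.
Qed.

Lemma continuous_glue K (r r' : R) : r < r' ->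
  (forall x, `|x| < r' -> {for x, continuous K}) ->
  (forall x, r <= `|x| -> K x = 0) -> continuous K.
Proof.
move=> rr' cK K0 x; have [|xr] := ltP `|x| r'; first exact: cK.
have rx : r < `|x| by exact: lt_le_trans xr.
rewrite /continuous_at K0; last exact: ltW.
apply: cvg_near_cst; exact: near_zero_outside rx.
Qed.

Lemma compact_support_bounded K (r : R) : 0 < r -> continuous K ->
  (forall x, r <= `|x| -> K x = 0) -> exists M : R, forall x, `|K x| <= M.
Proof.
move=> r0 cK K0.
have [||c _ cmax] := @EVT_max R (fun x => `|K x|) (- r) r.
- by lra.
- apply: continuous_subspaceT => x.
  by apply: (@continuous_comp _ _ _ K (fun y : R => `|y|)); [exact: cK|exact: norm_continuous].
exists `|K c| => x; have [xr|rx] := ltP `|x| r; last by rewrite K0 ?normr0.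
by apply: cmax; rewrite in_itv/= -ler_norml ltW.
Qed.

Lemma compact_support_integrable K (r : R) : 0 < r -> continuous K ->
  (forall x, r <= `|x| -> K x = 0) ->
  (@lebesgue_measure R).-integrable setT (EFin \o K).
Proof.
move=> r0 cK K0; have [M KM] := compact_support_bounded r0 cK K0.
have mK : measurable_fun setT K by exact: continuous_measurable_fun.
have : (@lebesgue_measure R).-integrable `[- r, r] (EFin \o K).
  apply: measurable_bounded_integrable => //=.
  - by rewrite lebesgue_measure_itv/=; case: ifPn => // _; rewrite -EFinB ltry.
  - exact: measurable_funTS.
  - exists M; split; first exact: num_real.
    by move=> y My z _ /=; exact: le_trans (KM z) (ltW My).
move=> iK.
have := (@integrable_mkcond _ _ R (@lebesgue_measure R) `[- r, r]%classic (EFin \o K) (measurable_itv _)).1 iK.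
congr (integrable _ _ _); apply/funext => x; rewrite patchE; case: ifPn => // /negP xr.
rewrite /= K0// leNgt; apply/negP => xr'; apply: xr.
by apply/mem_set; rewrite /= in_itv/= -ler_norml ltW.
Qed.

Definition primitive K (x : R) : R := \int[lebesgue_measure]_(t in `]-oo, x]) K t.

Lemma is_derive_primitive K (r : R) (x : R) : 0 < r -> continuous K ->
  (forall x, r <= `|x| -> K x = 0) -> is_derive x 1 (primitive K) (K x).
Proof.
move=> r0 cK K0.
have Ki := compact_support_integrable r0 cK K0.
have [||||dP PE] := @continuous_FTC1 R K -oo%O x (x + 1).
- by rewrite ltrDl.
- by apply: integrableS Ki.
- by rewrite /Order.lt/=.
- exact: cK.
by apply: DeriveDef; [exact: dP|rewrite -derive1E].
Qed.

Lemma primitive_zero K (r : R) (x : R) : \int[lebesgue_measure]_t K t = 0 ->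
  (forall x, r <= `|x| -> K x = 0) -> r <= `|x| -> primitive K x = 0.
Proof.
move=> K1 K0 rx; have [x0|x0] := leP 0 x.
  rewrite -K1 /primitive Rintegral_mkcond; congr Rintegral; apply/funext => t.
  rewrite patchE; case: ifPn => // /negP tx; rewrite K0//.
  have xt : x < t by rewrite ltNge; apply/negP => tx'; apply: tx; apply/mem_set; rewrite /= in_itv.
  by move: rx; rewrite !ger0_norm//; [move=> rx; lra|lra].
rewrite /primitive (@eq_Rintegral _ _ _ _ _ (fun=> 0)); first by rewrite Rintegral_cst// mul0r.
move=> t /set_mem; rewrite /= in_itv/= => tx; apply: K0; apply: (le_trans rx).
by rewrite !ler0_norm; lra.
Qed.

End CompactSupport.

Lemma Rintegral_bounded_sum disp (T : measurableType disp) {R : realType}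
    (P : probability T R) (I : Type) (s : seq I) (p : pred I) (f : I -> T -> R) (M : R) :
  (forall i, measurable_fun setT (f i)) -> (forall i x, `|f i x| <= M) ->
  P.-integrable setT (EFin \o (fun x => \sum_(i <- s | p i) f i x)) /\
  \int[P]_x (\sum_(i <- s | p i) f i x) = \sum_(i <- s | p i) \int[P]_x f i x.
Proof.
move=> mf fM; have fi i : P.-integrable setT (EFin \o f i).
  exact: (bounded_integrable P (mf i) (fM i)).
elim: s => [|i s [IH1 IH2]].
  under eq_fun do rewrite big_nil; rewrite big_nil Rintegral_cst// mul0r; split=> //.
  by apply: (@bounded_integrable _ _ _ P _ 0) => // x; rewrite normr0.
rewrite big_cons; under eq_fun do rewrite big_cons; case: (p i) => //.
split; first exact: (integrableD measurableT (fi i) IH1).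
by rewrite RintegralD// IH2.
Qed.

(* Unnormalized density of sqrt d times a coordinate of a uniform point of
   S^(d-1); it vanishes for |y| >= sqrt d since Num.sqrt is 0 on negatives. *)
Definition height_weight {R : realType} (d : nat) (y : R) : R :=
  Num.sqrt (1 - y ^+ 2 / d%:R) ^+ (d - 3).

Section HeightWeight.
Context {R : realType}.
Implicit Types (d : nat) (y : R).

Lemma continuous_shape d : continuous (fun y : R => 1 - y ^+ 2 / d%:R).
Proof.
move=> y; apply: cvgB; first exact: cvg_cst.
by apply: cvgMr_tmp; exact: exprn_continuous.
Qed.

Lemma continuous_height_weight d : continuous (@height_weight R d).
Proof.
move=> y; apply: (@continuous_comp _ _ _ (fun y : R => Num.sqrt (1 - y ^+ 2 / d%:R))
  (fun z : R => z ^+ (d - 3))); last exact: exprn_continuous.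
apply: (@continuous_comp _ _ _ (fun y : R => 1 - y ^+ 2 / d%:R) Num.sqrt).
  exact: continuous_shape.
exact: sqrt_continuous.
Qed.

Lemma measurable_height_weight d : measurable_fun setT (@height_weight R d).
Proof. by apply: continuous_measurable_fun; exact: continuous_height_weight. Qed.

Lemma height_weight_ge0 d y : 0 <= height_weight d y.
Proof. by rewrite exprn_ge0// sqrtr_ge0. Qed.

Lemma height_weight_le1 d y : height_weight d y <= 1.
Proof.
apply: exprn_ile1; first exact: sqrtr_ge0.
by rewrite -[leRHS]sqrtr1 ler_wsqrtr// gerBl divr_ge0// sqr_ge0.
Qed.

Lemma shape_gt0 d y : (0 < d)%N -> (0 < 1 - y ^+ 2 / d%:R) = (`|y| < Num.sqrt d%:R).
Proof.
move=> d0; have dR : 0 < d%:R :> R by rewrite ltr0n.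
rewrite subr_gt0 ltr_pdivrMr// mul1r -[LHS](@ltr_sqrt _ (y ^+ 2))//.
by rewrite sqrtr_sqr.
Qed.

(** For [d <= 3] the truncated exponent [d - 3] is 0 and the weight is constantly 1; only a positive
    exponent makes it vanish here. *)
Lemma height_weight_eq0 d y : (3 < d)%N -> Num.sqrt d%:R <= `|y| -> height_weight d y = 0.
Proof.
move=> d3 dy; rewrite /height_weight ler0_sqrtr; last first.
  by rewrite leNgt shape_gt0 ?(ltn_trans _ d3)// -leNgt.
by rewrite expr0n subn_eq0 leqNgt d3.
Qed.

Lemma height_weight_gt0 d y : (0 < d)%N -> `|y| < Num.sqrt d%:R -> 0 < height_weight d y.
Proof. by move=> d0 h; rewrite exprn_gt0// sqrtr_gt0 shape_gt0. Qed.

End HeightWeight.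

Section HeightLaw.
Context {R : realType} {m : nat}.
Local Notation d := m.+4.
Variable mu : probability (borel_rV R d) R.
Hypothesis mu_unif : uniform_on_sphere mu.
Local Notation S := (@unit_sphere R d : set (borel_rV R d)).
Local Notation rd := (Num.sqrt d%:R : R).
Local Notation W := (@height_weight R d).
Local Notation Y := (@height R m).
Local Notation leb := (@lebesgue_measure R).

(** The sum of [stein_pair] over [i != 0], times [rd]: on the sphere the squares of the other [m.+3]
    coordinates add up to [1 - axis 0 u ^+ 2]. *)
Lemma stein_height (F F' : R -> R) (M : R) :
  measurable_fun setT F -> measurable_fun setT F' ->
  (forall x, `|F x| <= M) -> (forall x, `|F' x| <= M) ->
  (forall x : R, `|x| <= rd -> is_derive x 1 F (F' x)) ->
  (forall x : R, `|x| <= rd -> {for x, continuous F'}) ->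
  \int[mu]_u ((m.+3%:R * (Y u * F (Y u)) - (d%:R - Y u ^+ 2) * F' (Y u)) * \1_S u) = 0.
Proof.
move=> mF mF' FM FM' dF cF'.
pose G (i : 'I_d) (u : borel_rV R d) :=
  (F (Y u) * axis 0 u - F' (Y u) * (rd * axis i u ^+ 2)) * \1_S u.
have mG i : measurable_fun setT (G i).
  apply: measurable_funM; last exact: measurable_indic_sphere.
  apply: measurable_funB; apply: measurable_funM.
  - by apply: measurableT_comp => //; exact: measurable_height.
  - exact: measurable_coord.
  - by apply: measurableT_comp => //; exact: measurable_height.
  - by apply: measurable_funM => //; apply: measurable_funX; exact: measurable_coord.
have rd0 := @rd_gt0 R m.
have M0 : 0 <= M by exact: le_trans (FM 0).
have GM i u : `|G i u| <= M + M * rd.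
  rewrite /G indicE; case: (boolP (u \in _)) => [/set_mem Su|_]; last first.
    by rewrite mulr0 normr0 addr_ge0// mulr_ge0// ltW.
  rewrite mulr1; apply: le_trans (ler_normB _ _) _.
  have c1 j := coord_le1 j Su.
  apply: lerD; rewrite normrM.
    by rewrite -[leRHS]mulr1; apply: ler_pM.
  apply: ler_pM => //; rewrite normrM gtr0_norm// ger_pMr// normrX.
  exact: exprn_ile1.
have Gint i : i != 0 -> \int[mu]_u G i u = 0.
  by move=> i0; exact: (stein_pair mu_unif i0 mF FM FM' dF cF').

have sumG : \int[mu]_u (\sum_(i < d | i != 0) G i u) = 0.
  by rewrite (Rintegral_bounded_sum mu _ _ mG GM).2 big1.
rewrite -[RHS](mulr0 rd) -sumG -RintegralZl//; last first.
  exact: (Rintegral_bounded_sum mu _ _ mG GM).1.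
congr Rintegral; apply/funext => u.
rewrite /G -mulr_suml sumrB sumr_const -mulr_sumr -mulr_sumr.
have [Su|nSu] := pselect (S u); last by rewrite indicE memNset// !mulr0.
rewrite indicE mem_set// !mulr1.
have -> : \sum_(i < d | i != 0) axis i u ^+ 2 = 1 - axis 0 u ^+ 2.
  have h : axis 0 u * axis 0 u + \sum_(i < d | i != 0) axis i u * axis i u = 1.
    by have := (Su : dotp u u = 1); rewrite /dotp (bigD1 0).
  rewrite -[in RHS]h [axis 0 u ^+ 2]expr2 addrAC subrr add0r.
  by apply: eq_bigr => i _; rewrite expr2.
have -> : #|(fun i : 'I_d => i != 0)| = m.+3.
  by have := cardC1 (0 : 'I_d); rewrite card_ord.
have E : d%:R = rd ^+ 2 :> R by rewrite sqr_sqrtr.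
rewrite -[_ *+ m.+3]mulr_natl /height; move: E; move: (Num.sqrt _) => r0 ->; ring.
Qed.

(** Solution of the Stein equation: let [T] be the primitive of [h * W], and
    [g = (1 - y^2 / d)^(-(d - 1) / 2)]. Then [F = T * g] satisfies
    [(d - 1) y F - (d - y^2) F' = - d h]. Since [h * W] has integral 0, [T] vanishes for [r <= |y|],
    so the singularity of [g] at [rd] is never met. *)
Lemma height_null (h : R -> R) (r : R) : 0 < r -> r < rd -> continuous h ->
  (forall x, r <= `|x| -> h x = 0) ->
  \int[leb]_x (h x * W x) = 0 -> \int[mu]_u h (Y u) = 0.
Proof.
move=> r0 rrd ch h0 hW.
pose K x := h x * W x.
have cK : continuous K.
  by move=> x; apply: continuousM; [exact: ch|exact: continuous_height_weight].
have K0 x : r <= `|x| -> K x = 0 by move=> rx; rewrite /K h0// mul0r.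
pose sg (y : R) : R := Num.sqrt (1 - y ^+ 2 / d%:R).
pose g (y : R) : R := (sg y ^+ m.+3)^-1.
pose g' (y : R) : R := m.+3%:R * (y / d%:R) * (sg y ^+ m.+4.+1)^-1.
pose T := primitive K.
pose F y := T y * g y.
pose F' y := K y * g y + T y * g' y.
have T0 x : r <= `|x| -> T x = 0 by exact: primitive_zero hW K0.
have dT (x : R) : is_derive x 1 T (K x) by exact: is_derive_primitive r0 cK K0.
have cT : continuous T.
  move=> x; apply: differentiable_continuous; apply/derivable1_diffP.
  by have [] := dT x.
have sg0 x : `|x| < rd -> 0 < sg x by move=> xr; rewrite sqrtr_gt0 shape_gt0.
have csg : continuous sg.
  move=> x; apply: (@continuous_comp _ _ _ (fun y : R => 1 - y ^+ 2 / d%:R) Num.sqrt).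
    exact: continuous_shape.
  exact: sqrt_continuous.
have cpow k x : `|x| < rd -> {for x, continuous (fun y => (sg y ^+ k)^-1)}.
  move=> xr; apply: continuousV; first by rewrite expf_neq0// gt_eqF// sg0.
  apply: (@continuous_comp _ _ _ sg (fun z : R => z ^+ k)); first exact: csg.
  exact: exprn_continuous.
have cF : continuous F.
  apply: (continuous_glue rrd) => x xr; last by rewrite /F T0// mul0r.
  by apply: continuousM; [exact: cT|exact: cpow].
have cF' : continuous F'.
  apply: (continuous_glue rrd) => x xr; last by rewrite /F' T0// K0// !mul0r addr0.
  apply: continuousD; apply: continuousM; [exact: cK|exact: cpow|exact: cT|].
  apply: continuousM; last exact: cpow.
  apply: continuousM; first exact: cst_continuous.
  by apply: continuousM; [exact: cvg_id|exact: cst_continuous].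
have F0 x : r <= `|x| -> F x = 0 by move=> rx; rewrite /F T0// mul0r.
have F'0 x : r <= `|x| -> F' x = 0 by move=> rx; rewrite /F' T0// K0// !mul0r addr0.
have dF (x : R) : is_derive x 1 F (F' x).
  have [xr|rx] := ltP `|x| rd; last first.
    have rx' : r < `|x| by exact: lt_le_trans rx.
    rewrite F'0; last exact: ltW.
    apply: near_eq_is_derive (is_derive_cst 0 x 1).
    by have := near_zero_outside F0 rx'; apply: filterS => y ->.
  have sx := sg0 _ xr.
  have dsg : is_derive x 1 sg (- (x / d%:R) / sg x).
    have s0 : 0 < 1 - x ^+ 2 / d%:R :> R by rewrite shape_gt0.
    have dsh : is_derive x 1 (fun y : R => 1 - y ^+ 2 / d%:R) (- (2 * x / d%:R)).
      by apply: is_derive_eq; rewrite /GRing.scale/=; ring.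
    have ds := is_derive1_sqrt s0.
    have := @is_derive1_comp _ Num.sqrt (fun y : R => 1 - y ^+ 2 / d%:R) x _ _ ds dsh.
    move=> D; apply: (is_derive_eq D); rewrite /sg /GRing.scale/=.
    have d0 : d%:R != 0 :> R by rewrite pnatr_eq0.
    have E (e z : R) : e != 0 -> z != 0 -> (2 * z)^-1 * - (2 * x / e) = - (x / e) / z.
      by move=> e0 z0; field; rewrite e0 z0.
    by apply: E => //; rewrite gt_eqF// sqrtr_gt0.
  have dg : is_derive x 1 g (g' x).
    have dp := @is_deriveX _ _ sg m.+3 x 1 _ dsg.
    have pn : (sg ^+ m.+3) x != 0 by rewrite exprfctE expf_neq0// gt_eqF.
    have := is_deriveV pn dp; rewrite exprfctE => D.
    apply: (is_derive_eq D); rewrite /g' /GRing.scale/=.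
    have d0 : d%:R != 0 :> R by rewrite pnatr_eq0.
    have sn : sg x != 0 by rewrite gt_eqF.
    have E (e z p c : R) : e != 0 -> z != 0 -> p != 0 ->
        - (z * p) ^- 2 * (c * p * (- (x / e) / z)) = c * (x / e) * (z * (z * (z * p)))^-1.
      by move=> e0 z0 p0; field; rewrite e0 z0 p0.
    rewrite !(exprS _ m.+4) !(exprS _ m.+3) !(exprS _ m.+2) -E ?expf_neq0//.
  have := is_deriveM (dT x) dg => D.
  by apply: (is_derive_eq D); rewrite /F' /GRing.scale/=; ring.
have [M1 FM] := compact_support_bounded r0 cF F0.
have [M2 FM'] := compact_support_bounded r0 cF' F'0.
pose M := Num.max M1 M2.
have FMm x : `|F x| <= M by rewrite le_max FM.
have FMm' x : `|F' x| <= M by rewrite le_max FM' orbT.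
have := @stein_height F F' M (continuous_measurable_fun cF) (continuous_measurable_fun cF')
  FMm FMm' (fun x _ => dF x) (fun x _ => cF' x).
have -> : (fun u => (m.+3%:R * (Y u * F (Y u)) - (d%:R - Y u ^+ 2) * F' (Y u)) * \1_S u) =
   (fun u => (- d%:R) * (h (Y u) * \1_S u)).
  apply/funext => u; rewrite [RHS]mulrA; congr (_ * _).
  have [xr|rx] := ltP `|Y u| r; last by rewrite F0// F'0// h0// !mulr0 subr0.
  have sx := sg0 _ (lt_trans xr rrd); have s2 : sg (Y u) ^+ 2 = 1 - Y u ^+ 2 / d%:R.
    by rewrite sqr_sqrtr// ltW// -sqrtr_gt0.
  have d0 : d%:R != 0 :> R by rewrite pnatr_eq0.
  have -> : d%:R - Y u ^+ 2 = d%:R * sg (Y u) ^+ 2 by rewrite s2; field.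
  have WE : W (Y u) = sg (Y u) ^+ m.+1 by rewrite /height_weight subSS subSS subSS subn0.
  rewrite /F' /F /K /g /g' WE (exprS _ m.+2) (exprS _ m.+1) (exprS _ m.+4) (exprS _ m.+3).
  rewrite (exprS _ m.+2) (exprS _ m.+1).
  have s0 : sg (Y u) != 0 by rewrite gt_eqF.
  have sm0 : sg (Y u) ^+ m.+1 != 0 by rewrite expf_neq0.
  have E (e z p c y t k : R) : e != 0 -> z != 0 -> p != 0 ->
      c * (y * (t / (z * (z * p)))) - e * z ^+ 2 * (k * p / (z * (z * p)) +
        t * (c * (y / e) / (z * (z * (z * (z * p)))))) = - e * k.
    by move=> e0 z0 p0; field; rewrite e0 z0 p0.
  exact: E.
have [Mh hM] := compact_support_bounded r0 ch h0.
have mhY : measurable_fun setT (h \o Y).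
  apply: measurableT_comp; last exact: measurable_height.
  exact: continuous_measurable_fun.
have mhS : measurable_fun setT (fun u => h (Y u) * \1_S u).
  by apply: measurable_funM => //; exact: measurable_indic_sphere.
have hS u : `|h (Y u) * \1_S u| <= Mh.
  rewrite indicE normrM; case: (_ \in _); rewrite ?normr1 ?mulr1// normr0 mulr0.
  exact: le_trans (hM 0).
rewrite RintegralZl//; last exact: (bounded_integrable mu mhS hS).
move=> /eqP; rewrite mulf_eq0 oppr_eq0 pnatr_eq0 /= => /eqP <-.
apply: (ae_Rintegral mu_unif) => // u Su.
by rewrite indicE Su mulr1.
Qed.

End HeightLaw.

(** * Measures given by a density *)

Section DensityMeasure.
Context dT (T : measurableType dT) {R : realType}.
Variables (leb : {measure set T -> \bar R}) (q : T -> R).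
Hypotheses (q0 : forall x, 0 <= q x) (mq : measurable_fun setT q).

(** The two proofs are carried by the term, so that its measure structure can be inferred from
    it. *)
Definition density_measure of (forall x, 0 <= q x) & measurable_fun setT q :=
  fun A : set T => (\int[leb]_(x in A) (q x)%:E)%E.
Local Notation nu := (density_measure q0 mq).

Let nu_set0 : nu set0 = 0%E.
Proof. by rewrite /density_measure integral_set0. Qed.

Let nu_ge0 A : (0 <= nu A)%E.
Proof. by apply: integral_ge0 => x _; rewrite lee_fin. Qed.

Let nu_sigma_additive : semi_sigma_additive nu.
Proof.
apply: semi_sigma_additive_nng_induced => [|x]; last by rewrite lee_fin.
exact/measurable_EFinP.
Qed.

HB.instance Definition _ := isMeasure.Build _ _ _ nu nu_set0 nu_ge0 nu_sigma_additive.

Import HBNNSimple.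

Lemma integral_density (g : T -> \bar R) : (forall x, (0 <= g x)%E) -> measurable_fun setT g ->
  (\int[nu]_x g x = \int[leb]_x (g x * (q x)%:E))%E.
Proof.
move=> g0 mg; pose h := nnsfun_approx measurableT mg.
have mqE : measurable_fun setT (fun x => (q x)%:E) by exact/measurable_EFinP.
have -> : (\int[nu]_x g x = lim (\int[nu]_x (h n x)%:E @[n --> \oo]))%E.
  under eq_integral => x _.
    rewrite (_ : g x = lim ((h n x)%:E @[n --> \oo])); last first.
      by apply/esym/cvg_lim => //; exact: cvg_nnsfun_approx.
    over.
  apply: monotone_convergence => //.
  - by move=> n; apply/measurable_EFinP.
  - by move=> n x _; rewrite lee_fin.
  - by move=> x _ a b ab; rewrite lee_fin; exact/lefP/nd_nnsfun_approx.
have -> : (\int[leb]_x (g x * (q x)%:E) = lim (\int[leb]_x ((h n x)%:E * (q x)%:E) @[n --> \oo]))%E.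
  under eq_integral => x _.
    rewrite (_ : (g x * _)%E = lim ((h n x)%:E * (q x)%:E @[n --> \oo])%E); last first.
      by apply/esym/cvg_lim => //; apply: cvgeZr => //; exact: cvg_nnsfun_approx.
    over.
  apply: monotone_convergence => //.
  - by move=> n; apply: emeasurable_funM => //; exact/measurable_EFinP.
  - by move=> n x _; rewrite mule_ge0 ?lee_fin.
  - move=> x _ a b ab; rewrite lee_wpmul2r ?lee_fin//; exact/lefP/nd_nnsfun_approx.
suff E n : (\int[nu]_x (h n x)%:E = \int[leb]_x ((h n x)%:E * (q x)%:E))%E.
  by under eq_fun do rewrite E.
have mi (r : R) : measurable_fun setT (fun x => (r * \1_(h n @^-1` [set r]) x)%:E).
  by apply/measurable_EFinP; exact: measurable_funM.
transitivity (\int[nu]_x (\sum_(y \in range (h n)) (y * \1_(h n @^-1` [set y]) x)%:E))%E.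
  by apply: eq_integral => t _; rewrite fimfunE -fsumEFin.
rewrite ge0_integral_fsum//; last by move=> r x _; exact: nnfun_muleindic_ge0.
transitivity (\int[leb]_x (\sum_(y \in range (h n))
    (y * \1_(h n @^-1` [set y]) x)%:E * (q x)%:E))%E; last first.
  apply: eq_integral => x _.
  rewrite -ge0_mule_fsuml => [|y]; last exact: nnfun_muleindic_ge0.
  by rewrite fsumEFin// -(fimfunE _ x).
rewrite ge0_integral_fsum//; last 2 first.
  - by move=> r; apply: emeasurable_funM.
  - by move=> r x _; apply: mule_ge0; [exact: nnfun_muleindic_ge0|rewrite lee_fin].
apply: eq_fsbigr => r rhn.
have r0 : 0 <= r by move: rhn => /set_mem[x _ <-].
under eq_integral do rewrite EFinM.
rewrite ge0_integralZl//; last exact/measurable_EFinP.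
under [RHS]eq_integral do rewrite EFinM -muleA.
rewrite ge0_integralZl//; last first.
  - by move=> x _; rewrite mule_ge0// lee_fin.
  - by apply: emeasurable_funM => //; exact/measurable_EFinP.
congr (_ * _)%E; rewrite integral_indic// setIT.
transitivity (\int[leb]_(x in h n @^-1` [set r]) (q x)%:E)%E => //.
rewrite integral_mkcond; apply: eq_integral => x _; rewrite patchE indicE.
by case: ifPn; rewrite ?mul1e ?mul0e.
Qed.

End DensityMeasure.

Section Bump.
Context {R : realType}.
Implicit Types (b c y : R) (n : nat).

(** A continuous approximation of the indicator of []b, c[] whose support stays [n.+1%:R^-1] away
    from the end points: [height_null] asks for such a margin below [rd]. *)
Definition bump b c n y : R := Num.min 1 (Num.max 0 (n.+1%:R * Num.min (y - b) (c - y) - 1)).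

Lemma continuous_bump b c n : continuous (bump b c n).
Proof.
move=> y; have cs (z : R) (f : R -> R) := @cst_continuous R R z.
apply: (@continuous_min R R (fun=> 1) (fun y => Num.max 0 (n.+1%:R * Num.min (y - b) (c - y) - 1)) y).
  exact: cst_continuous.
apply: (@continuous_max R R (fun=> 0) (fun y => n.+1%:R * Num.min (y - b) (c - y) - 1) y).
  exact: cst_continuous.
apply: cvgB; last exact: cvg_cst.
apply: cvgMl_tmp.
apply: (@continuous_min R R (fun y => y - b) (fun y => c - y) y); apply: cvgB.
- exact: cvg_id.
- exact: cvg_cst.
- exact: cvg_cst.
- exact: cvg_id.
Qed.

Lemma bump_ge0 b c n y : 0 <= bump b c n y.
Proof. by rewrite le_min ler01 le_max lexx. Qed.

Lemma bump_le1 b c n y : bump b c n y <= 1.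
Proof. by rewrite ge_min lexx. Qed.

Lemma norm_bump b c n y : `|bump b c n y| <= 1.
Proof. by rewrite ger0_norm ?bump_ge0 ?bump_le1. Qed.

Lemma bump_eq0 b c n y : Num.min (y - b) (c - y) <= n.+1%:R^-1 -> bump b c n y = 0.
Proof.
move=> h; rewrite /bump; move: (Num.min (y - b) _) h => t h.
rewrite max_l; first by rewrite min_r.
by rewrite subr_le0 -ler_pdivlMl ?ltr0n// mulr1.
Qed.

Lemma bump_cvg b c y : bump b c n y @[n --> \oo] --> (\1_`]b, c[%classic y : R).
Proof.
have [ybc|ybc] := ltP 0 (Num.min (y - b) (c - y)); last first.
  rewrite (_ : (fun n => _) = (fun=> 0)); last first.
    by apply/funext => n; rewrite bump_eq0// (le_trans ybc)// invr_ge0.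
  rewrite indicE memNset; first exact: cvg_cst.
  by rewrite /= in_itv/= => /andP[h1 h2]; move: ybc; rewrite leNgt lt_min !subr_gt0 h1 h2.
rewrite indicE mem_set; last by rewrite /= in_itv/=; move: ybc; rewrite lt_min !subr_gt0.
apply: cvg_near_cst.
near=> n; rewrite /bump min_l// le_max; apply/orP; right.
rewrite lerBrDr -ler_pdivrMr//.
apply: (@le_trans _ _ n%:R); last by rewrite ler_nat.
by near: n; exact: nbhs_infty_ger.
Unshelve. all: by end_near. Qed.

End Bump.

Lemma eq_lee {R : realType} (x y : \bar R) : x = y -> (x <= y)%E.
Proof. by move=> ->. Qed.

Lemma integrable_scale dT (T : measurableType dT) {R : realType} (nu : {measure set T -> \bar R})
    (c : R) (f : T -> R) :
  nu.-integrable setT (EFin \o f) -> nu.-integrable setT (EFin \o (fun x => c * f x)).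
Proof.
move=> fi; rewrite (_ : _ \o _ = (fun x => c%:E * (EFin \o f) x)%E).
  exact: integrableZl.
by apply/funext => x; rewrite /= EFinM.
Qed.

(** * The density of a coordinate *)

Section HeightDensity.
Context {R : realType} {m : nat}.
Local Notation d := m.+4.
Variable mu : probability (borel_rV R d) R.
Hypothesis mu_unif : uniform_on_sphere mu.
Local Notation S := (@unit_sphere R d : set (borel_rV R d)).
Local Notation rd := (Num.sqrt d%:R : R).
Local Notation W := (@height_weight R d).
Local Notation Y := (@height R m).
Local Notation leb := (@lebesgue_measure R).

Lemma rd_gt1 : 1 < rd.
Proof. by rewrite -[ltLHS]sqrtr1 ltr_sqrt ?ltr1n// ltr0n. Qed.

Lemma integrable_height_weight : leb.-integrable setT (EFin \o W).
Proof.
apply: (compact_support_integrable (@rd_gt0 R m)); first exact: continuous_height_weight.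
by move=> x; exact: height_weight_eq0.
Qed.

Lemma integrableM_height_weight (h : R -> R) (M : R) : measurable_fun setT h ->
  (forall x, `|h x| <= M) -> leb.-integrable setT (EFin \o (fun x => h x * W x)).
Proof.
move=> mh hM.
apply: (@le_integrable _ _ R leb setT measurableT _ (EFin \o (fun x => M * W x))).
- apply/measurable_EFinP; apply: measurable_funM => //; exact: measurable_height_weight.
- move=> x _ /=; rewrite lee_fin !normrM ler_wpM2r// (le_trans (hM x))// ler_norm//.
- rewrite (_ : _ \o _ = (fun x => M%:E * (EFin \o W) x)%E); last first.
    by apply/funext => x; rewrite /= EFinM.
  by apply: integrableZl => //; exact: integrable_height_weight.
Qed.

Lemma measurable_comp_height (h : R -> R) : measurable_fun setT h ->
  measurable_fun setT (h \o Y).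
Proof. by move=> mh; apply: measurableT_comp => //; exact: measurable_height. Qed.

(** This is [height_null] for [I2 * h1 - I1 * h2], whose integral against [W] is 0. *)
Lemma height_exchange (h1 h2 : R -> R) (r : R) : 0 < r -> r < rd ->
  continuous h1 -> continuous h2 ->
  (forall x, r <= `|x| -> h1 x = 0) -> (forall x, r <= `|x| -> h2 x = 0) ->
  \int[mu]_u h1 (Y u) * \int[leb]_x (h2 x * W x) =
  \int[mu]_u h2 (Y u) * \int[leb]_x (h1 x * W x).
Proof.
move=> r0 rrd c1 c2 z1 z2.
set I1 := \int[leb]_x (h1 x * W x); set I2 := \int[leb]_x (h2 x * W x).
have [M1 hM1] := compact_support_bounded r0 c1 z1.
have [M2 hM2] := compact_support_bounded r0 c2 z2.
have m1 := continuous_measurable_fun c1; have m2 := continuous_measurable_fun c2.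
have i1 := integrableM_height_weight m1 hM1.
have i2 := integrableM_height_weight m2 hM2.
have e1 := bounded_integrable mu (measurable_comp_height m1) (fun u => hM1 (Y u)).
have e2 := bounded_integrable mu (measurable_comp_height m2) (fun u => hM2 (Y u)).
have := @height_null R m mu mu_unif (fun x => I2 * h1 x - I1 * h2 x) r r0 rrd.
have h : forall f1 f2 : R, I2 * f1 - I1 * f2 = 0 -> f1 * I2 = f2 * I1.
  by move=> f1 f2 /eqP; rewrite subr_eq0 => /eqP; rewrite mulrC => ->; rewrite mulrC.
move=> H; apply: h; rewrite -RintegralZl// -RintegralZl// -RintegralB//; last first.
- exact: integrable_scale.
- exact: integrable_scale.
apply: H.
- by move=> x; apply: cvgB; apply: cvgMl_tmp; [exact: c1|exact: c2].
- by move=> x rx; rewrite z1// z2// !mulr0 subrr.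
under eq_Rintegral do rewrite mulrBl -!mulrA.
rewrite RintegralB//; [|exact: integrable_scale|exact: integrable_scale].
by rewrite RintegralZl// RintegralZl// -/I1 -/I2 mulrC subrr.
Qed.

(* The interval is first cut down to ]-sqrt d, sqrt d[, where the law of Y has
   no boundary atoms to worry about. *)
Let lo (b : R) := Num.max b (- rd).
Let hi (c : R) := Num.min c rd.
Let bp b c n := bump (lo b) (hi c) n.
Let rn (n : nat) : R := rd - n.+1%:R^-1.

Let rn_gt0 n : 0 < rn n.
Proof. by rewrite subr_gt0 (le_lt_trans _ rd_gt1)// invf_le1// ler1n. Qed.

Let rn_lt n : rn n < rd.
Proof. by rewrite gtrBl invr_gt0. Qed.

Let bp0 b c n x : rn n <= `|x| -> bp b c n x = 0.
Proof.
move=> h; apply: bump_eq0; rewrite ge_min.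
have lo1 : - rd <= lo b by rewrite le_max lexx orbT.
have hi1 : hi c <= rd by rewrite ge_min lexx orbT.
move: h lo1 hi1; rewrite /rn; move: (lo b) (hi c) n.+1%:R^-1 (Num.sqrt _) => l' h' e s.
have [x0|x0] := leP 0 x; [rewrite ger0_norm//|rewrite ltr0_norm//];
  move=> h h1 h2; apply/orP; [right|left]; lra.
Qed.

Let cvg_mu b c : \int[mu]_u bp b c n (Y u) @[n --> \oo] -->
  \int[mu]_u (\1_`]lo b, hi c[%classic (Y u) : R).
Proof.
apply: (@bounded_cvg_Rintegral _ _ _ mu (fun n u => bp b c n (Y u)) _ 1).
- move=> n; apply: measurable_comp_height; apply: continuous_measurable_fun.
  exact: continuous_bump.
- by move=> n u; exact: norm_bump.
- by move=> u; exact: bump_cvg.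
Qed.

Let cvg_leb b c : \int[leb]_x (bp b c n x * W x) @[n --> \oo] -->
  \int[leb]_x (\1_`]lo b, hi c[%classic x * W x).
Proof.
have mW := @measurable_height_weight R d.
have mb n : measurable_fun setT (bp b c n).
  by apply: continuous_measurable_fun; exact: continuous_bump.
have [] := @dominated_convergence _ _ R leb setT measurableT
  (fun n => EFin \o (fun x => bp b c n x * W x))
  (EFin \o (fun x => \1_`]lo b, hi c[%classic x * W x)) (EFin \o W).
- by move=> n; apply/measurable_EFinP; apply: measurable_funM; [exact: mb|exact: mW].
- apply/measurable_EFinP; apply: measurable_funM; last exact: mW.
  by apply: measurable_indic; exact: measurable_itv.
- apply: aeW => x _; apply: cvg_EFin; first exact: nearW.
  by apply: cvgMr_tmp; exact: bump_cvg.
- exact: integrable_height_weight.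
- apply: aeW => x n _ /=; rewrite lee_fin normrM (ger0_norm (height_weight_ge0 _ _)).
  by rewrite -[leRHS]mul1r ler_wpM2r ?height_weight_ge0// norm_bump.
move=> fi _ h; apply: fine_cvg; rewrite fineK//.
exact: integrable_fin_num.
Qed.

Lemma measurable_point_rV k (t : borel_rV R k) : measurable [set t].
Proof.
apply: measurable_closed_rV; apply: compact_closed; last exact: compact_set1.
exact: norm_hausdorff.
Qed.

(** By transitivity all points of the sphere have the same mass, and the plane of the axes 0 and 1
    supplies arbitrarily many of them. *)
Lemma height_no_atom (u0 : 'rV[R]_d) : dotp u0 u0 = 1 -> mu [set u0] = 0%E.
Proof.
move=> u1; set a := mu [set u0].
have ms (t : borel_rV R d) : measurable [set t].
  exact: measurable_point_rV.
have at_ (t : 'rV[R]_d) : dotp t t = 1 -> mu [set t] = a.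
  move=> t1; have [Q oQ tQ] := orthogonal_transitive u1 t1.
  rewrite /a -(mu_unif.2 Q oQ [set t])//; congr (mu _); apply/seteqP; split=> u /=.
    move=> ut; rewrite -[LHS]mulmx1 -oQ mulmxA ut -tQ -mulmxA oQ mulmx1//.
  by move=> ->.
pose q (k : nat) : R := k.+2%:R^-1.
pose t (k : nat) : 'rV[R]_d := q k *: delta_mx 0 0 + Num.sqrt (1 - q k ^+ 2) *: delta_mx 0 1.
have t0 k : t k 0 0 = q k by rewrite !mxE !eqxx /= mulr1 mulr0 addr0.
have t1 k : t k 0 1 = Num.sqrt (1 - q k ^+ 2) by rewrite !mxE !eqxx /= mulr1 mulr0 add0r.
have tt k : dotp (t k) (t k) = 1.
  rewrite [X in dotp _ X]/t dotpDr !dotpZr !dotp_delta t0 t1 -!expr2 sqr_sqrtr; first by ring.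
  by rewrite subr_ge0; apply: exprn_ile1; [rewrite invr_ge0|rewrite invf_le1 ?ltr0n// ler1n].
have tinj i j : t i = t j -> i = j.
  by move=> /(congr1 (fun v : 'rV[R]_d => v 0 0)); rewrite !t0 => /invr_inj /eqP; rewrite eqr_nat => /eqP[].
have sum n : (n%:R * fine a <= 1)%R.
  have tr : trivIset [set: 'I_n] (fun i => [set t i]).
    by move=> i j _ _ [v [/= -> /tinj /val_inj]].
  have af : a = (fine a)%:E by rewrite fineK// fin_num_measure.
  have h : mu (\big[setU/set0]_(i < n) [set (t i : borel_rV R d)]) = (fine a *+ n)%:E.
    rewrite (@measure_bigsetU_ord _ _ _ mu n xpredT (fun i : 'I_n => [set (t i : borel_rV R d)]))//.
    rewrite (eq_bigr (fun=> (fine a)%:E)); first by rewrite sumEFin sumr_const card_ord.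
    by move=> k _; rewrite -af; apply: at_; exact: tt.
  rewrite mulr_natl -lee_fin -h; apply: probability_le1; apply: bigsetU_measurable => k _; exact: ms.
have a0 : (0 <= fine a)%R by apply: fine_ge0; exact: measure_ge0.
rewrite -[LHS]fineK ?fin_num_measure//; congr _%:E; apply/eqP.
rewrite eq_le a0 andbT leNgt; apply/negP => ap.
have := sum (Num.bound (fine a)^-1).
rewrite -ler_pdivlMr// mul1r leNgt => /negP; apply.
by apply: archi_boundP; rewrite invr_ge0.
Qed.

Lemma measurable_boundary : measurable [set u | rd <= `|Y u|].
Proof.
rewrite [X in measurable X](_ : _ = ((fun x : R => `|x|) \o Y) @^-1` `[rd, +oo[); last first.
  by apply/seteqP; split=> u /=; rewrite in_itv/= andbT.
rewrite -[X in measurable X]setTI.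
by apply: (@measurable_comp_height (fun x : R => `|x|)).
Qed.

Lemma height_boundary : mu [set u | rd <= `|Y u|] = 0%E.
Proof.
pose e : 'rV[R]_d := delta_mx 0 0.
have e1 : dotp e e = 1 by rewrite dotp_delta mxE !eqxx.
have ms (t : borel_rV R d) : measurable [set t].
  exact: measurable_point_rV.
have mS : measurable (~` S) by apply: measurableC; exact: measurable_sphere.
apply: (@subset_measure0 _ _ _ mu _ (~` S `|` ([set e] `|` [set - e]))).
- exact: measurable_boundary.
- by apply: measurableU => //; apply: measurableU.
- move=> u /= hu; have [Su|] := pselect (S u); [right|by left].
  have u2 : 1 <= axis 0 u ^+ 2.
    move: hu; rewrite normrM gtr0_norm ?rd_gt0// ler_pMr ?rd_gt0// => hu.
    by rewrite -[_ ^+ 2]real_normK ?num_real// exprn_ege1.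
  have split0 : dotp u u = axis 0 u ^+ 2 + \sum_(i < d | i != 0) axis i u ^+ 2.
    by rewrite /dotp (bigD1 0)//= -expr2; congr (_ + _); apply: eq_bigr => i _; rewrite -expr2.
  have s0 : 0 <= \sum_(i < d | i != 0) axis i u ^+ 2 by apply: sumr_ge0 => i _; exact: sqr_ge0.
  have su : dotp u u = 1 := Su.
  have /eqP : \sum_(i < d | i != 0) axis i u ^+ 2 = 0 by lra.
  rewrite psumr_eq0 => [/allP z|i _]; last exact: sqr_ge0.
  have zi i : i != 0 -> axis i u = 0.
    by move=> i0; have /implyP/(_ i0)/eqP/eqP := z i (mem_index_enum i); rewrite sqrf_eq0 => /eqP.
  have /eqP : axis 0 u ^+ 2 = 1 ^+ 2 by rewrite expr1n; lra.
  rewrite eqf_sqr => /orP[] /eqP u0; [left|right]; apply/rowP => i; rewrite !mxE ?eqxx /=.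
    by have [->|i0] := eqVneq i 0; [exact: u0|exact: zi].
  by have [->|i0] := eqVneq i 0; [exact: u0|rewrite oppr0; exact: zi].
- have n1 := @height_no_atom e e1.
  have n2 : mu [set - e] = 0%E by apply: height_no_atom; rewrite dotpNl dotpNr opprK.
  have n3 := (uniform_invariant mu_unif).1.
  apply/eqP; rewrite eq_le measure_ge0 andbT.
  apply: (@le_trans _ _ (0 + (0 + 0))%E); last by rewrite !adde0.
  apply: le_trans (measureU2 _ _ _) _ => //; first by apply: measurableU.
  apply: leeD; first by apply: eq_lee; exact: n3.
  apply: le_trans (measureU2 _ _ _) _ => //.
  by apply: leeD; apply: eq_lee; [exact: n1|exact: n2].
Qed.

Lemma height_weight_int_gt0 : 0 < \int[leb]_x W x.
Proof.
have rd1 := rd_gt1.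
have w1 : 0 < W 1 by apply: height_weight_gt0 => //; rewrite normr1.
apply: (@lt_le_trans _ _ (\int[leb]_x (W 1 * \1_`[-1, 1]%classic x))).
  rewrite RintegralZl//; last exact: integrable_indic_itv.
  have -> : \int[leb]_x \1_`[-1, 1]%classic x = 2 :> R.
    rewrite /Rintegral integral_indic//= setIT.
    by rewrite (lebesgue_measure_itv `[-1, 1]) /= lte_fin; case: ifPn => h /=; lra.
  by rewrite mulr_gt0.
apply: le_Rintegral => //.
- by apply: integrable_scale; exact: integrable_indic_itv.
- exact: integrable_height_weight.
- move=> x _; rewrite indicE; case: (boolP (x \in _)) => [/set_mem|_]; last first.
    by rewrite mulr0 height_weight_ge0.
  rewrite /= in_itv/= mulr1 -ler_norml => x1.
  rewrite /height_weight; apply: lerXn2r; rewrite ?nnegrE ?sqrtr_ge0//.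
  rewrite ler_wsqrtr// lerD2l lerN2 ler_pM2r ?invr_gt0//.
  by rewrite -(real_normK (num_real x)) ler_sqr ?nnegrE// expr1n.
Qed.

(** [height_exchange] is applied to bumps of []b, c[] and of the full interval []-rd, rd[]; in the
    limit the latter has probability 1 and carries the whole integral of [W]. *)
Lemma height_itv b c : fine (mu (Y @^-1` `]b, c[)) * \int[leb]_x W x =
  \int[leb]_x (\1_`]b, c[%classic x * W x).
Proof.
have ex b1 c1 b2 c2 n : \int[mu]_u bp b1 c1 n (Y u) * \int[leb]_x (bp b2 c2 n x * W x) =
    \int[mu]_u bp b2 c2 n (Y u) * \int[leb]_x (bp b1 c1 n x * W x).
  apply: (height_exchange (rn_gt0 n) (rn_lt n)); try exact: continuous_bump; exact: bp0.
have lim b1 c1 b2 c2 :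
    \int[mu]_u (\1_`]lo b1, hi c1[%classic (Y u) : R) * \int[leb]_x (\1_`]lo b2, hi c2[%classic x * W x)
    = \int[mu]_u (\1_`]lo b2, hi c2[%classic (Y u) : R) * \int[leb]_x (\1_`]lo b1, hi c1[%classic x * W x).
  have h1 : \int[mu]_u bp b1 c1 n (Y u) * \int[leb]_x (bp b2 c2 n x * W x) @[n --> \oo] -->
      \int[mu]_u (\1_`]lo b1, hi c1[%classic (Y u) : R) * \int[leb]_x (\1_`]lo b2, hi c2[%classic x * W x).
    by apply: cvgM; [exact: cvg_mu|exact: cvg_leb].
  have h2 : \int[mu]_u bp b2 c2 n (Y u) * \int[leb]_x (bp b1 c1 n x * W x) @[n --> \oo] -->
      \int[mu]_u (\1_`]lo b2, hi c2[%classic (Y u) : R) * \int[leb]_x (\1_`]lo b1, hi c1[%classic x * W x).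
    by apply: cvgM; [exact: cvg_mu|exact: cvg_leb].
  rewrite -(cvg_lim (@Rhausdorff R) h1) -(cvg_lim (@Rhausdorff R) h2).
  by under eq_fun do rewrite ex.
have fw b1 c1 x : \1_`]lo b1, hi c1[%classic x * W x = \1_`]b1, c1[%classic x * W x.
  have [xr|xr] := ltP `|x| rd; last by rewrite height_weight_eq0// !mulr0.
  congr (_ * _); rewrite !indicE; congr (_%:R); congr nat_of_bool.
  move: xr; rewrite ltr_norml => /andP[x1 x2].
  apply/idP/idP => /set_mem/=; rewrite in_itv/= /lo /hi ?gt_max ?lt_min => h;
    apply/mem_set; rewrite /= in_itv/= ?gt_max ?lt_min.
    by move: h => /andP[/andP[-> _] /andP[-> _]].
  by rewrite x1 x2 !andbT.
have fwI b1 c1 : \int[leb]_x (\1_`]lo b1, hi c1[%classic x * W x) =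
    \int[leb]_x (\1_`]b1, c1[%classic x * W x) by apply: eq_Rintegral => x _; exact: fw.
have full : \int[mu]_u (\1_`]lo (- rd), hi rd[%classic (Y u) : R) = 1.
  pose A : set (borel_rV R d) := [set u | rd <= `|Y u|].
  have mA : measurable A by exact: measurable_boundary.
  have -> : (fun u => \1_`]lo (- rd), hi rd[%classic (Y u) : R) = \1_(~` A).
    apply/funext => u; rewrite !indicE /lo /hi maxxx minxx; congr (_%:R); congr nat_of_bool.
    apply/idP/idP => /set_mem h; apply/mem_set; move: h; rewrite /= in_itv/= -ltr_norml /A/=.
      by rewrite leNgt => -> .
    by move=> /negP; rewrite -ltNge.
  rewrite /Rintegral integral_indic// ?setIT; last exact: measurableC.
  have E : mu (~` A) = 1%E by rewrite probability_setC// height_boundary sube0.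
  by rewrite -[RHS]/(fine 1%E); congr fine; exact: E.
have := lim b c (- rd) rd; rewrite full mul1r !fwI => <-.
have mB : measurable [set u | rd <= `|Y u|] by exact: measurable_boundary.
have mY (b1 c1 : R) : measurable (Y @^-1` `]b1, c1[).
  by rewrite -[X in measurable X]setTI; apply: measurable_height.
congr (_ * _).
  rewrite /Rintegral (_ : (fun u => _) = (fun u => (\1_(Y @^-1` `]lo b, hi c[) u)%:E)) //.
  rewrite integral_indic// setIT; congr fine; apply/eqP; rewrite eq_le; apply/andP; split; last first.
    apply: le_measure; [by apply/mem_set; exact: mY|by apply/mem_set; exact: mY|].
    by move=> u /=; rewrite !in_itv/= /lo /hi gt_max lt_min => /andP[/andP[-> _] /andP[-> _]].
  apply: (@le_trans _ _ (mu (Y @^-1` `]lo b, hi c[ `|` [set u | rd <= `|Y u|]))).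
    apply: le_measure; [by apply/mem_set; exact: mY|by apply/mem_set; apply: measurableU; [exact: mY|exact: mB]|].
    move=> u /=; rewrite !in_itv/= /lo /hi gt_max lt_min => /andP[-> ->].
    have [|] := leP rd `|Y u|; first by right.
    by rewrite ltr_norml => /andP[-> ->]; left.
  apply: le_trans (measureU2 _ _ _) _; [exact: mY|exact: mB|].
  rewrite -[leRHS]adde0; apply: leeD => //; apply: eq_lee; exact: height_boundary.
apply: eq_Rintegral => x _; have [xr|xr] := ltP `|x| rd; last by rewrite height_weight_eq0// mulr0.
by rewrite indicE mem_set ?mul1r//= in_itv/= -ltr_norml.
Qed.

End HeightDensity.

Definition height_density {R : realType} (d : nat) (y : R) : R :=
  (\int[lebesgue_measure]_x height_weight d x)^-1 * height_weight d y.

Lemma measurable_height_density {R : realType} d : measurable_fun setT (@height_density R d).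
Proof. by apply: measurable_funM => //; exact: measurable_height_weight. Qed.

Lemma height_density_ge0 {R : realType} d (y : R) : 0 <= height_density d y.
Proof.
rewrite mulr_ge0 ?height_weight_ge0// invr_ge0.
by apply: Rintegral_ge0 => x _; exact: height_weight_ge0.
Qed.

Definition height_measure {R : realType} (d : nat) :=
  density_measure (@lebesgue_measure R) (height_density_ge0 d) (@measurable_height_density R d).

HB.instance Definition _ {R : realType} d := Measure.on (@height_measure R d).

Definition mfun_of d1 d2 (T1 : measurableType d1) (T2 : measurableType d2) (f : T1 -> T2)
    (mf : measurable_fun setT f) : {mfun T1 >-> T2} :=
  HB.pack f (isMeasurableFun.Build _ _ T1 T2 f mf).

Section HeightMeasure.
Context {R : realType} {m : nat}.
Local Notation d := m.+4.
Local Notation leb := (@lebesgue_measure R).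

Lemma height_measure_setT : @height_measure R d setT = 1%E.
Proof.
have i := @integrable_height_weight R m.
have I0 := @height_weight_int_gt0 R m.
rewrite /height_measure /density_measure -[LHS]fineK; last first.
  apply: integrable_fin_num => //; exact: integrable_scale.
congr _%:E; rewrite -/(Rintegral leb setT (@height_density R d)).
rewrite /height_density RintegralZl// mulVf// gt_eqF//.
Qed.

HB.instance Definition _ := @Measure_isProbability.Build _ _ R
  (@height_measure R d) height_measure_setT.

Variable mu : probability (borel_rV R d) R.
Hypothesis mu_unif : uniform_on_sphere mu.

Lemma height_measure_itv b c : @height_measure R d `]b, c[%classic = mu (@height R m @^-1` `]b, c[).
Proof.
have i := @integrable_height_weight R m.
have I0 := @height_weight_int_gt0 R m.
have mY : measurable (@height R m @^-1` `]b, c[).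
  by rewrite -[X in measurable X]setTI; apply: measurable_height.
rewrite -[LHS]fineK ?fin_num_measure// -[RHS]fineK ?fin_num_measure//; congr _%:E.
have := height_itv mu_unif b c.
move=> /(canRL (mulfK (lt0r_neq0 I0))) ->.
rewrite /height_measure /density_measure -/(Rintegral leb _ (@height_density R d)).
rewrite Rintegral_mkcond mulrC -RintegralZl//; last first.
  apply: (integrableM_height_weight (M := 1)).
    by apply: measurable_indic; exact: measurable_itv.
  by move=> x; rewrite ger0_norm// indic_le1.
apply: eq_Rintegral => x _; rewrite patchE /height_density indicE.
by case: ifPn => _; rewrite ?mul1r// mul0r mulr0.
Qed.

Lemma height_law (B : set R) : measurable B -> mu (@height R m @^-1` B) = height_measure d B.
Proof.
move=> mB.
have mh : measurable_fun setT (@height R m : borel_rV R d -> measurableTypeR R).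
  exact: measurable_height.
pose X := mfun_of mh.
pose nu1 := distribution mu X.
apply/esym.
have H := @measure_unique _ R (measurableTypeR R) (@RGenOpens.G R)
  (fun k : nat => `](- k%:R), k%:R[%classic) (RGenOpens.measurableE R).
have h1 : setI_closed (@RGenOpens.G R).
  move=> _ _ [a [b ->]] [a' [b' ->]]; exists (Num.max a a'), (Num.min b b').
  apply/seteqP; split=> x /=; rewrite !in_itv/= gt_max lt_min.
    by move=> [/andP[-> ->] /andP[-> ->]].
  by move=> /andP[/andP[-> ->] /andP[-> ->]].
have h2 (k : nat) : RGenOpens.G `](- k%:R : R), k%:R[%classic by exists (- k%:R), k%:R.
have h3 : \bigcup_k `](- k%:R : R), k%:R[%classic = setT.
  apply/seteqP; split=> // x _; exists (Num.bound `|x|) => //=.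
  by rewrite in_itv/= -ltr_norml archi_boundP.
have H1 := H h1 h2 h3 (@height_measure R d) nu1.
apply: H1 mB => [_ [b [c ->]]|k]; first exact: height_measure_itv.
by rewrite ltey_eq fin_num_measure.
Qed.

End HeightMeasure.

(** * Disintegration along a coordinate *)

Section Frame.
Context {R : realType} {m : nat}.
Implicit Types (t u : 'rV[R]_m.+1) (P : 'M[R]_(m, m.+1)).

(** The rows of [P] form an orthonormal basis of the orthogonal complement of the unit vector [t],
    and [u *m P^T] lists the coordinates of the projection of [u] in it. *)
Definition frame t P :=
  [/\ t *m t^T = 1%:M, P *m P^T = 1%:M, t *m P^T = 0 & t^T *m t + P^T *m P = 1%:M].

Lemma exists_frame t : dotp t t = 1 -> exists2 P, frame t P &
  exists2 Q : 'M[R]_m.+1, orthogonal_mx Q & forall u, dotp u t = (u *m Q) 0 0.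
Proof.
move=> t1; pose e : 'rV[R]_m.+1 := delta_mx 0 0.
have e1 : dotp e e = 1.
  by rewrite /dotp (bigD1 0)//= big1 ?mxE ?eqxx ?mulr1 ?addr0// => i i0; rewrite !mxE (negbTE i0) andbF mulr0.
have [Q oQ eQ] := orthogonal_transitive e1 t1.
pose M : 'M[R]_(1 + m, m.+1) := Q.
have uM : usubmx M = t.
  rewrite -eQ -rowE; apply/rowP => j; rewrite !mxE /M; congr (Q _ _); exact/val_inj.
have ME : M = col_mx t (dsubmx M) by rewrite -uM vsubmxK.
exists (dsubmx M).
  have h1 : col_mx t (dsubmx M) *m (col_mx t (dsubmx M))^T = 1%:M by rewrite -ME.
  have h2 : (col_mx t (dsubmx M))^T *m col_mx t (dsubmx M) = 1%:M.
    by rewrite -ME; exact: mulmx1C.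
  move: h2; rewrite tr_col_mx mul_row_col => h2.
  move: h1; rewrite tr_col_mx mul_col_row (@scalar_mx_block _ 1 m) => /eq_block_mx[h1 h3 h4 h5].
  by split.
exists Q^T; first exact: orthogonal_mxT.
move=> u; rewrite -eQ -[u in LHS]mulmx1 -(mulmx1C oQ) mulmxA dotp_orthogonal//.
rewrite /dotp (bigD1 0)//= big1 ?mxE ?eqxx ?mulr1 ?addr0// => i i0.
by rewrite [e _ _]mxE (negbTE i0) andbF mulr0.
Qed.

Variables (t : 'rV[R]_m.+1) (P : 'M[R]_(m, m.+1)).
Hypothesis fr : frame t P.

Lemma frame_split u : u = dotp u t *: t + (u *m P^T) *m P.
Proof.
have [_ _ _ h] := fr; rewrite -[LHS]mulmx1 -h mulmxDr !mulmxA; congr (_ + _).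
by rewrite [u *m t^T]mx11_scalar mul_scalar_mx -dotp_mulmx.
Qed.

Lemma frame_dotp u v : dotp u v = dotp u t * dotp v t + dotp (u *m P^T) (v *m P^T).
Proof.
have [_ _ _ h] := fr; rewrite dotp_mulmx -{1}[u]mulmx1 -h mulmxDr mulmxDl mxE; congr (_ + _).
  rewrite !mulmxA [u *m t^T]mx11_scalar mul_scalar_mx -scalemxAl mxE -!dotp_mulmx.
  by rewrite (dotpC t).
by rewrite dotp_mulmx trmx_mul trmxK !mulmxA.
Qed.

Definition frame_point (r s : R) (v : 'rV[R]_m) : 'rV[R]_m.+1 := r *: t + s *: (v *m P).

Lemma dotp_frame_point u r s v :
  dotp u (frame_point r s v) = r * dotp u t + s * dotp (u *m P^T) v.
Proof.
rewrite dotpDr !dotpZr; congr (_ + _ * _).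
by rewrite !dotp_mulmx trmx_mul mulmxA.
Qed.

(** The lift acts as [Q] on the complement of [t] and as the identity along [t]. *)
Lemma frame_lift (Q : 'M[R]_m) : orthogonal_mx Q -> exists2 Q' : 'M[R]_m.+1,
  orthogonal_mx Q' & forall u, (u *m Q') *m P^T = (u *m P^T) *m Q /\ dotp (u *m Q') t = dotp u t.
Proof.
move=> oQ; have [tt PP tP h] := fr.
have Pt : P *m t^T = 0 by rewrite -[LHS]trmxK trmx_mul trmxK tP trmx0.
exists (t^T *m t + P^T *m Q *m P).
  rewrite /orthogonal_mx linearD/= !trmx_mul !trmxK -h mulmxDl !mulmxDr !mulmxA.
  rewrite -(mulmxA _ t t^T) tt mulmx1 -(mulmxA _ t P^T) tP mulmx0 !mul0mx addr0.
  rewrite -(mulmxA _ P t^T) Pt mulmx0 mul0mx add0r; congr (_ + _).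
  by rewrite -(mulmxA _ P P^T) PP mulmx1 -(mulmxA _ Q Q^T) oQ mulmx1.
move=> u; split.
  rewrite mulmxDr !mulmxDl !mulmxA -(mulmxA _ t P^T) tP mulmx0 add0r.
  by rewrite -(mulmxA _ P P^T) PP mulmx1.
rewrite !dotp_mulmx mulmxDr !mulmxDl !mulmxA -(mulmxA _ t t^T) tt mulmx1.
by rewrite -(mulmxA _ P t^T) Pt mulmx0 addr0.
Qed.

End Frame.

Section Normalize.
Context {R : realType} {k : nat}.

Definition normalize (w : 'rV[R]_k) : 'rV[R]_k := (Num.sqrt (dotp w w))^-1 *: w.

Lemma normalize_unit w : w != 0 -> dotp (normalize w) (normalize w) = 1.
Proof.
move=> w0; have p : 0 < dotp w w.
  by rewrite lt_def dotp_ge0 andbT; apply: contra_neq w0 => /dotp_eq0.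
rewrite dotpZl dotpZr mulrA -invfM -expr2 sqr_sqrtr ?ltW// mulVf// gt_eqF//.
Qed.

Lemma normalizeK w : Num.sqrt (dotp w w) *: normalize w = w.
Proof.
have [->|w0] := eqVneq w 0; first by rewrite /normalize !scaler0.
rewrite scalerA divff ?scale1r// gt_eqF// sqrtr_gt0 lt_def dotp_ge0 andbT.
by apply: contra_neq w0 => /dotp_eq0.
Qed.

Lemma normalize_orthogonal (Q : 'M[R]_k) w : orthogonal_mx Q -> normalize (w *m Q) = normalize w *m Q.
Proof. by move=> oQ; rewrite /normalize dotp_orthogonal// scalemxAl. Qed.

Lemma measurable_normalize : measurable_fun setT (normalize : borel_rV R k -> borel_rV R k).
Proof.
apply: measurable_into_rV => V oV.
pose Z : set (borel_rV R k) := [set 0].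
have cn (w : 'rV[R]_k) : w != 0 -> {for w, continuous normalize}.
  move=> w0; have p : 0 < dotp w w.
    by rewrite lt_def dotp_ge0 andbT; apply: contra_neq w0 => /dotp_eq0.
  have c1 : {for w, continuous (fun w : 'rV[R]_k => (Num.sqrt (dotp w w))^-1)}.
    apply: continuousV; first by rewrite gt_eqF// sqrtr_gt0.
    apply: (@continuous_comp _ _ _ (fun w : 'rV[R]_k => dotp w w) Num.sqrt).
      exact: continuous_dotp_self.
    exact: sqrt_continuous.
  have c2 : (fun w : 'rV[R]_k => w) v @[v --> w] --> w by exact: cvg_id.
  exact: (cvgZ c1 c2).
have mZ : measurable Z by exact: measurable_point_rV.
rewrite (_ : _ @^-1` V = ((normalize @^-1` V) `&` ~` Z) `|` (Z `&` [set _ | V 0])); last first.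
  apply/seteqP; split=> w /=.
    have [->|w0 Vw] := eqVneq w 0; last by left; split=> //; exact/eqP.
    by rewrite /normalize scaler0; right.
  by move=> [[]//|[-> V0]]; rewrite /normalize scaler0.
apply: measurableU; last first.
  have [V0|V0] := pselect (V 0).
    by rewrite (_ : [set _ | _] = setT) ?setIT//; apply/seteqP; split.
  by rewrite (_ : [set _ | _] = set0) ?setI0//; apply/seteqP; split.
apply: measurable_open_rV; rewrite openE => w [/= Vw Zw].
have w0 : w != 0 by apply/eqP.
have n1 : nbhs w (normalize @^-1` V) by apply: cn => //; exact: open_nbhs_nbhs.
have n2 : nbhs w (~` Z).
  apply: open_nbhs_nbhs; split=> //; apply: closed_openC.
  by apply: compact_closed; [exact: norm_hausdorff|exact: compact_set1].
exact: filterI.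
Qed.

End Normalize.

Section SliceLaw.
Context d1 d2 (T1 : measurableType d1) (T2 : measurableType d2) {R : realType}.
Variables (mu : probability T1 R) (f : T1 -> T2).
Variables (D : set T1).
Hypotheses (mf : measurable_fun setT f) (mD : measurable D).

(** The law of [f] restricted to the event [D], without normalization. *)
Definition slice_law of measurable_fun setT f & measurable D :=
  fun A : set T2 => mu (D `&` f @^-1` A).
Local Notation nu := (slice_law mf mD).

Let mfD A : measurable A -> measurable (D `&` f @^-1` A).
Proof. by move=> mA; apply: measurableI => //; rewrite -[X in measurable X]setTI; exact: mf. Qed.

Let nu0 : nu set0 = 0%E.
Proof. by rewrite /slice_law preimage_set0 setI0 measure0. Qed.

Let nu_ge0 A : (0 <= nu A)%E.
Proof. by rewrite measure_ge0. Qed.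

Let nu_sigma : semi_sigma_additive nu.
Proof.
move=> F mF tF mUF; rewrite /slice_law preimage_bigcup setI_bigcupr.
apply: measure_semi_sigma_additive.
- by move=> k; exact: mfD.
- apply/trivIsetP => i j _ _ ij; move/trivIsetP : tF => /(_ i j Logic.I Logic.I ij) Fij.
  by rewrite setIACA setIid -preimage_setI Fij preimage_set0 setI0.
- rewrite -setI_bigcupr -preimage_bigcup; exact: mfD.
Qed.

HB.instance Definition _ := isMeasure.Build _ _ _ nu nu0 nu_ge0 nu_sigma.

Let nu_fin : fin_num_fun nu.
Proof. by move=> A mA; rewrite fin_num_measure//; exact: mfD. Qed.

HB.instance Definition _ := @Measure_isFinite.Build _ _ _ nu nu_fin.

End SliceLaw.

Section Disintegration.
Context {R : realType} {m : nat}.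
Local Notation d := m.+4.
Variable mu : probability (borel_rV R d) R.
Hypothesis mu_unif : uniform_on_sphere mu.
Variables (t : 'rV[R]_d) (P : 'M[R]_(m.+3, d)).
Hypothesis fr : frame t P.
Hypothesis frQ : exists2 Q : 'M[R]_d, orthogonal_mx Q & forall u, dotp u t = (u *m Q) 0 0.
Local Notation S := (@unit_sphere R d : set (borel_rV R d)).
Local Notation S' := (@unit_sphere R m.+3 : set (borel_rV R m.+3)).
Local Notation rd := (Num.sqrt d%:R : R).

Let X (u : borel_rV R d) : R := rd * dotp u t.
Let V (u : borel_rV R d) : borel_rV R m.+3 := normalize ((u : 'rV[R]_d) *m P^T).

Let mX : measurable_fun setT X.
Proof. apply: measurable_funM => //; exact: measurable_dotp. Qed.

Let mV : measurable_fun setT V.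
Proof.
have mp : measurable_fun setT (fun u : borel_rV R d => (u : 'rV[R]_d) *m P^T : borel_rV R m.+3).
  apply: measurable_into_rV => W oW; apply: measurable_open_rV.
  by move: oW; apply: open_comp => u _; exact: continuous_mulmx.
exact: (measurableT_comp (@measurable_normalize R m.+3) mp).
Qed.

Let X_law B : measurable B -> mu (X @^-1` B) = height_measure d B.
Proof.
move=> mB; have [Q oQ tQ] := frQ.
rewrite -(height_law mu_unif mB) -[RHS](mu_unif.2 Q oQ); last first.
  by rewrite -[X in measurable X]setTI; apply: measurable_height.
by congr (mu _); apply/seteqP; split=> u /=; rewrite /X /height /axis tQ.
Qed.

Let X_boundary : mu [set u | rd <= `|X u|] = 0%E.
Proof.
rewrite (_ : [set _ | _] = X @^-1` [set y | rd <= `|y|])//.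
have mB : measurable [set y : R | rd <= `|y|].
  rewrite [X in measurable X](_ : _ = (fun x : R => `|x|) @^-1` `[rd, +oo[); last first.
    by apply/seteqP; split=> y /=; rewrite in_itv/= andbT.
  by rewrite -[X in measurable X]setTI; apply: (continuous_measurable_fun (@norm_continuous _ _)).
rewrite X_law// -(height_law mu_unif mB); exact: height_boundary.
Qed.

Let perp_eq0 u : S u -> u *m P^T = 0 :> 'rV[R]__ -> rd <= `|X u|.
Proof.
move=> Su uP; have := frame_dotp fr u u; rewrite uP (Su : dotp u u = 1).
rewrite [dotp 0 0](_ : _ = 0) ?addr0; last by rewrite /dotp big1// => i _; rewrite mxE mul0r.
move=> h; rewrite normrM ger0_norm ?sqrtr_ge0// ler_peMr ?sqrtr_ge0//.
by rewrite -(@ler_pXn2r _ 2%N) ?nnegrE// real_normK ?num_real// expr1n expr2 -h.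
Qed.

Let V_sphere u : S u -> `|X u| < rd -> S' (V u).
Proof.
move=> Su Xu; apply: normalize_unit; apply/eqP => uP.
by have := perp_eq0 Su uP; rewrite leNgt Xu.
Qed.

Let mB0 : measurable [set u | rd <= `|X u|].
Proof.
rewrite [Y in measurable Y](_ : _ = (fun u => `|X u|) @^-1` `[rd, +oo[); last first.
  by apply/seteqP; split=> y /=; rewrite in_itv/= andbT.
by rewrite -[Y in measurable Y]setTI; apply: (measurableT_comp (continuous_measurable_fun (@norm_continuous _ _)) mX).
Qed.

Definition perp_law : probability (borel_rV R m.+3) R := distribution mu (mfun_of mV).

Let slice B (mB : measurable B) := slice_law mu mV mB.

Let mXB B : measurable B -> measurable (X @^-1` B).
Proof. by move=> mB; rewrite -[Y in measurable Y]setTI; exact: mX. Qed.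

Let mS' : measurable S'. Proof. exact: measurable_sphere. Qed.

(** A rotation of the complement of [t] lifts to one of the whole space that fixes [t], hence
    preserves the event on [X] and rotates [V]. The points where [V] leaves the sphere have
    [rd <= |X|] and are negligible. *)
Let slice_invariant B (mB : measurable B) : invariant_on_sphere (slice (mXB mB)).
Proof.
split.
  apply/eqP; rewrite eq_le measure_ge0 andbT.
  apply: (@le_trans _ _ (mu (~` S `|` [set u | rd <= `|X u|]))).
    apply: le_measure.
    - apply/mem_set; apply: measurableI; first exact: mXB.
      by rewrite -[Y in measurable Y]setTI; apply: mV => //; exact: measurableC.
    - by apply/mem_set; apply: measurableU => //; apply: measurableC; exact: measurable_sphere.
    - move=> u [_ /= nV]; have [Su|] := pselect (S u); last by left.
      right; rewrite leNgt; apply/negP => Xu; apply: nV; exact: V_sphere.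
  apply: le_trans (measureU2 _ _ _) _ => //.
    by apply: measurableC; exact: measurable_sphere.
  rewrite -[leRHS]adde0; apply: leeD; apply: eq_lee.
    exact: (uniform_invariant mu_unif).1.
  exact: X_boundary.
move=> Q oQ A mA; have [Q' oQ' hQ'] := frame_lift fr oQ.
have mA' : measurable (X @^-1` B `&` V @^-1` A).
  by apply: measurableI; [exact: mXB|rewrite -[Y in measurable Y]setTI; exact: mV].
transitivity (mu [set u | (X @^-1` B `&` V @^-1` A) ((u : 'rV[R]_d) *m Q')]).
  congr (mu _); apply/seteqP; split=> u /=; have [h1 h2] := hQ' u;
    by rewrite /X /V h2 h1 normalize_orthogonal.
exact: mu_unif.2.
Qed.

Lemma perp_law_unif : uniform_on_sphere perp_law.
Proof.
have [h0 hQ] := slice_invariant (@measurableT _ R).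
have E A : perp_law A = slice (mXB (@measurableT _ R)) A.
  by rewrite /perp_law /distribution /pushforward /slice /slice_law preimage_setT setTI.
split; last by move=> Q oQ A mA; rewrite !E; exact: hQ.
have : perp_law (~` S') = 0%E by rewrite E.
rewrite probability_setC// => /eqP; rewrite sube_eq ?fin_num_measure//.
by rewrite add0e => /eqP <-.
Qed.

(** Independence comes from uniqueness: restricted to [X] in [B], the law of [V] is invariant, hence
    a multiple of [perp_law], the factor being the probability of the event. *)
Lemma perp_law_indep A B : measurable A -> measurable B ->
  mu (X @^-1` B `&` V @^-1` A) = (height_measure d B * perp_law A)%E.
Proof.
move=> mA mB; rewrite -X_law//.
have invp := uniform_invariant perp_law_unif.
have invs := slice_invariant mB.
have E : (slice (mXB mB) A * perp_law S' = slice (mXB mB) S' * perp_law A)%E.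
  exact: (@invariant_unique _ _ (slice (mXB mB)) perp_law A invs invp mA).
rewrite perp_law_unif.1 mule1 in E.
transitivity (slice (mXB mB) A) => //; rewrite E; congr (_ * _)%E.
have <- : slice (mXB mB) setT = slice (mXB mB) S'.
  exact: (@sphere_setT _ _ (slice_law mu mV (mXB mB)) invs).
by rewrite /slice /slice_law preimage_setT setIT.
Qed.

Definition sphere_point (y : R) (v : 'rV[R]_m.+3) : 'rV[R]_d :=
  frame_point t P (y / rd) (Num.sqrt (1 - y ^+ 2 / d%:R)) v.

Let sphere_pointK u : S u -> sphere_point (X u) (V u) = u.
Proof.
move=> Su; rewrite [RHS](frame_split fr) /sphere_point /frame_point; congr (_ *: _ + _).
  by rewrite /X mulrAC divff ?mul1r// gt_eqF// sqrtr_gt0.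
rewrite scalemxAl; congr (_ *m _); rewrite -[RHS]normalizeK; congr (Num.sqrt _ *: _).
have := frame_dotp fr u u; rewrite (Su : dotp u u = 1) => h.
rewrite /X exprMn sqr_sqrtr// mulrAC divff ?pnatr_eq0// mul1r h expr2; ring.
Qed.

Theorem sphere_disintegration (F : borel_rV R d -> \bar R) : (forall u, (0 <= F u)%E) ->
  measurable_fun setT F ->
  measurable_fun setT (fun z : measurableTypeR R * borel_rV R m.+3 => F (sphere_point z.1 z.2)) ->
  (\int[mu]_u F u = \int[lebesgue_measure]_y
     ((\int[perp_law]_v F (sphere_point y v)) * (height_density d y)%:E))%E.
Proof.
move=> F0 mF mFs.
pose Z u : measurableTypeR R * borel_rV R m.+3 := (X u, V u).
have mZ : measurable_fun setT Z.
  by apply: (@measurable_fun_pair _ _ _ (borel_rV R d) (measurableTypeR R) (borel_rV R m.+3) X V).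
have mFZ : measurable_fun setT (fun u => F (sphere_point (X u) (V u))).
  exact: (measurableT_comp mFs mZ).
transitivity (\int[mu]_u F (sphere_point (X u) (V u)))%E.
  apply: ae_eq_integral => //; exists (~` S); split.
  - by apply: measurableC; exact: measurable_sphere.
  - exact: (uniform_invariant mu_unif).1.
  - by move=> u /= h Su; apply: h => _; rewrite sphere_pointK.
have -> : (\int[mu]_u F (sphere_point (X u) (V u)) =
    \int[distribution mu (mfun_of mZ)]_z F (sphere_point z.1 z.2))%E.
  by rewrite /distribution ge0_integral_pushforward.
transitivity (\int[height_measure d \x perp_law]_z F (sphere_point z.1 z.2))%E.
  apply: eq_measure_integral => A mA _.
  apply/esym; apply: product_measure_unique => // B C mB mC.
  by rewrite /distribution /pushforward -perp_law_indep.
rewrite fubini_tonelli1//= -/(fubini_F _ _).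
rewrite integral_density//.
- by move=> y; apply: integral_ge0 => v _.
exact: (@measurable_fun_fubini_tonelli_F _ _ (measurableTypeR R) (borel_rV R m.+3) R perp_law (fun z => F (sphere_point z.1 z.2)) mFs (fun z => F0 _)).
Qed.

End Disintegration.

(** * Gaussian limit of the coordinate density *)

Section GaussianLimit.
Context {R : realType}.
Local Notation leb := (@lebesgue_measure R).
Implicit Types (a y x : R) (d : nat).

Lemma sqrt_1m_le_expR x : Num.sqrt (1 - x) <= expR (- x / 2).
Proof.
rewrite -[leRHS](@ger0_norm _ (expR _)) ?expR_ge0// -sqrtr_sqr ler_wsqrtr//.
rewrite -expRM_natl mulrC mulfVK//; apply: le_trans (expR_ge1Dx _); by [].
Qed.

(** This is [1 + z <= exp z] at [z = x / (1 - x)], where the left side equals [1 / (1 - x)]. *)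
Lemma expR_le_sqrt_1m x : x < 1 -> expR (- (x / (1 - x)) / 2) <= Num.sqrt (1 - x).
Proof.
move=> x1; rewrite -[leLHS](@ger0_norm _ (expR _)) ?expR_ge0// -sqrtr_sqr ler_wsqrtr//.
rewrite -expRM_natl mulrC mulfVK// expRN invf_ple ?posrE ?expR_gt0 ?subr_gt0//.
apply: le_trans (expR_ge1Dx _); rewrite le_eqVlt; apply/orP; left; apply/eqP.
by field; rewrite subr_eq0 eq_sym lt_eqF.
Qed.

Lemma height_weight_ub d y : height_weight d y <= expR (- ((d - 3)%:R * (y ^+ 2 / d%:R) / 2)).
Proof.
rewrite (_ : - _ = (d - 3)%:R * (- (y ^+ 2 / d%:R) / 2)) ?expRM_natl; last by ring.
by apply: lerXn2r; rewrite ?nnegrE ?sqrtr_ge0 ?expR_ge0// sqrt_1m_le_expR.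
Qed.

Lemma height_weight_lb d y : y ^+ 2 / d%:R < 1 ->
  expR (- ((d - 3)%:R * (y ^+ 2 / d%:R / (1 - y ^+ 2 / d%:R)) / 2)) <= height_weight d y.
Proof.
move=> yd; set x := _ / _ in yd *.
rewrite (_ : - _ = (d - 3)%:R * (- (x / (1 - x)) / 2)) ?expRM_natl; last by ring.
by apply: lerXn2r; rewrite ?nnegrE ?sqrtr_ge0 ?expR_ge0// expR_le_sqrt_1m.
Qed.

(** For [d >= 4], [(d - 3) / (2 d) >= 1 / 8]. Up to a constant the bound is the normal density with
    standard deviation 2, the dominating function in [height_weight_int_cvg]. *)
Lemma height_weight_gauss_bound d y : (3 < d)%N -> height_weight d y <= expR (- (y ^+ 2 / 8)).
Proof.
move=> d3; apply: le_trans (height_weight_ub _ _) _; rewrite ler_expR lerN2.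
have dR : 0 < d%:R :> R by rewrite ltr0n (ltn_trans _ d3).
rewrite (_ : _ * _ / 2 = y ^+ 2 * ((d - 3)%:R / d%:R / 2)); last by ring.
rewrite ler_wpM2l ?sqr_ge0// ler_pdivlMr// natrB ?(ltnW d3)//.
rewrite ler_pdivlMr//.
have : 4 <= d%:R :> R by rewrite (ler_nat R 4 d).
lra.
Qed.

Local Notation F a := (filter_prod (nbhs \oo) (nbhs (a : R))).

(** The product filter makes the convergence uniform near [a], as required by windows that shrink to
    [a] while the dimension grows. The weight is squeezed between two exponentials with a common
    limit. *)
Lemma height_weight_cvg a :
  height_weight z.1 z.2 @[z --> F a] --> (expR (- (a ^+ 2 / 2)) : R).
Proof.
have i0 : (z.1%:R : R)^-1 @[z --> F a] --> (0 : R).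
  apply: (@cvg_comp _ _ _ (fun z : nat * R => z.1) (fun n : nat => (n%:R : R)^-1) _ (nbhs \oo)).
    exact: cvg_fst.
  have h := @cvg_harmonic R; rewrite -cvg_shiftS; exact: h.
have y2 : z.2 ^+ 2 @[z --> F a] --> a ^+ 2.
  apply: (@cvg_comp _ _ _ (fun z : nat * R => z.2) (fun y : R => y ^+ 2) _ (nbhs a)).
    exact: cvg_snd.
  exact: exprn_continuous.
have x0 : z.2 ^+ 2 / z.1%:R @[z --> F a] --> (0 : R).
  by rewrite -(mulr0 (a ^+ 2)); exact: cvgM.
have i3 : 1 - 3 * z.1%:R^-1 @[z --> F a] --> (1 - 3 * 0 : R).
  by apply: cvgB; [exact: cvg_cst|exact: cvgMl_tmp].
have x1 : (1 - z.2 ^+ 2 / z.1%:R)^-1 @[z --> F a] --> ((1 - 0)^-1 : R).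
  by apply: cvgV; [rewrite subr0 oner_neq0|apply: cvgB; [exact: cvg_cst|exact: x0]].
rewrite mulr0 subr0 in i3; rewrite subr0 invr1 in x1.
have lim1 : - (z.2 ^+ 2 * (1 - 3 * z.1%:R^-1) / 2) @[z --> F a] --> - (a ^+ 2 * 1 / 2).
  by apply: cvgN; apply: cvgMr_tmp; exact: cvgM.
have lim2 : - (z.2 ^+ 2 * (1 - 3 * z.1%:R^-1) / (1 - z.2 ^+ 2 / z.1%:R) / 2)
    @[z --> F a] --> - (a ^+ 2 * 1 * 1 / 2).
  by apply: cvgN; apply: cvgMr_tmp; apply: cvgM => //; exact: cvgM.
rewrite mulr1 in lim1; rewrite !mulr1 in lim2.
have e1 := cvg_comp _ _ lim1 (@continuous_expR R _).
have e2 := cvg_comp _ _ lim2 (@continuous_expR R _).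
apply: (squeeze_cvgr _ e2 e1).
have nd : \forall z \near F a, (3 < z.1)%N.
  exists ([set n | (3 < n)%N], setT); last by move=> [n y] [].
  by split; [exact: nbhs_infty_gt|exact: filterT].
have nx : \forall z \near F a, z.2 ^+ 2 / z.1%:R < 1.
  by apply: (cvgr_lt _ x0); exact: ltr01.
near=> z.
have d3 : (3 < z.1)%N by near: z.
have x1z : z.2 ^+ 2 / z.1%:R < 1 by near: z.
have d0 : z.1%:R != 0 :> R by rewrite pnatr_eq0 -lt0n (ltn_trans _ d3).
apply/andP; split.
  apply: le_trans (height_weight_lb x1z); rewrite /= ler_expR lerN2 natrB ?(ltnW d3)//.
  rewrite le_eqVlt; apply/orP; left; apply/eqP.
  have x1' : 1 - z.2 ^+ 2 / z.1%:R != 0 by rewrite subr_eq0 eq_sym lt_eqF.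
  move: (_ - _) x1' => q q0; move: (z.1%:R) d0 => n n0.
  by field; rewrite q0 n0.
apply: le_trans (height_weight_ub _ _) _; rewrite /= ler_expR lerN2 natrB ?(ltnW d3)//.
rewrite le_eqVlt; apply/orP; left; apply/eqP.
by move: (z.1%:R) d0 => n n0; field.
Unshelve. all: by end_near. Qed.

Lemma height_weight_int_cvg :
  \int[leb]_y height_weight n y @[n --> \oo] --> (Num.sqrt (2 * pi) : R).
Proof.
have pw y : height_weight n y @[n --> \oo] --> expR (- (y ^+ 2 / 2)).
  apply: (@cvg_comp _ _ _ (fun n : nat => (n, y)) (fun z : nat * R => height_weight z.1 z.2)
    _ (F y)); last exact: height_weight_cvg.
  move=> A [[B C] [B1 C1] BC]; apply: filterS B1 => n Bn.
  by apply: (BC (n, y)); split=> //; exact: nbhs_singleton C1.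
rewrite -(cvg_shiftn 4).
pose p2 : R := (normal_peak 2)^-1.
have p20 : (normal_peak 2 : R) != 0 by rewrite gt_eqF// normal_peak_gt0// pnatr_eq0.
have [] := @dominated_convergence _ _ R leb setT measurableT
  (fun n => EFin \o height_weight (n + 4)) (fun y => (expR (- (y ^+ 2 / 2)))%:E)
  (EFin \o (fun y => p2 * normal_pdf 0 2 y)).
- by move=> n; apply/measurable_EFinP; exact: measurable_height_weight.
- apply/measurable_EFinP; apply: measurableT_comp => //; apply: measurableT_comp => //.
  by apply: measurable_funM => //; exact: measurable_funX.
- apply: aeW => y _; apply: cvg_EFin; first exact: nearW.
  have := pw y; rewrite -(cvg_shiftn 4); exact.
- apply: integrable_scale; exact: integrable_normal_pdf.
- apply: aeW => y n _ /=; rewrite lee_fin ger0_norm ?height_weight_ge0//.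
  rewrite normal_pdfE ?pnatr_eq0// mulrA mulVf// mul1r.
  rewrite /normal_fun subr0 (_ : - y ^+ 2 / _ = - (y ^+ 2 / 8)).
    by apply: height_weight_gauss_bound; rewrite addnS ltnS leq_addl.
  by rewrite -mulr_natr -natrX -natrM mulNr.
move=> fi _ h.
have E : (\int[leb]_y (expR (- (y ^+ 2 / 2)))%:E)%E = (Num.sqrt (2 * pi))%:E :> \bar R.
  have n1 := @integral_normal_pdf R 0 1.
  have s0 : Num.sqrt (2 * pi) != 0 :> R.
    by rewrite gt_eqF// sqrtr_gt0 mulr_gt0// pi_gt0.
  rewrite -[RHS]mule1 -n1 -ge0_integralZl//; last 2 first.
  - by apply/measurable_EFinP; exact: measurable_normal_pdf.
  - by move=> y _; rewrite lee_fin normal_pdf_ge0.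
  apply: eq_integral => y _; rewrite -EFinM; congr _%:E.
  rewrite normal_pdfE ?oner_neq0// /normal_peak /normal_fun expr1n mul1r subr0.
  by rewrite -[pi *+ 2]mulr_natl mulrA divff// mul1r mulNr.
by rewrite E in h; apply: fine_cvg; exact: h.
Qed.

Lemma height_density_cvg a : height_density z.1 z.2 @[z --> F a] --> phi a.
Proof.
apply: cvgM; last exact: height_weight_cvg.
apply: (@cvg_comp _ _ _ (fun z : nat * R => z.1)
  (fun n => (\int[leb]_x height_weight n x)^-1) _ (nbhs \oo)); first exact: cvg_fst.
apply: cvgV; last exact: height_weight_int_cvg.
by rewrite gt_eqF// sqrtr_gt0 mulr_gt0// pi_gt0.
Qed.

(** A single [eta] measures both the distance to [a] and, through [1 <= eta * d%:R], the size of the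
    dimension; [good] follows the same convention. *)
Lemma height_density_near a (eps : R) : 0 < eps -> exists2 eta : R, 0 < eta &
  forall d y, 1 <= eta * d%:R -> `|y - a| <= eta -> `|height_density d y - phi a| <= eps.
Proof.
move=> e0; have /cvgrPdist_le/(_ _ e0) := @height_density_cvg a.
move=> [[A B] [/= [N _ NA] [r /= r0 rB]] AB].
exists (Num.min (N.+1%:R^-1) (r / 2)).
  by rewrite lt_min invr_gt0 ltr0n/= divr_gt0.
move=> d y d1 yr; rewrite distrC; apply: (AB (d, y)); split => /=.
  apply: NA => /=; rewrite ltnW// -(ltr_nat R).
  have : 1 <= N.+1%:R^-1 * d%:R :> R.
    by apply: le_trans d1 _; rewrite ler_wpM2r// ge_min lexx.
  rewrite ler_pdivlMl// mulr1; apply: lt_le_trans; by rewrite ltr_nat.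
apply: rB => /=; rewrite distrC; apply: (le_lt_trans yr).
by rewrite gt_min ltr_pdivrMr// ltr_pMr// ltr1n orbT.
Qed.

(** The normalizing integral tends to [sqrt (2 pi) > 1], while the weight is at most 1. *)
Lemma height_density_le1 : exists2 eta : R, 0 < eta &
  forall d y, 1 <= eta * d%:R -> height_density d y <= 1.
Proof.
have s1 : 1 < Num.sqrt (2 * pi) :> R.
  rewrite -[ltLHS]sqrtr1 ltr_sqrt ?mulr_gt0 ?pi_gt0//.
  by have := @pi_ge2 R; lra.
have [N _ NA] : \forall n \near \oo, 1 < \int[leb]_y height_weight n y.
  exact: (cvgr_gt _ height_weight_int_cvg).
exists (N.+1%:R^-1); first by rewrite invr_gt0 ltr0n.
move=> d y; rewrite ler_pdivlMl// mulr1 ler_nat => Nd.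
have I1 : 1 < \int[leb]_y height_weight d y by apply: NA; exact: ltnW.
rewrite /height_density mulrC ler_pdivrMr ?(lt_trans _ I1)// mul1r.
by apply: (le_trans (height_weight_le1 _ _)); exact: ltW.
Qed.

End GaussianLimit.

(** * Removing one point from the count *)

Section AffinePreimage.
Context {R : realType}.
Local Notation leb := (@lebesgue_measure R).

Lemma measurable_affine (b g : R) (B : set R) : measurable B ->
  measurable ((fun z : R => b + g * z) @^-1` B).
Proof.
move=> mB; rewrite -[X in measurable X]setTI.
have m : measurable_fun setT (fun z : R => b + g * z).
  by apply: measurable_funD => //; exact: measurable_funM.
exact: m.
Qed.

Lemma lebesgue_affine (b g : R) (B : set R) : 0 < g -> measurable B ->
  leb ((fun z : R => b + g * z) @^-1` B) = ((g^-1)%:E * leb B)%E.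
Proof.
move=> g0 mB; have ng : 0 <= g by exact: ltW.
pose T (z : measurableTypeR R) : measurableTypeR R := b + g * z.
have mT : measurable_fun setT T.
  move=> _ Y mY; rewrite setTI; exact: measurable_affine.
pose nuf : {measure set (measurableTypeR R) -> \bar R} :=
  [the {measure set _ -> \bar R} of pushforward leb T].
pose nu0 := nuf mT.
pose nu : {measure set (measurableTypeR R) -> \bar R} :=
  [the {measure set _ -> \bar R} of mscale (NngNum ng) nu0].
have E : leb B = nu B.
  apply: lebesgue_measure_unique => // _ [[x y] /= _ <-].
  rewrite /nu /= /mscale /= /nu0 /nuf /= /pushforward.
  rewrite (_ : T @^-1` _ = `](x - b) / g, (y - b) / g]%classic); last first.
    apply/seteqP; split=> z /=; rewrite !in_itv/= /T ltr_pdivrMr// ler_pdivlMr//;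
      by move=> /andP[h1 h2]; apply/andP; split; lra.
  rewrite !lebesgue_measure_itv/= !lte_fin ltr_pM2r ?invr_gt0// ltrD2r.
  case: ifPn => _; rewrite ?mule0//.
  by rewrite -!EFinB -EFinM; congr _%:E; field; rewrite gt_eqF.
rewrite E /nu /= /mscale /= muleA -EFinM mulVf ?gt_eqF// mul1e.
by [].
Qed.

End AffinePreimage.

Section MeasurableBools.
Context dT (T : measurableType dT) dS (S : measurableType dS).

Lemma measurable_fun_in (g : T -> S) (B : set S) : measurable_fun setT g -> measurable B ->
  measurable_fun setT (fun u => g u \in B).
Proof.
move=> mg mB; apply: (measurable_fun_bool true); rewrite setTI.
rewrite (_ : _ @^-1` _ = g @^-1` B); first by rewrite -[X in measurable X]setTI; exact: mg.
by apply/seteqP; split=> u /= => [/set_mem|/mem_set].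
Qed.

Lemma measurable_fun_bools (I : Type) (s : seq I) (b : I -> T -> bool) (F : seq bool -> S) :
  (forall i, measurable_fun setT (b i)) ->
  measurable_fun setT (fun u => F [seq b i u | i <- s]).
Proof.
move=> mb; elim: s F => [|i s IH] F /=; first exact: measurable_cst.
rewrite (_ : (fun u => _) = (fun u => if b i u then F (true :: [seq b i u | i <- s])
  else F (false :: [seq b i u | i <- s]))); last by apply/funext => u; case: (b i u).
by apply: measurable_fun_ifT => //; exact: (IH (fun l => F (_ :: l))).
Qed.

End MeasurableBools.

Section Hits.
Context {R : realType}.

Definition hit (B : set R) d (x u : 'rV[R]_d) : bool := (Num.sqrt d%:R * dotp x u) \in B.

Definition hits d n (A : {set 'I_n}) (B : 'I_n -> set R) (x : 'I_n -> 'rV[R]_d) (u : 'rV[R]_d) :=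
  (\sum_(i in A) hit (B i) (x i) u)%N.

Lemma measurable_hit d (B : set R) (x : 'rV[R]_d) : measurable B ->
  measurable_fun setT (fun u : borel_rV R d => hit B x u).
Proof.
move=> mB; apply: measurable_fun_in => //; apply: measurable_funM => //.
rewrite (_ : dotp x = (fun u => dotp u x)); first exact: measurable_dotp.
by apply/funext => u; rewrite dotpC.
Qed.

Lemma measurable_sumb dT (T : measurableType dT) dS (S : measurableType dS) n (A : {set 'I_n})
    (b : 'I_n -> T -> bool) (f : nat -> S) :
  (forall i, measurable_fun setT (b i)) ->
  measurable_fun setT (fun u => f (\sum_(i in A) b i u)%N).
Proof.
move=> mb; have := measurable_fun_bools (enum A) (fun l => f (\sum_(x <- l) x)%N) mb.
by congr (measurable_fun _ _); apply/funext => u; rewrite big_map big_enum.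
Qed.

Lemma measurable_hits d n (A : {set 'I_n}) B (x : 'I_n -> 'rV[R]_d) (f : nat -> R) :
  (forall i, measurable (B i)) ->
  measurable_fun setT (fun u : borel_rV R d => f (hits A B x u)).
Proof. by move=> mB; apply: measurable_sumb => i; exact: measurable_hit. Qed.

Lemma hits_le d n (A : {set 'I_n}) B (x : 'I_n -> 'rV[R]_d) u : (hits A B x u <= #|A|)%N.
Proof.
rewrite /hits -sum1_card; apply: leq_sum => i _; exact: leq_b1.
Qed.

(* The coordinate condition rd <x, .> in B at the point of height y over t,
   seen from the sphere orthogonal to t. *)
Definition scale d (y c : R) : R :=
  Num.sqrt d%:R * Num.sqrt (1 - y ^+ 2 / d%:R) * Num.sqrt (1 - c ^+ 2) / Num.sqrt (d.-1)%:R.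

Definition window d (y c : R) (B : set R) : set R :=
  (fun z : R => c * y + scale d y c * z) @^-1` B.

Lemma measurable_window d y c B : measurable B -> measurable (window d y c B).
Proof. exact: measurable_affine. Qed.

Lemma hit_frame_point m (t : 'rV[R]_m.+2) P y v (x : 'rV[R]_m.+2) B : frame t P -> dotp x x = 1 ->
  hit B x (frame_point t P (y / Num.sqrt (m.+2)%:R) (Num.sqrt (1 - y ^+ 2 / (m.+2)%:R)) v) =
  hit (window m.+2 y (dotp x t) B) (normalize (x *m P^T)) v.
Proof.
move=> fr x1; rewrite /hit dotp_frame_point.
have E : Num.sqrt (1 - dotp x t ^+ 2) = Num.sqrt (dotp (x *m P^T) (x *m P^T)).
  congr Num.sqrt; have := frame_dotp fr x x; rewrite x1 expr2 => ->; ring.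
have r0 : Num.sqrt (m.+2)%:R != 0 :> R by rewrite gt_eqF// sqrtr_gt0.
have r1 : Num.sqrt (m.+1)%:R != 0 :> R by rewrite gt_eqF// sqrtr_gt0.
have key : Num.sqrt (m.+2)%:R * (y / Num.sqrt (m.+2)%:R * dotp x t +
    Num.sqrt (1 - y ^+ 2 / (m.+2)%:R) * dotp (x *m P^T) v) =
    dotp x t * y + scale m.+2 y (dotp x t) * (Num.sqrt (m.+1)%:R * dotp (normalize (x *m P^T)) v).
  rewrite /scale E -{1}(normalizeK (x *m P^T)) dotpZl -pred_Sn.
  move: (Num.sqrt (m.+2)%:R) r0 (Num.sqrt (m.+1)%:R) r1 => q q0 q' q0'.
  by field; rewrite q0 q0'.
by rewrite key; apply/idP/idP => /set_mem h; exact/mem_set.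
Qed.

Lemma normalize_corr m (t : 'rV[R]_m.+1) (P : 'M[R]_(m, m.+1)) x x' : frame t P ->
  dotp x x = 1 -> dotp x' x' = 1 ->
  dotp (normalize (x *m P^T)) (normalize (x' *m P^T)) = proj_corr (dotp t x) (dotp t x') (dotp x x').
Proof.
move=> fr x1 x1'; rewrite dotpZl dotpZr /proj_corr invfM.
have E (z : 'rV[R]_m.+1) : dotp z z = 1 -> 1 - dotp t z ^+ 2 = dotp (z *m P^T) (z *m P^T).
  by move=> z1; have := frame_dotp fr z z; rewrite z1 expr2 (dotpC t) => ->; ring.
rewrite !E//; have := frame_dotp fr x x'; rewrite !(dotpC t) => ->.
by ring.
Qed.

End Hits.

Lemma measurable_boolr dT (T : measurableType dT) {R : realType} (b : T -> bool) :
  measurable_fun setT b -> measurable_fun setT (fun u => (b u)%:R : R).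
Proof.
move=> mb; rewrite (_ : (fun u => _) = (fun u => if b u then 1 else 0 : R)).
  exact: measurable_fun_ifT.
by apply/funext => u; case: (b u).
Qed.

Section Slices.
Context {R : realType} {m : nat}.
Local Notation d := m.+4.
Local Notation leb := (@lebesgue_measure R).
Variable mu : probability (borel_rV R d) R.
Hypothesis mu_unif : uniform_on_sphere mu.
Local Notation rd := (Num.sqrt d%:R : R).
Local Notation hm B := (fine (height_measure d (B : set R))).

Lemma height_measure_between (B : set R) (lo hi : R) : measurable B -> 0 <= lo ->
  (forall y, B y -> lo <= height_density d y <= hi) ->
  (lo%:E * leb B <= height_measure d B <= hi%:E * leb B)%E.
Proof.
move=> mB lo0 h; rewrite /height_measure /density_measure.
have mq : measurable_fun B (fun y => (height_density d y)%:E).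
  by apply/measurable_EFinP; apply: measurable_funTS; exact: measurable_height_density.
rewrite -!integral_cst//; apply/andP; split; apply: ge0_le_integral => //;
  move=> y By; rewrite lee_fin ?height_density_ge0//; by have /andP[] := h y By.
Qed.

Lemma hit_law (B : set R) (x : 'rV[R]_d) : dotp x x = 1 -> measurable B ->
  mu [set u | hit B x u] = height_measure d B.
Proof.
move=> x1 mB; have [P fr [Q oQ tQ]] := exists_frame x1.
rewrite -(height_law mu_unif mB) -[RHS](mu_unif.2 Q oQ); last first.
  by rewrite -[X in measurable X]setTI; apply: measurable_height.
congr (mu _); apply/seteqP; split=> u /=; rewrite /hit /height /axis dotpC tQ => h.
  exact/set_mem.
exact/mem_set.
Qed.

Lemma height_measure_fin (B : set R) : measurable B -> height_measure d B = (hm B)%:E.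
Proof. by move=> mB; rewrite fineK// fin_num_measure. Qed.

Lemma Rintegral_hit (B : set R) (x : 'rV[R]_d) : dotp x x = 1 -> measurable B ->
  \int[mu]_u (hit B x u)%:R = hm B.
Proof.
move=> x1 mB; rewrite -(hit_law x1 mB).
have mh : measurable [set u : borel_rV R d | hit B x u].
  have h := @measurable_hit R d B x mB measurableT [set true] Logic.I.
  by rewrite setTI in h; exact: h.
rewrite /Rintegral (_ : (fun u => _) = (fun u => (\1_[set u | hit B x u] u)%:E)).
  by rewrite integral_indic// setIT.
apply/funext => u; rewrite indicE; congr (_%:R%:E); congr nat_of_bool.
by apply/idP/idP => [h|/set_mem//]; exact/mem_set.
Qed.

(** The disintegration in the form used below: bounds on the slices at heights in [B] integrate to
    bounds on the event that [t] is hit. The frame and the law of the slices depend on [t] alone,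
    not on [B] or [G]. *)
Lemma sphere_slices (t : 'rV[R]_d) : dotp t t = 1 ->
  exists (P : 'M[R]_(m.+3, d)) (nu : probability (borel_rV R m.+3) R),
  [/\ frame t P, uniform_on_sphere nu &
   forall (B : set R) (G : borel_rV R d -> R) (M lo hi : R), measurable B ->
    measurable_fun setT G -> (forall u, 0 <= G u <= M) ->
    measurable_fun setT (fun z : measurableTypeR R * borel_rV R m.+3 =>
      G (frame_point t P (z.1 / rd) (Num.sqrt (1 - z.1 ^+ 2 / d%:R)) z.2)) ->
    0 <= hi ->
    (forall y, B y ->
      lo <= \int[nu]_v G (frame_point t P (y / rd) (Num.sqrt (1 - y ^+ 2 / d%:R)) v) <= hi) ->
    lo * hm B <= \int[mu]_u ((hit B t u)%:R * G u) <= hi * hm B].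
Proof.
move=> t1; have [P fr frQ] := exists_frame t1.
exists P, (perp_law mu P); split=> //; first exact: (perp_law_unif mu_unif fr frQ).
move=> B G M lo hi mB mG GM mGs hi0 hB.
set nu := perp_law mu P in hB *; set sp := sphere_point t P.
have G0 u : 0 <= G u by have /andP[] := GM u.
have mh : measurable_fun setT (fun u : borel_rV R d => (hit B t u)%:R : R).
  exact: measurable_boolr (measurable_hit t mB).
pose F (u : borel_rV R d) := ((hit B t u)%:R * G u)%:E.
have rd0 : rd != 0 by rewrite gt_eqF// sqrtr_gt0.
have hsp y v : hit B t (sp y v) = (y \in B).
  rewrite /hit /sp /sphere_point dotp_frame_point t1 mulr1.
  have [_ _ -> _] := fr; rewrite [dotp 0 v](_ : _ = 0) ?mulr0 ?addr0.
    by rewrite mulrCA divff// mulr1.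
  by rewrite /dotp big1// => i _; rewrite mxE mul0r.
have mFs : measurable_fun setT (fun z : measurableTypeR R * borel_rV R m.+3 => F (sp z.1 z.2)).
  apply/measurable_EFinP; rewrite (_ : (fun z => _) =
    (fun z : measurableTypeR R * borel_rV R m.+3 => (z.1 \in B)%:R * G (sp z.1 z.2))); last first.
    by apply/funext => z; rewrite hsp.
  apply: measurable_funM => //.
  have mb : measurable_fun setT (fun z : measurableTypeR R * borel_rV R m.+3 => z.1 \in B).
    by apply: measurable_fun_in => //; exact: measurable_fst.
  exact: measurable_boolr mb.
have FE : (\int[mu]_u F u = \int[leb]_y ((\int[nu]_v F (sp y v)) * (height_density d y)%:E))%E.
  apply: (sphere_disintegration mu_unif fr frQ).
  - by move=> u; rewrite lee_fin mulr_ge0.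
  - by apply/measurable_EFinP; exact: measurable_funM.
  - exact: mFs.
have mGy y : measurable_fun setT (fun v : borel_rV R m.+3 => G (sp y v)).
  have mp : measurable_fun setT (fun v : borel_rV R m.+3 => ((y : measurableTypeR R), v)).
    by apply: measurable_fun_pair => //; exact: measurable_cst.
  exact: (measurableT_comp mGs mp).
have inner y : (\int[nu]_v F (sp y v) = ((y \in B)%:R * \int[nu]_v G (sp y v))%:E)%E.
  rewrite /F; under eq_integral do rewrite hsp.
  have ig : nu.-integrable setT (EFin \o (fun v => G (sp y v))).
    by apply: (bounded_integrable nu (M := M)) => // v; rewrite ger0_norm//; have /andP[] := GM (sp y v).
  case: (y \in B); last by rewrite mul0r; under eq_integral do rewrite mul0r; rewrite integral0.
  rewrite mul1r; under eq_integral do rewrite mul1r.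
  by rewrite /Rintegral fineK//; exact: integrable_fin_num.
have hmE (c : R) : 0 <= c ->
    (\int[leb]_y ((c * (y \in B)%:R * height_density d y)%:E) = (c * hm B)%:E)%E.
  move=> c0; rewrite EFinM -height_measure_fin// /height_measure /density_measure.
  rewrite [in RHS]integral_mkcond -ge0_integralZl//.
  - apply: eq_integral => y _; rewrite patchE; case: ifPn => yB.
      by rewrite mulr1 EFinM.
    by rewrite mulr0 mul0r mule0.
  - apply/(measurable_restrictT _ mB)/measurable_EFinP; apply: measurable_funTS.
    exact: measurable_height_density.
  - by move=> y _; rewrite patchE; case: ifPn => // _; rewrite lee_fin height_density_ge0.
have mint : measurable_fun setT (fun y : measurableTypeR R => (\int[nu]_v F (sp y v) * (height_density d y)%:E)%E).
  apply: emeasurable_funM; last by apply/measurable_EFinP; exact: measurable_height_density.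
  apply: (@measurable_fun_fubini_tonelli_F _ _ (measurableTypeR R) (borel_rV R m.+3) R nu
    (fun z => F (sp z.1 z.2)) mFs) => z.
  by rewrite lee_fin mulr_ge0.
have mc (c : R) : measurable_fun setT (fun y : measurableTypeR R => (c * (y \in B)%:R * height_density d y)%:E).
  apply/measurable_EFinP; apply: measurable_funM; last exact: measurable_height_density.
  apply: measurable_funM => //; apply: measurable_boolr.
  by apply: measurable_fun_in => //; exact: measurable_id.
have fin1 : (\int[mu]_u F u)%E = (\int[mu]_u ((hit B t u)%:R * G u))%:E.
  rewrite /Rintegral fineK//; apply: integrable_fin_num => //.
  apply: (bounded_integrable mu (M := M)) => [|u]; first exact: measurable_funM.
  have /andP[g0 g1] := GM u; rewrite normrM (ger0_norm g0).
  by case: (hit B t u); rewrite ?normr1 ?mul1r// normr0 mul0r (le_trans g0).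
apply/andP; split.
  (* A negative [lo] does occur, as [L] minus an error; the bound is then trivial because the
     integrand is nonnegative. *)
  have [lo0|lo0] := leP lo 0.
    apply: (@le_trans _ _ 0); first by rewrite mulr_le0_ge0// fine_ge0.
    by apply: Rintegral_ge0 => u _; rewrite mulr_ge0.
  rewrite -lee_fin -fin1 FE -hmE; last exact: ltW.
  apply: ge0_le_integral => //.
  - by move=> y _; rewrite lee_fin mulr_ge0 ?height_density_ge0// mulr_ge0// ltW.
  - move=> y _; rewrite inner -EFinM lee_fin ler_wpM2r ?height_density_ge0//.
    case: (boolP (y \in B)) => [/set_mem By|_]; last by rewrite mulr0 mul0r.
    by rewrite mulr1 mul1r; have /andP[] := hB y By.
rewrite -lee_fin -fin1 FE -hmE//; apply: ge0_le_integral => //.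
- move=> y _; rewrite inner -EFinM lee_fin mulr_ge0 ?height_density_ge0// mulr_ge0//.
  by apply: Rintegral_ge0 => v _.
- move=> y _; rewrite inner -EFinM lee_fin ler_wpM2r ?height_density_ge0//.
  case: (boolP (y \in B)) => [/set_mem By|_]; last by rewrite mulr0 mul0r.
  by rewrite mulr1 mul1r; have /andP[] := hB y By.
Qed.

End Slices.

(** * Configurations to which the estimates apply uniformly *)

Section GoodConfigurations.
Context {R : realType}.
Local Notation leb := (@lebesgue_measure R).

(* The windows B i depend on the point: slicing the sphere along a point x_j
   deforms the window of x_i by an amount depending on <x_i, x_j>. *)
Definition good (a C lam eta : R) d (mu : probability (borel_rV R d) R) n
    (x : 'I_n -> 'rV[R]_d) (A : {set 'I_n}) (B : 'I_n -> set R) : Prop :=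
  [/\ [/\ uniform_on_sphere mu, 1 <= eta * d%:R & 1 <= eta * n%:R],
      sparse_corr n A (fun i j => dotp (x i) (x j)) eta,
      forall i, measurable (B i),
      {in A, forall i, [/\ dotp (x i) (x i) = 1, forall y, B i y -> `|y - a| <= eta &
                           (leb (B i) <= (C / n%:R)%:E)%E]} &
      `|phi a * (\sum_(i in A) fine (leb (B i))) - lam| <= eta].

(* tau is an error that survives the limit; it comes from truncating the number
   of hits. *)
Definition near_count (a lam : R) (f : nat -> R) (L tau : R) : Prop :=
  forall C eps : R, 0 < C -> 0 < eps -> exists2 eta : R, 0 < eta &
  forall d (mu : probability (borel_rV R d) R) n (x : 'I_n -> 'rV[R]_d) A B,
    good a C lam eta mu x A B -> `|\int[mu]_u f (hits A B x u) - L| <= tau + eps.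

Lemma sparse_corr_le (T : finType) N (A : {set T}) (c : T -> T -> R) e1 e2 : e1 <= e2 ->
  sparse_corr N A c e1 -> sparse_corr N A c e2.
Proof.
move=> e12 h i iA; apply: (@le_trans _ _ (e1 * N%:R)); last by rewrite ler_wpM2r.
apply: le_trans (h i iA); rewrite [leRHS](bigID (fun j => e2 <= `|c i j|))/=.
rewrite -[leLHS]addr0; apply: lerD; last by apply: sumr_ge0 => j _; exact: wt_ge0.
rewrite le_eqVlt; apply/orP; left; apply/eqP; apply: eq_bigl => j.
case: (boolP (e2 <= _)) => h2; last by rewrite !andbF.
by rewrite (le_trans e12 h2) !andbT.
Qed.

Lemma good_le a C lam e1 e2 d (mu : probability (borel_rV R d) R) n (x : 'I_n -> 'rV[R]_d) A B :
  e1 <= e2 -> good a C lam e1 mu x A B -> good a C lam e2 mu x A B.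
Proof.
move=> e12 [[mu_unif d1 n1] sp mB hB hl]; split=> //.
- split=> //; [apply: (le_trans d1)|apply: (le_trans n1)]; exact: ler_wpM2r.
- exact: sparse_corr_le sp.
- move=> i iA; have [h1 h2 h3] := hB i iA; split=> // y /h2 h; exact: le_trans e12.
- exact: le_trans e12.
Qed.

Lemma gram_like_dotp d (T : finType) (x : T -> 'rV[R]_d) (A : {set T}) :
  {in A, forall i, dotp (x i) (x i) = 1} -> gram_like A (fun i j => dotp (x i) (x j)).
Proof.
move=> x1; split.
- by move=> i j; exact: dotpC.
- by move=> i j iA jA; apply: dotp_sqr_le1; exact: x1.
- by move=> t i j tA iA jA; apply: vol2_ge0; exact: x1.
- by move=> i j t s iA jA tA sA; apply: vol2_quasi_triangle; exact: x1.
Qed.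

(** As [scale] is nonnegative, its distance to 1 is at most that of its square, which is the
    rational expression [(d - y^2) (1 - c^2) / (d - 1)]. *)
Lemma scale_near d (y c Y th : R) : (1 < d)%N -> `|y| <= Y -> Y ^+ 2 <= d%:R -> c ^+ 2 <= th ->
  c ^+ 2 <= 1 -> 1 <= th * d%:R -> `|scale d y c - 1| <= (2 * Y ^+ 2 + 4) * th.
Proof.
move=> d1 yY Yd cth c1 thd.
have s0 : 0 <= scale d y c by rewrite /scale !mulr_ge0 ?invr_ge0 ?sqrtr_ge0.
have yy : y ^+ 2 <= Y ^+ 2.
  rewrite -(real_normK (num_real y)) ler_pXn2r ?nnegrE//; exact: le_trans yY.
have dR : 2 <= d%:R :> R by rewrite (ler_nat R 2 d).
have dp : 0 < d%:R :> R by lra.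
have dm : d.-1%:R = d%:R - 1 :> R by rewrite -subn1 natrB// ltnW.
have y2 : y ^+ 2 / d%:R <= 1 by rewrite ler_pdivrMr// mul1r (le_trans yy).
have sq : scale d y c ^+ 2 = (d%:R - y ^+ 2) * (1 - c ^+ 2) / (d%:R - 1).
  rewrite /scale !exprMn exprVn !sqr_sqrtr ?ler0n ?subr_ge0// dm.
  by field; apply/andP; split; apply/eqP; lra.
have th0 : 0 < th.
  by rewrite -(pmulr_lgt0 _ dp) (lt_le_trans _ thd).
have K : scale d y c ^+ 2 - 1 = (1 - y ^+ 2 - (d%:R - y ^+ 2) * c ^+ 2) / (d%:R - 1).
  by rewrite sq; field; apply/eqP; lra.
have key : `|scale d y c ^+ 2 - 1| <= (2 * Y ^+ 2 + 4) * th.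
  rewrite K normrM normfV (ger0_norm (_ : 0 <= d%:R - 1)); last by lra.
  rewrite ler_pdivrMr; last by lra.
  have y0 := sqr_ge0 y; have c0 := sqr_ge0 c; have YY := sqr_ge0 Y.
  have h1 : (d%:R - y ^+ 2) * c ^+ 2 <= d%:R * th.
    by apply: ler_pM => //; [lra|lra].
  have h2 : 0 <= (d%:R - y ^+ 2) * c ^+ 2 by apply: mulr_ge0 => //; lra.
  have h3 : (2 * Y ^+ 2 + 4) * th * (d%:R - 1) >= (Y ^+ 2 + 2) * (th * d%:R).
    have -> : (2 * Y ^+ 2 + 4) * th * (d%:R - 1) = (Y ^+ 2 + 2) * (th * (2 * (d%:R - 1))) by ring.
    by apply: ler_wpM2l; [lra|apply: ler_wpM2l; lra].
  have h4 : Y ^+ 2 <= Y ^+ 2 * (th * d%:R) by rewrite ler_peMr.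
  have h5 : (Y ^+ 2 + 2) * (th * d%:R) = Y ^+ 2 * (th * d%:R) + 2 * (th * d%:R) by ring.
  by rewrite ler_norml; apply/andP; split; lra.
apply: le_trans key.
have -> : scale d y c ^+ 2 - 1 = (scale d y c - 1) * (scale d y c + 1) by ring.
rewrite normrM ler_peMr// ger0_norm; lra.
Qed.

Lemma leb_window_fine d y c (B : set R) : 0 < scale d y c -> measurable B ->
  (leb (window d y c B) = (scale d y c)^-1%:E * leb B)%E.
Proof. by move=> s0 mB; exact: lebesgue_affine. Qed.

End GoodConfigurations.

Section ProbabilityBounds.
Context dT (T : measurableType dT) {R : realType} (P : probability T R).

Lemma Rintegral_prob_cst (r : R) : \int[P]_x r = r.
Proof.
rewrite Rintegral_cst// (_ : fine _ = 1) ?mulr1//.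
exact: (congr1 fine (probability_setT P)).
Qed.

Lemma Rintegral_le_cst (f : T -> R) (M : R) : measurable_fun setT f ->
  (forall x, `|f x| <= M) -> \int[P]_x f x <= M.
Proof.
move=> mf fM; rewrite -(Rintegral_prob_cst M); apply: le_Rintegral => //.
- exact: (bounded_integrable P mf fM).
- by apply: (bounded_integrable P (M := `|M|)).
- by move=> x _; apply: le_trans (fM x); exact: ler_norm.
Qed.

End ProbabilityBounds.

(** * The probability that two given points are both hit *)

Section PairBound.
Context {R : realType} {k : nat}.
Local Notation d := k.+1.+4.
Local Notation leb := (@lebesgue_measure R).
Local Notation rd := (Num.sqrt d%:R : R).
Variable mu : probability (borel_rV R d) R.
Hypothesis mu_unif : uniform_on_sphere mu.
Hypotheses (q1 : forall y : R, height_density d y <= 1)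
           (q1' : forall y : R, height_density d.-1 y <= 1).

Lemma height_measure_le_leb m (B : set R) : (forall y : R, height_density m.+4 y <= 1) ->
  measurable B -> (height_measure m.+4 B <= leb B)%E.
Proof.
move=> h mB; have := @height_measure_between R m B 0 1 mB (lexx _).
rewrite mul1e => /(_ _)/andP[]// y By; by rewrite height_density_ge0 h.
Qed.

Lemma measurable_slice_hit (t x : 'rV[R]_d) P (B : set R) : measurable B ->
  measurable_fun setT (fun z : measurableTypeR R * borel_rV R k.+4 =>
    hit B x (frame_point t P (z.1 / rd) (Num.sqrt (1 - z.1 ^+ 2 / d%:R)) z.2)).
Proof.
move=> mB; apply: measurable_fun_in => //; apply: measurable_funM => //.
rewrite (_ : (fun z => _) = (fun z : measurableTypeR R * borel_rV R k.+4 =>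
   z.1 / rd * dotp x t + Num.sqrt (1 - z.1 ^+ 2 / d%:R) * dotp z.2 (x *m P^T))); last first.
  by apply/funext => z; rewrite dotp_frame_point (dotpC (x *m P^T)).
have m1 : measurable_fun setT (fun z : measurableTypeR R * borel_rV R k.+4 => z.1 : R).
  exact: measurable_fst.
apply: measurable_funD.
  by apply: measurable_funM => //; apply: measurable_funM.
apply: measurable_funM.
  have mc : measurable_fun setT (fun y : R => Num.sqrt (1 - y ^+ 2 / d%:R)).
    apply: continuous_measurable_fun => y.
    apply: (@continuous_comp _ _ _ (fun y : R => 1 - y ^+ 2 / d%:R) Num.sqrt).
      exact: continuous_shape.
    exact: sqrt_continuous.
  exact: (measurableT_comp mc m1).
have m2 : measurable_fun setT (fun z : measurableTypeR R * borel_rV R k.+4 => z.2).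
  exact: measurable_snd.
exact: (measurableT_comp (measurable_dotp (x *m P^T)) m2).
Qed.

(** Given a height [y] along [xj], the window of [xi] is stretched by at most [2 / sqrt (1 - c^2)],
    since [y^2 / d <= 3 / 4] keeps [sqrt (1 - y^2 / d)] above [1 / 2]; with densities at most 1 this
    bounds the conditional probability. When [sqrt (1 - c^2) <= 1 / n] the trivial bound 1 replaces
    it, and [wt] combines the two cases. The slices live in dimension [d - 1 >= 4], where the
    coordinate law is again available. *)
Lemma pair_hit_bound n (C : R) (xi xj : 'rV[R]_d) (Bi Bj : set R) : (0 < n)%N -> 0 < C ->
  dotp xi xi = 1 -> dotp xj xj = 1 -> measurable Bi -> measurable Bj ->
  (leb Bi <= (C / n%:R)%:E)%E -> (leb Bj <= (C / n%:R)%:E)%E ->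
  (forall y, Bj y -> y ^+ 2 / d%:R <= 3 / 4) ->
  \int[mu]_u ((hit Bj xj u)%:R * (hit Bi xi u)%:R) <=
    (2 * C + 1) * C * (wt n (dotp xj xi) / n%:R ^+ 2).
Proof.
move=> n0 C0 i1 j1 mi mj li lj yj.
have nR : 0 < n%:R :> R by rewrite ltr0n.
have [P [nu [fr nu_unif H]]] := sphere_slices mu_unif j1.
set c := dotp xj xi.
have w0 := wt_ge0 n c.
have hj : fine (height_measure d Bj) <= C / n%:R.
  rewrite -lee_fin -height_measure_fin//; apply: le_trans lj.
  exact: height_measure_le_leb.
have hi0 : 0 <= (2 * C + 1) * (wt n c / n%:R).
  by rewrite mulr_ge0 ?divr_ge0//; lra.
have mhit B (x : 'rV[R]_d) : measurable B -> measurable_fun setT (fun u : borel_rV R d => (hit B x u)%:R : R).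
  by move=> mB; apply: measurable_boolr; exact: measurable_hit.
have := H Bj (fun u => (hit Bi xi u)%:R) 1 0 ((2 * C + 1) * (wt n c / n%:R)) mj (mhit _ _ mi).
move=> /(_ _ _ hi0 _)/andP[].
- by move=> u; rewrite ler0n lern1 leq_b1.
- apply: measurable_boolr; exact: measurable_slice_hit.
- move=> y Bjy; apply/andP; split; first by apply: Rintegral_ge0 => v _.
  under eq_Rintegral do rewrite (hit_frame_point _ _ _ fr i1).
  have mW : measurable (window d y (dotp xi xj) Bi) by exact: measurable_window.
  have le1 : \int[nu]_v (hit (window d y (dotp xi xj) Bi) (normalize (xi *m P^T)) v)%:R <= 1 :> R.
    apply: Rintegral_le_cst => [|v]; last by rewrite ger0_norm// lern1 leq_b1.
    by apply: measurable_boolr; exact: measurable_hit.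
  have [small|big] := leP (Num.sqrt (1 - c ^+ 2)) n%:R^-1.
    apply: (le_trans le1); rewrite /wt max_r// invrK divff ?gt_eqF// mulr1; lra.
  have s0 : 0 < Num.sqrt (1 - c ^+ 2) by apply: lt_trans big; rewrite invr_gt0.
  have wE : wt n c = (Num.sqrt (1 - c ^+ 2))^-1 by rewrite /wt max_l// ltW.
  have sc : Num.sqrt (1 - c ^+ 2) / 2 <= scale d y (dotp xi xj).
    rewrite /scale (dotpC xi) -/c -pred_Sn.
    have a1 : 1 / 2 <= Num.sqrt (1 - y ^+ 2 / d%:R).
      rewrite -[leLHS](@ger0_norm _ _); last by lra.
      rewrite -sqrtr_sqr ler_wsqrtr// (_ : (1 / 2) ^+ 2 = 1 / 4); last by field.
      by move: (yj y Bjy); move: (y ^+ 2 / _) => q hq; lra.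
    have a2 : 1 <= rd / Num.sqrt (k.+4)%:R.
      by rewrite ler_pdivlMr ?sqrtr_gt0 ?ltr0n// mul1r ler_wsqrtr// ler_nat.
    have -> : rd * Num.sqrt (1 - y ^+ 2 / d%:R) * Num.sqrt (1 - c ^+ 2) / Num.sqrt (k.+4)%:R =
      (rd / Num.sqrt (k.+4)%:R) * Num.sqrt (1 - y ^+ 2 / d%:R) * Num.sqrt (1 - c ^+ 2) by ring.
    rewrite mulrC ler_pM2r//; apply: (@le_trans _ _ (1 * (1 / 2))); first by lra.
    by apply: ler_pM => //; lra.
  have sp : 0 < scale d y (dotp xi xj) by apply: lt_le_trans sc; rewrite divr_gt0.
  have x'1 : dotp (normalize (xi *m P^T)) (normalize (xi *m P^T)) = 1.
    apply: normalize_unit; apply/eqP => x0.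
    have := frame_dotp fr xi xi; rewrite x0 i1 (dotpC xi xj) -/c.
    rewrite [dotp 0 0](_ : _ = 0) ?addr0; last by rewrite /dotp big1// => i _; rewrite mxE mul0r.
    by move=> h; move: s0; rewrite expr2 -h subrr sqrtr0 ltxx.
  rewrite (Rintegral_hit nu_unif x'1 mW).
  apply: (@le_trans _ _ (C / n%:R / scale d y (dotp xi xj))).
    rewrite -lee_fin -height_measure_fin//.
    apply: (@le_trans _ _ (leb (window d y (dotp xi xj) Bi))); first exact: height_measure_le_leb.
    by rewrite leb_window_fine// mulrC EFinM lee_wpmul2l// lee_fin invr_ge0 ltW.
  rewrite wE; apply: (@le_trans _ _ (C / n%:R * (2 / Num.sqrt (1 - c ^+ 2)))).
    have -> : 2 / Num.sqrt (1 - c ^+ 2) = (Num.sqrt (1 - c ^+ 2) / 2)^-1 by rewrite invf_div.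
    have a0 : 0 < C / n%:R by rewrite divr_gt0.
    have b0 : 0 < Num.sqrt (1 - c ^+ 2) / 2 by rewrite divr_gt0.
    by rewrite ler_pM2l// lef_pV2 ?posrE.
  have -> : C / n%:R * (2 / Num.sqrt (1 - c ^+ 2)) = 2 * C * ((Num.sqrt (1 - c ^+ 2))^-1 / n%:R) by ring.
  by rewrite ler_wpM2r ?divr_ge0 ?invr_ge0 ?sqrtr_ge0//; lra.
move=> _ h; apply: (le_trans h); apply: (@le_trans _ _ ((2 * C + 1) * (wt n c / n%:R) * (C / n%:R))).
  by rewrite ler_wpM2l.
rewrite le_eqVlt; apply/orP; left; apply/eqP; field; exact: lt0r_neq0.
Qed.

End PairBound.

Section SliceGood.
Context {R : realType}.
Local Notation leb := (@lebesgue_measure R).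

Lemma phi_le1 (a : R) : phi a <= 1.
Proof.
rewrite /phi mulr_ile1 ?invr_ge0 ?sqrtr_ge0 ?expR_ge0//.
  rewrite invf_le1 ?sqrtr_gt0 ?mulr_gt0 ?pi_gt0// -[leLHS]sqrtr1 ler_wsqrtr//.
  by have := @pi_ge2 R; lra.
by rewrite -expR0 ler_expR oppr_le0 divr_ge0// sqr_ge0.
Qed.

Lemma phi_gt0 (a : R) : 0 < phi a.
Proof. by rewrite mulr_gt0 ?expR_gt0// invr_gt0 sqrtr_gt0 mulr_gt0// pi_gt0. Qed.

Lemma sum_leb_le n (D : {set 'I_n}) (B : 'I_n -> set R) (C th : R) : (0 < n)%N -> 0 <= C ->
  {in D, forall i, (leb (B i) <= (C / n%:R)%:E)%E} -> #|D|%:R <= th * n%:R ->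
  0 <= \sum_(i in D) fine (leb (B i)) <= th * C.
Proof.
move=> n0 C0 h Dn; have nR : 0 < n%:R :> R by rewrite ltr0n.
apply/andP; split; first by apply: sumr_ge0 => i _; exact: fine_ge0.
apply: (@le_trans _ _ (\sum_(i in D) C / n%:R)).
  apply: ler_sum => i iD; rewrite -lee_fin fineK; first exact: h.
  by rewrite ge0_fin_numE//; apply: le_lt_trans (h i iD) _; exact: ltry.
rewrite sumr_const -[_ *+ #|D|]mulr_natr.
have -> : C / n%:R * #|D|%:R = C * (#|D|%:R / n%:R) by ring.
by rewrite (mulrC th) ler_wpM2l// ler_pdivrMr.
Qed.

(** The points of [S] are nearly orthogonal to [x j], so [scale] is close to 1 and their windows
    hardly change; the discarded points carry a total length of at most [th' * C]. The stretching
    factor is at most [4 / 3], and [2 * C] leaves room for it. *)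
Lemma slice_good (a C lam eta1 : R) : 0 < C -> 0 < eta1 -> exists2 th : R, 0 < th &
  forall eta th', eta <= th' -> th' <= th -> forall k (mu : probability (borel_rV R k.+1.+4) R) n
    (x : 'I_n -> 'rV[R]_k.+1.+4) A B j (S : {set 'I_n}) P (nu : probability (borel_rV R k.+4) R) y,
  good a C lam eta mu x A B -> j \in A -> S \subset A ->
  #|A :\: S|%:R <= th' * n%:R -> {in S, forall i, `|dotp (x j) (x i)| < th'} ->
  sparse_corr n S (fun i l => proj_corr (dotp (x j) (x i)) (dotp (x j) (x l)) (dotp (x i) (x l))) th' ->
  frame (x j) P -> uniform_on_sphere nu -> B j y ->
  good a (2 * C) lam eta1 nu (fun i => normalize (x i *m P^T)) S
    (fun i => window k.+1.+4 y (dotp (x i) (x j)) (B i)).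
Proof.
move=> C0 e10.
pose Y : R := `|a| + 1; have Y1 : 1 <= Y by rewrite lerDr.
pose K1 : R := 2 * Y ^+ 2 + 4.
have Y2 : 1 <= Y ^+ 2 by rewrite exprn_ege1.
have K1p : 0 < K1 by rewrite /K1; lra.
(* [K2] adds up the demands on [th]: the windows move by [2 * (1 + Y + K1 * Y) * th] at most, the
   total length changes by [(C + 2 * C * K1) * th], and the constants absorb the error [eta] already
   present and the loss of one dimension. *)
pose K2 : R := 2 * (1 + Y + K1 * Y) + 1 + C + 2 * C * K1 + 2.
have K1Y : 0 <= K1 * Y by rewrite mulr_ge0; lra.
have CK1 : 0 <= C * K1 by rewrite mulr_ge0; lra.
have K2p : 0 < K2 by rewrite /K2; lra.
exists (Num.min (eta1 / K2) (Num.min (4^-1 / K1) (4^-1 / Y ^+ 2))).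
  by rewrite !lt_min !divr_gt0//; lra.
move=> eta th eth; rewrite !le_min => /and3P[th1 th2 th3] k mu n x A B j S P nu y.
set d := k.+1.+4.
have kd : (k.+1.+4 <= 2 * k.+4)%N by clear; lia.
move=> [[mu_unif d1 n1] sp mB hB hl] jA SA AS cS spS fr nu_unif Bjy.
have {}th1 : th * K2 <= eta1 by rewrite -ler_pdivlMr.
have {}th2 : th * K1 <= 4^-1 by rewrite -ler_pdivlMr.
have {}th3 : th * Y ^+ 2 <= 4^-1 by rewrite -ler_pdivlMr//; lra.
have dR : 0 < d%:R :> R by rewrite ltr0n.
have eta0 : 0 < eta by rewrite -(pmulr_lgt0 _ dR) (lt_le_trans _ d1).
have th0 : 0 < th by exact: lt_le_trans eth.
have n0 : (0 < n)%N by rewrite lt0n; apply/eqP => n0; move: n1; rewrite n0 mulr0 ler10.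
have nR : 0 < n%:R :> R by rewrite ltr0n.
have thd : 1 <= th * d%:R by apply: (le_trans d1); exact: ler_wpM2r.
have thn : 1 <= th * n%:R by apply: (le_trans n1); exact: ler_wpM2r.
have the : 2 * th <= eta1.
  apply: le_trans th1; rewrite mulrC; apply: ler_wpM2l; first exact: ltW.
  rewrite /K2; lra.
have th4 : th <= 4^-1 by apply: le_trans th3; rewrite ler_peMr// ltW.
have [xj1 hj _] := hB j jA.
have ya : `|y - a| <= eta by exact: hj.
have yY : `|y| <= Y.
  have := ler_normD (y - a) a; rewrite subrK => h; apply: (le_trans h).
  by rewrite /Y addrC lerD2l; lra.
have Yd : Y ^+ 2 <= d%:R.
  have : th * Y ^+ 2 <= th * d%:R by lra.
  by rewrite ler_pM2l.
have xS i : i \in S -> i \in A by move=> iS; exact: (fintype.subsetP SA).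
pose c i := dotp (x i) (x j); pose g i := scale d y (c i).
have cth i : i \in S -> `|c i| < th by move=> iS; rewrite /c dotpC cS.
have c2 i : i \in S -> c i ^+ 2 <= th.
  move=> iS; rewrite -(real_normK (num_real _)) expr2.
  have h := cth i iS; have h0 := normr_ge0 (c i).
  have h1 : `|c i| <= 1 by clear -h th4; lra.
  by rewrite -[leRHS]mul1r; apply: ler_pM => //; exact: ltW.
have c21 i : i \in S -> c i ^+ 2 <= 1 by move=> /c2; lra.
have gs i : i \in S -> `|g i - 1| <= K1 * th.
  by move=> iS; apply: scale_near => //; [exact: c2|exact: c21].
have g34 i : i \in S -> 3 / 4 <= g i.
  by move=> /gs; rewrite ler_norml => /andP[h _]; move: h; rewrite mulrC; lra.
have gpos i : i \in S -> 0 < g i by move=> /g34; lra.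
have gi0 i : i \in S -> 0 <= (g i)^-1 by move=> /gpos /ltW; rewrite -invr_ge0.
have gV i : i \in S -> (g i)^-1 <= 2.
  move=> iS; rewrite -[leRHS]invrK lef_pV2 ?posrE ?invr_gt0 ?gpos//.
  by have := g34 i iS; clear; lra.
have gV1 i : i \in S -> `|(g i)^-1 - 1| <= 2 * (K1 * th).
  move=> iS; have g0 := gpos i iS.
  have -> : (g i)^-1 - 1 = (g i)^-1 * (1 - g i) by field; exact: lt0r_neq0.
  rewrite normrM (ger0_norm (gi0 i iS)).
  by apply: ler_pM; rewrite ?gi0 ?gV// distrC gs.
have lW i : i \in S -> (leb (window d y (c i) (B i)) = (g i)^-1%:E * leb (B i))%E.
  by move=> iS; apply: leb_window_fine; [exact: gpos|exact: mB].
have lfin i : i \in A -> leb (B i) = (fine (leb (B i)))%:E.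
  move=> iA; rewrite fineK// ge0_fin_numE//; have [_ _ h] := hB i iA.
  by apply: le_lt_trans h _; exact: ltry.
have lC i : i \in A -> fine (leb (B i)) <= C / n%:R.
  by move=> iA; have [_ _ h] := hB i iA; rewrite -lee_fin -lfin.
have x'1 i : i \in S -> dotp (normalize (x i *m P^T)) (normalize (x i *m P^T)) = 1.
  move=> iS; have [xi1 _ _] := hB i (xS i iS).
  apply: normalize_unit; apply/eqP => x0.
  have := frame_dotp fr (x i) (x i); rewrite x0 xi1 -/(c i).
  rewrite [dotp 0 0](_ : _ = 0) ?addr0; last by rewrite /dotp big1// => l _; rewrite mxE mul0r.
  by have := c2 i iS; rewrite expr2 => h1 h2; move: h1 th4; rewrite -h2; clear; lra.
split.
- split=> //.
    apply: (le_trans thd); apply: (@le_trans _ _ (th * (2 * k.+4%:R))).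
      by apply: ler_wpM2l; [exact: ltW|rewrite -natrM ler_nat; exact: kd].
    by rewrite mulrA; apply: ler_wpM2r => //; rewrite mulrC.
  apply: (le_trans thn); apply: ler_wpM2r => //; apply: le_trans the.
  by rewrite ler_peMl ?ler1n// ltW.
- apply: (@sparse_corr_le _ _ _ _ _ th).
    by apply: le_trans the; rewrite ler_peMl ?ler1n// ltW.
  move=> i iS; apply: le_trans (spS i iS); rewrite le_eqVlt; apply/orP; left; apply/eqP.
  have E l : l \in S -> dotp (normalize (x i *m P^T)) (normalize (x l *m P^T)) =
      proj_corr (dotp (x j) (x i)) (dotp (x j) (x l)) (dotp (x i) (x l)).
    move=> lS; have [xi1 _ _] := hB i (xS i iS); have [xl1 _ _] := hB l (xS l lS).
    exact: normalize_corr.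
  rewrite !big_mkcondr; apply: eq_bigr => l lS; by rewrite E.
- by move=> i; exact: measurable_window.
- move=> i iS; have iA := xS i iS; split; first exact: x'1.
    move=> z /= Bz; have [_ hi _] := hB i iA; have := hi _ Bz.
    rewrite -/(c i) -/(g i) => b1; have g0 := gpos i iS.
    have -> : z - a = (g i)^-1 * ((c i * y + g i * z - a) - c i * y + (1 - g i) * a).
      by field; exact: lt0r_neq0.
    rewrite normrM (ger0_norm (gi0 i iS)).
    apply: (@le_trans _ _ (2 * (th + th * Y + K1 * th * Y))).
      apply: ler_pM; rewrite ?gi0 ?gV//.
      apply: (le_trans (ler_normD _ _)); apply: lerD.
        apply: (le_trans (ler_normB _ _)); apply: lerD; first exact: le_trans eth.
        by rewrite normrM; apply: ler_pM => //; exact/ltW/cth.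
      rewrite normrM distrC; apply: ler_pM => //; first exact: gs.
      by rewrite /Y lerDl.
    apply: le_trans th1.
    have -> : 2 * (th + th * Y + K1 * th * Y) = th * (2 * (1 + Y + K1 * Y)) by ring.
    by apply: ler_wpM2l; [exact: ltW|rewrite /K2; lra].
  have g0 := gpos i iS.
  rewrite lW// lfin// -EFinM lee_fin -[leRHS]mulrA.
  by apply: ler_pM; rewrite ?gi0 ?gV ?fine_ge0 ?lC.
have sumS : \sum_(i in A) fine (leb (B i)) =
    \sum_(i in S) fine (leb (B i)) + \sum_(i in A :\: S) fine (leb (B i)).
  rewrite (big_setID S)/=; congr (_ + _).
  by apply: eq_bigl => i; rewrite finset.in_setI; case: (boolP (i \in S)) => [/xS ->|_]; rewrite ?andbF.
have lW' : \sum_(i in S) fine (leb (window d y (c i) (B i))) =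
    \sum_(i in S) (g i)^-1 * fine (leb (B i)).
  by apply: eq_bigr => i iS; rewrite lW// lfin ?xS// -EFinM.
have /andP[d0 dC] : 0 <= \sum_(i in A :\: S) fine (leb (B i)) <= th * C.
  apply: sum_leb_le => //; [exact: ltW|].
  by move=> i; rewrite finset.in_setD => /andP[_ /hB[]].
have /andP[s0 sC] : 0 <= \sum_(i in S) fine (leb (B i)) <= 1 * C.
  apply: sum_leb_le => //; [exact: ltW|by move=> i /xS /hB[]|].
  by rewrite mul1r ler_nat -[leqRHS](card_ord n); exact: max_card.
have df : `|\sum_(i in S) (g i)^-1 * fine (leb (B i)) - \sum_(i in S) fine (leb (B i))| <=
    2 * (K1 * th) * C.
  rewrite -sumrB; apply: le_trans (ler_norm_sum _ _ _) _.
  apply: (@le_trans _ _ (\sum_(i in S) 2 * (K1 * th) * fine (leb (B i)))).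
    apply: ler_sum => i iS; rewrite -[X in _ - X]mul1r -mulrBl normrM.
    rewrite (ger0_norm (_ : 0 <= fine _)) ?fine_ge0//; apply: ler_wpM2r; first exact: fine_ge0.
    exact: gV1.
  rewrite -mulr_sumr; apply: ler_wpM2l; last by rewrite -[leRHS]mul1r.
  by rewrite !mulr_ge0// ltW.
rewrite lW'.
have p1 := phi_le1 a; have p0 := phi_gt0 a.
set s1 := \sum_(i in S) (g i)^-1 * _ in df *; set s2 := \sum_(i in S) _ in sumS s0 sC df *.
set s3 := \sum_(i in A :\: S) _ in sumS d0 dC *.
rewrite sumS in hl.
have -> : phi a * s1 - lam = (phi a * (s2 + s3) - lam) + phi a * ((s1 - s2) - s3) by ring.
apply: (le_trans (ler_normD _ _)).
have h3 : `|phi a * (s1 - s2 - s3)| <= 2 * (K1 * th) * C + th * C.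
  rewrite normrM -[leRHS]mul1r; apply: ler_pM => //; first by rewrite gtr0_norm.
  apply: (le_trans (ler_normB _ _)); apply: lerD => //.
  by rewrite ger0_norm.
apply: (le_trans (lerD hl h3)); apply: le_trans th1.
have -> : 2 * (K1 * th) * C + th * C = th * (2 * C * K1 + C) by ring.
apply: (@le_trans _ _ (th * (1 + (2 * C * K1 + C)))); first by rewrite [leRHS]mulrDr mulr1 lerD2r.
apply: ler_wpM2l; [exact: ltW|rewrite /K2; lra].
Qed.

End SliceGood.

Section Removal.
Context {R : realType}.

(** The two counts differ only if a discarded point is hit together with [j]; in that case the
    values of [f] differ by at most [M]. *)
Lemma removal_bound n (A S : {set 'I_n}) (j : 'I_n) (h : 'I_n -> bool) (f : nat -> R) (M : R) :
  j \in A -> S \subset A -> j \notin S -> (forall w, 0 <= f w <= M) ->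
  `|(h j)%:R * f (\sum_(i in A) h i)%N.-1 - (h j)%:R * f (\sum_(i in S) h i)%N| <=
    M * \sum_(i in A | (i \notin S) && (i != j)) (h j)%:R * (h i)%:R.
Proof.
move=> jA SA jS fM; have M0 : 0 <= M by have /andP[h0 h1] := fM 0%N; exact: le_trans h1.
have s0 : 0 <= \sum_(i in A | (i \notin S) && (i != j)) (h j)%:R * (h i)%:R :> R.
  by apply: sumr_ge0 => i _; rewrite mulr_ge0.
case: (boolP (h j)) s0 => hj s0; last by rewrite !mul0r subrr normr0 mulr_ge0.
have t1 : (true : nat)%:R = 1 :> R by [].
rewrite t1 !mul1r; under [in leRHS]eq_bigr do rewrite mul1r.
set r := (\sum_(i in A | (i \notin S) && (i != j)) h i)%N.
have sA : (\sum_(i in A) h i = 1 + (\sum_(i in S) h i + r))%N.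
  rewrite (bigD1 j)//= hj; congr (1 + _)%N.
  rewrite (bigID (fun i => i \in S))/=; congr (_ + _)%N.
    apply: eq_bigl => i; case: (boolP (i \in S)) => iS; last by rewrite andbF.
    rewrite (fintype.subsetP SA i iS) andbT /=; apply/eqP => ij.
    by move: jS; rewrite -ij iS.
  by apply: eq_bigl => i; rewrite -andbA (andbC (i != j)).
rewrite sA add1n /=; have -> : \sum_(i in A | (i \notin S) && (i != j)) (h i)%:R = r%:R :> R.
  by rewrite natr_sum.
case: (posnP r) => [->|r0]; first by rewrite addn0 subrr normr0 mulr0.
have /andP[f0 f1] := fM (\sum_(i in S) h i + r)%N.
have /andP[f2 f3] := fM (\sum_(i in S) h i)%N.
apply: (@le_trans _ _ M); first by rewrite ler_norml; apply/andP; split; lra.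
by rewrite ler_peMr// ler1n.
Qed.

Lemma bounded_Rintegral_le dT (T : measurableType dT) (P : probability T R) (f g : T -> R) (M : R) :
  measurable_fun setT f -> measurable_fun setT g -> (forall u, `|f u| <= M) -> (forall u, `|g u| <= M) ->
  (forall u, f u <= g u) -> \int[P]_u f u <= \int[P]_u g u.
Proof.
move=> mf mg fM gM fg; apply: le_Rintegral => //.
- exact: (bounded_integrable P mf fM).
- exact: (bounded_integrable P mg gM).
Qed.

End Removal.

Section HeightNear.
Context {R : realType}.
Local Notation leb := (@lebesgue_measure R).

Lemma height_measure_near m (a th : R) (B : set R) : 0 <= th -> measurable B ->
  (leb B < +oo)%E -> (forall y, B y -> `|height_density m.+4 y - phi a| <= th) ->
  `|fine (height_measure m.+4 B) - phi a * fine (leb B)| <= th * fine (leb B).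
Proof.
move=> th0 mB Boo h.
have lfin : leb B = (fine (leb B))%:E by rewrite fineK// ge0_fin_numE.
have hb y : B y -> phi a - th <= height_density m.+4 y <= phi a + th.
  by move=> /h; rewrite ler_norml => /andP[h1 h2]; apply/andP; split; lra.
have l0 : 0 <= fine (leb B) by exact: fine_ge0.
have p0 : 0 <= fine (height_measure m.+4 B) by exact: fine_ge0.
have up : fine (height_measure m.+4 B) <= (phi a + th) * fine (leb B).
  have /andP[_] : (0%:E * leb B <= height_measure m.+4 B <= (phi a + th)%:E * leb B)%E.
    apply: height_measure_between => // y By; rewrite height_density_ge0.
    by have /andP[] := hb y By.
  by rewrite height_measure_fin// lfin -EFinM lee_fin.
have lo : (phi a - th) * fine (leb B) <= fine (height_measure m.+4 B).
  have [neg|pos] := leP (phi a - th) 0; first by apply: le_trans p0; exact: mulr_le0_ge0.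
  have /andP[+ _] : ((phi a - th)%:E * leb B <= height_measure m.+4 B <= (phi a + th)%:E * leb B)%E.
    by apply: height_measure_between => //; exact: ltW.
  by rewrite height_measure_fin// lfin -EFinM lee_fin.
by rewrite ler_norml; apply/andP; split; lra.
Qed.

End HeightNear.

Section StepArith.
Context {R : realType}.
Implicit Types s lam eta th C m L : R.

Lemma step_arith1 s1 s2 s3 lam eta th C : eta <= th -> `|s3 - lam| <= eta ->
  `|s1 + s2 - s3| <= th * C -> 0 <= s2 -> s2 <= th * C -> `|s1 - lam| <= (2 * C + 1) * th.
Proof.
have -> : (2 * C + 1) * th = 2 * (th * C) + th by ring.
rewrite !ler_norml => h0 /andP[h1 h2] /andP[h3 h4] r0 r1; apply/andP; split; lra.
Qed.

Lemma step_arith2 s1 s2 s3 s4 lam L m1 m2 m3 m4 t : 0 <= s4 -> s4 <= m2 ->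
  `|s1 - s2| <= m1 -> `|s2 - L * s3| <= t * s3 -> `|L * (s3 - lam)| <= m4 ->
  t * s3 <= m3 -> `|s1 + s4 - lam * L| <= m3 + m4 + m1 + m2.
Proof.
move=> z0 z1 h1 h2 h3 h4.
have -> : s1 + s4 - lam * L = (s1 - s2) + (s2 - L * s3) + L * (s3 - lam) + s4 by ring.
apply: le_trans (ler_normD _ _) _; rewrite (ger0_norm z0); apply: lerD => //.
apply: le_trans (ler_normD _ _) _.
by have := ler_normD (s1 - s2) (s2 - L * s3); lra.
Qed.

Lemma step_arith3 tau e lam eps C th aL m : 0 <= tau -> 0 <= lam -> 0 < e -> e <= 1 ->
  e * (lam + 1) <= eps / 2 -> 0 <= 2 * C + 1 -> 0 <= th ->
  th * ((tau + 1) * (2 * C + 1) + aL * (2 * C + 1) + m * ((2 * C + 1) * C) + m * C + 1) <= eps / 2 ->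
  (tau + e) * (lam + (2 * C + 1) * th) + aL * ((2 * C + 1) * th) + m * ((2 * C + 1) * C) * th
    + th * (m * C) <= lam * tau + eps.
Proof.
move=> tau0 lam0 e0 e1 elam C0 th0 h.
have h1 : (tau + e) * ((2 * C + 1) * th) <= (tau + 1) * ((2 * C + 1) * th).
  by apply: ler_wpM2r; [exact: mulr_ge0|rewrite lerD2l].
have -> : (tau + e) * (lam + (2 * C + 1) * th) = lam * tau + e * lam + (tau + e) * ((2 * C + 1) * th) by ring.
move: h h1; set t := (2 * C + 1) * th => h h1.
have {}h : (tau + 1) * t + aL * t + m * ((2 * C + 1) * C) * th + th * (m * C) + th <= eps / 2.
  by apply: le_trans h; rewrite le_eqVlt; apply/orP; left; apply/eqP; rewrite /t; ring.
have h2 : e * lam + e <= eps / 2 by move: elam; rewrite mulrDr mulr1.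
lra.
Qed.

Lemma step_arith4 s1 s2 s3 : s1 <= s2 -> 2 * s2 <= s3 -> 0 <= s3 -> s1 <= 3 / 4 * s3.
Proof. lra. Qed.

Lemma half_le s1 : 0 < s1 -> s1 / 2 <= s1.
Proof. lra. Qed.

Lemma ge6_succ d : (6 <= d)%N -> exists k, d = k.+1.+4.
Proof. by case: d => [|[|[|[|[|k]]]]]// _; exists k. Qed.

Lemma leq_double4 k : (k.+1.+4 <= 2 * k.+4)%N.
Proof. lia. Qed.

End StepArith.

(** * From the mean of [f(W)] to the mean of [W f(W - 1)] *)

Section Step.
Context {R : realType}.
Local Notation leb := (@lebesgue_measure R).
Variables (a lam : R) (f : nat -> R) (L tau M : R).
Hypotheses (lam0 : 0 <= lam) (tau0 : 0 <= tau) (fM : forall w, 0 <= f w <= M).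
Hypothesis nearf : near_count a lam f L tau.

Let M0 : 0 <= M. Proof. by have /andP[h0 h1] := fM 0%N; exact: le_trans h1. Qed.

Section Estimates.
Variables (k n : nat) (mu : probability (borel_rV R k.+1.+4) R).
Local Notation d := k.+1.+4.
Variables (x : 'I_n -> 'rV[R]_d) (A : {set 'I_n}) (B : 'I_n -> set R) (C eta th e : R).
Hypotheses (C0 : 0 < C) (th0 : 0 < th) (eta_th : eta <= th) (e0 : 0 < e).
Hypothesis gd : good a C lam eta mu x A B.
Hypotheses (q1 : forall y : R, height_density d y <= 1)
           (q1' : forall y : R, height_density k.+4 y <= 1).
Hypothesis qa : forall y, `|y - a| <= eta -> `|height_density d y - phi a| <= th.
Hypothesis dY : forall y, `|y - a| <= eta -> y ^+ 2 / d%:R <= 3 / 4.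
Variables (J : {set 'I_n}) (S : 'I_n -> {set 'I_n}).
Hypotheses (JA : J \subset A) (AJ : #|A :\: J|%:R <= th * n%:R).
Hypothesis hS : {in J, forall t, [/\ S t \subset A, t \notin S t &
  \sum_(i in A | (i \notin S t) && (i != t)) wt n (dotp (x t) (x i)) <= th * n%:R]}.
Hypothesis slice : {in J, forall j (P : 'M[R]_(k.+4, d)) (nu : probability (borel_rV R k.+4) R) y,
  frame (x j) P -> uniform_on_sphere nu -> B j y ->
  `|\int[nu]_v f (hits (S j) (fun i => window d y (dotp (x i) (x j)) (B i))
       (fun i => normalize (x i *m P^T)) v) - L| <= tau + e}.

(** [E1 j] is the contribution of [j] to the mean of [W f(W - 1)]; [E2 j] counts only the hits in
    [S j], which the slice along [x j] controls. *)
Let P j := fine (height_measure d (B j)).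
Let E1 j := \int[mu]_u ((hit (B j) (x j) u)%:R * f (hits A B x u).-1).
Let E2 j := \int[mu]_u ((hit (B j) (x j) u)%:R * f (hits (S j) B x u)).

Let mu_unif : uniform_on_sphere mu. Proof. by have [[]] := gd. Qed.
Let mB i : measurable (B i). Proof. by have [] := gd. Qed.
Let hB : {in A, forall i, [/\ dotp (x i) (x i) = 1, forall y, B i y -> `|y - a| <= eta &
  (leb (B i) <= (C / n%:R)%:E)%E]}. Proof. by have [] := gd. Qed.
Let n0 : (0 < n)%N.
Proof.
have [[_ _ n1] _ _ _ _] := gd.
by rewrite lt0n; apply/eqP => n0; move: n1; rewrite n0 mulr0 ler10.
Qed.
Let nR : 0 < n%:R :> R. Proof. by rewrite ltr0n. Qed.
Let K0 : 0 <= (2 * C + 1) * C.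
Proof.
apply: mulr_ge0; last exact: ltW.
by apply: addr_ge0 => //; apply: mulr_ge0 => //; exact: ltW.
Qed.
Let JinA j : j \in J -> j \in A. Proof. exact: (fintype.subsetP JA). Qed.

Let mhit j : measurable_fun setT (fun u : borel_rV R d => (hit (B j) (x j) u)%:R : R).
Proof. by apply: measurable_boolr; exact: measurable_hit. Qed.

Let mprod j (D : {set 'I_n}) (g : nat -> R) :
  measurable_fun setT (fun u : borel_rV R d => (hit (B j) (x j) u)%:R * g (hits D B x u)).
Proof. by apply: measurable_funM => //; exact: measurable_hits. Qed.

Let bprod j (D : {set 'I_n}) (g : nat -> nat) u :
  `|(hit (B j) (x j) u)%:R * f (g (hits D B x u))| <= M.
Proof.
have /andP[f0 f1] := fM (g (hits D B x u)).
by case: (hit _ _ _); rewrite ?mul1r ?mul0r ?normr0// ger0_norm.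
Qed.

Let P_ge0 j : 0 <= P j. Proof. exact: fine_ge0. Qed.

Let lfin i : i \in A -> (leb (B i) < +oo)%E.
Proof. by move=> iA; have [_ _ h] := hB iA; apply: le_lt_trans h _; exact: ltry. Qed.

Let P_le j : j \in A -> P j <= C / n%:R.
Proof.
move=> jA; have [_ _ h] := hB jA; rewrite -lee_fin /P -height_measure_fin//.
apply: le_trans h; exact: height_measure_le_leb.
Qed.

Let sum_const_le (D : {set 'I_n}) (F : 'I_n -> R) (c t : R) : 0 <= c ->
  {in D, forall i, F i <= c / n%:R} -> #|D|%:R <= t * n%:R -> \sum_(i in D) F i <= t * c.
Proof.
move=> c0 h Dn; apply: (@le_trans _ _ (\sum_(i in D) c / n%:R)); first exact: ler_sum.
rewrite sumr_const -[_ *+ #|D|]mulr_natr.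
have -> : c / n%:R * #|D|%:R = c * (#|D|%:R / n%:R) by ring.
by rewrite (mulrC t) ler_wpM2l// ler_pdivrMr.
Qed.

Let cardD (D : {set 'I_n}) : #|D|%:R <= 1 * n%:R :> R.
Proof. by rewrite mul1r ler_nat -[leqRHS](card_ord n); exact: max_card. Qed.

Lemma step_sumP : `|\sum_(j in J) P j - lam| <= (2 * C + 1) * th.
Proof.
have hl : `|phi a * (\sum_(i in A) fine (leb (B i))) - lam| <= eta by have [] := gd.
have dA : `|\sum_(j in A) P j - phi a * \sum_(j in A) fine (leb (B j))| <= th * C.
  rewrite mulr_sumr -sumrB; apply: le_trans (ler_norm_sum _ _ _) _.
  apply: (@le_trans _ _ (\sum_(j in A) th * fine (leb (B j)))).
    apply: ler_sum => j jA; apply: height_measure_near => //; [exact: ltW|exact: lfin|].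
    by move=> y By; apply: qa; have [_ h _] := hB jA; exact: h.
  rewrite -mulr_sumr; apply: ler_wpM2l; first exact: ltW.
  have /andP[_] : 0 <= \sum_(i in A) fine (leb (B i)) <= 1 * C.
    by apply: (@sum_leb_le R n A B C 1) => //; [exact: ltW|move=> i /hB[]].
  by rewrite mul1r.
have sA : \sum_(j in A) P j = \sum_(j in J) P j + \sum_(j in A :\: J) P j.
  rewrite (big_setID J)/=; congr (_ + _).
  by apply: eq_bigl => i; rewrite finset.in_setI; case: (boolP (i \in J)) => [/JinA ->|_]; rewrite ?andbF.
have r0 : 0 <= \sum_(j in A :\: J) P j by apply: sumr_ge0.
have r1 : \sum_(j in A :\: J) P j <= th * C.
  apply: sum_const_le => //; first exact: ltW.
  by move=> i; rewrite finset.in_setD => /andP[_ iA]; exact: P_le.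
rewrite sA in dA; exact: (step_arith1 eta_th hl dA r0 r1).
Qed.

Lemma step_outside : 0 <= \sum_(j in A :\: J) E1 j <= th * (M * C).
Proof.
have ge j : 0 <= E1 j.
  by apply: Rintegral_ge0 => u _; apply: mulr_ge0 => //; have /andP[] := fM (hits A B x u).-1.
apply/andP; split; first by apply: sumr_ge0.
apply: sum_const_le => //; first by rewrite mulr_ge0// ltW.
move=> j; rewrite finset.in_setD => /andP[_ jA]; have [x1 _ _] := hB jA.
apply: (@le_trans _ _ (M * P j)); last by rewrite -mulrA ler_wpM2l// P_le.
rewrite /P -(Rintegral_hit mu_unif x1 (mB j)) -RintegralZl//; last first.
  by apply: (bounded_integrable mu (M := 1)) => // u; rewrite ger0_norm// lern1 leq_b1.
apply: (@bounded_Rintegral_le _ _ _ mu _ _ M).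
- exact: (mprod j A (fun w => f w.-1)).
- by apply: measurable_funM.
- by move=> u; exact: (bprod j A predn).
- by move=> u; case: (hit _ _ _); rewrite ?mulr1 ?mulr0 ?normr0// ger0_norm.
- move=> u; rewrite mulrC; apply: ler_wpM2r => //.
  by have /andP[] := fM (hits A B x u).-1.
Qed.

Lemma step_slice j : j \in J -> `|E2 j - L * P j| <= (tau + e) * P j.
Proof.
move=> jJ; have jA := JinA jJ; have [x1 _ _] := hB jA.
have [Pj [nu [fr nu_unif H]]] := sphere_slices mu_unif x1.
have mG : measurable_fun setT (fun u : borel_rV R d => f (hits (S j) B x u)).
  exact: measurable_hits.
have mGs : measurable_fun setT (fun z : measurableTypeR R * borel_rV R k.+4 =>
    f (hits (S j) B x (frame_point (x j) Pj (z.1 / Num.sqrt d%:R) (Num.sqrt (1 - z.1 ^+ 2 / d%:R)) z.2))).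
  by apply: measurable_sumb => i; exact: measurable_slice_hit.
have [SA _ _] := hS jJ.
have sl y : B j y -> L - (tau + e) <= \int[nu]_v f (hits (S j) B x
     (frame_point (x j) Pj (y / Num.sqrt d%:R) (Num.sqrt (1 - y ^+ 2 / d%:R)) v)) <= L + (tau + e).
  move=> By; have := slice jJ fr nu_unif By; rewrite ler_distl.
  rewrite (_ : \int[nu]_v f (hits _ _ _ _) = \int[nu]_v f (hits (S j) B x
     (frame_point (x j) Pj (y / Num.sqrt d%:R) (Num.sqrt (1 - y ^+ 2 / d%:R)) v)))//.
  apply: eq_Rintegral => v _; congr f; apply: eq_bigr => i iS.
  have [xi1 _ _] := hB (fintype.subsetP SA i iS).
  by rewrite hit_frame_point.
(* With an empty window both sides are 0. Otherwise a slice at a height in the window shows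
   [L + (tau + e)] to be nonnegative, as [sphere_slices] requires. *)
have [[y0 By0]|noy] := pselect (exists y, B j y); last first.
  have B0 : B j = set0 by apply/seteqP; split=> // y By; exfalso; apply: noy; exists y.
  have P0 : P j = 0 by rewrite /P B0 measure0.
  have := H (B j) _ M 0 0 (mB j) mG (fun u => fM _) mGs (lexx _).
  rewrite !mul0r => /(_ _) h; rewrite P0 !mulr0 subr0 normr_le0 -/(E2 j).
  by rewrite eq_le andbC; apply: h => y By; exfalso; apply: noy; exists y.
have hi0 : 0 <= L + (tau + e).
  have /andP[_] := sl y0 By0; apply: le_trans; apply: Rintegral_ge0 => v _.
  by have /andP[] := fM (hits (S j) B x (frame_point (x j) Pj (y0 / Num.sqrt d%:R) (Num.sqrt (1 - y0 ^+ 2 / d%:R)) v)).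
have := H (B j) _ M (L - (tau + e)) (L + (tau + e)) (mB j) mG (fun u => fM _) mGs hi0 sl.
rewrite -/(E2 j) -/(P j) => /andP[h1 h2]; rewrite ler_norml; apply/andP; split; lra.
Qed.

(** A union bound over the discarded points: [pair_hit_bound] converts their total weight [th * n]
    into a probability of order [th / n]. *)
Lemma step_removal j : j \in J -> `|E1 j - E2 j| <= (M * ((2 * C + 1) * C) * th) / n%:R.
Proof.
move=> jJ; have jA := JinA jJ; have [x1 hj lj] := hB jA; have [SA jS sw] := hS jJ.
pose h u i := hit (B i) (x i) u.
pose T := fun i => (i \in A) && ((i \notin S j) && (i != j)).
have i1 : mu.-integrable setT (EFin \o (fun u => (hit (B j) (x j) u)%:R * f (hits A B x u).-1)).
  by apply: (bounded_integrable mu (M := M)); [exact: (mprod j A (fun w => f w.-1))|move=> u; exact: (bprod j A predn)].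
have i2 : mu.-integrable setT (EFin \o (fun u => (hit (B j) (x j) u)%:R * f (hits (S j) B x u))).
  by apply: (bounded_integrable mu (M := M)); [exact: mprod|move=> u; exact: (bprod j (S j) id)].
rewrite -RintegralB//.
pose D (u : borel_rV R d) := (hit (B j) (x j) u)%:R * f (hits A B x u).-1 - (hit (B j) (x j) u)%:R * f (hits (S j) B x u).
have mD : measurable_fun setT D.
  by apply: measurable_funB; [exact: (mprod j A (fun w => f w.-1))|exact: mprod].
have DM u : `|D u| <= M + M.
  by apply: le_trans (ler_normB _ _) _; apply: lerD; [exact: (bprod j A predn)|exact: (bprod j (S j) id)].
have mp i : measurable_fun setT (fun u : borel_rV R d => (h u j)%:R * (h u i)%:R : R).
  exact: (measurable_funM (mhit j) (mhit i)).
have pM i u : `|(h u j)%:R * (h u i)%:R : R| <= 1.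
  by case: (h u j); case: (h u i); rewrite ?mulr1 ?mul0r ?mulr0 ?normr0 ?normr1.
have [is1 is2] := Rintegral_bounded_sum mu (index_enum 'I_n) T mp pM.
apply: (@le_trans _ _ (M * \sum_(i | T i) \int[mu]_u ((h u j)%:R * (h u i)%:R))); last first.
  rewrite -2!mulrA; apply: ler_wpM2l => //.
  apply: (@le_trans _ _ (\sum_(i | T i) ((2 * C + 1) * C * (wt n (dotp (x j) (x i)) / n%:R ^+ 2)))).
    apply: ler_sum => i /andP[iA _]; have [xi1 hi li] := hB iA.
    by apply: pair_hit_bound => // y By; apply: dY; exact: hj.
  rewrite -mulr_sumr -mulr_suml mulrA; apply: (@le_trans _ _ ((2 * C + 1) * C * (th * n%:R / n%:R ^+ 2))).
    rewrite -mulrA; apply: ler_wpM2l; first exact: K0.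
    exact: ler_wpM2r.
  rewrite le_eqVlt; apply/orP; left; apply/eqP; field; exact: lt0r_neq0.
rewrite -is2 -RintegralZl//.
apply: le_trans (le_normr_Rintegral _ _) _ => //.
  exact: (bounded_integrable mu mD DM).
apply: le_Rintegral => //.
- apply: (bounded_integrable mu (M := M + M)); first exact: measurableT_comp.
  by move=> u; rewrite normr_id; exact: DM.
- exact: integrable_scale.
- move=> u _; exact: (removal_bound (h u) jA SA jS fM).
Qed.

Lemma step_total : `|\int[mu]_u ((hits A B x u)%:R * f (hits A B x u).-1) - lam * L| <=
  (tau + e) * (lam + (2 * C + 1) * th) + `|L| * ((2 * C + 1) * th)
   + M * ((2 * C + 1) * C) * th + th * (M * C).
Proof.
have -> : \int[mu]_u ((hits A B x u)%:R * f (hits A B x u).-1) = \sum_(j in A) E1 j.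
  have [_ <-] := Rintegral_bounded_sum mu (index_enum 'I_n) (mem A)
    (fun j => mprod j A (fun w => f w.-1)) (fun j u => bprod j A predn u).
  by apply: eq_Rintegral => u _; rewrite -mulr_suml natr_sum.
have sA : \sum_(j in A) E1 j = \sum_(j in J) E1 j + \sum_(j in A :\: J) E1 j.
  rewrite (big_setID J)/=; congr (_ + _).
  by apply: eq_bigl => i; rewrite finset.in_setI; case: (boolP (i \in J)) => [/JinA ->|_]; rewrite ?andbF.
have /andP[z0 z1] := step_outside.
have hP := step_sumP.
have h2 : `|\sum_(j in J) E2 j - L * \sum_(j in J) P j| <= (tau + e) * \sum_(j in J) P j.
  rewrite mulr_sumr -sumrB mulr_sumr; apply: le_trans (ler_norm_sum _ _ _) _.
  by apply: ler_sum => j jJ; exact: step_slice.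
have h1 : `|\sum_(j in J) E1 j - \sum_(j in J) E2 j| <= 1 * (M * ((2 * C + 1) * C) * th).
  rewrite -sumrB; apply: le_trans (ler_norm_sum _ _ _) _.
  apply: sum_const_le; [|by move=> j jJ; exact: step_removal|exact: cardD].
  by apply: mulr_ge0; [apply: mulr_ge0; [exact: M0|exact: K0]|exact: ltW].
rewrite sA; rewrite mul1r in h1.
have hPL : `|L * (\sum_(j in J) P j - lam)| <= `|L| * ((2 * C + 1) * th).
  by rewrite normrM; apply: ler_wpM2l.
have hPt : (tau + e) * \sum_(j in J) P j <= (tau + e) * (lam + (2 * C + 1) * th).
  apply: ler_wpM2l; first by rewrite addr_ge0// ltW.
  by move: hP; rewrite ler_distl => /andP[_].
exact: (step_arith2 z0 z1 h1 h2 hPL hPt).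
Qed.

End Estimates.

Theorem near_count_step :
  near_count a lam (fun w => w%:R * f w.-1) (lam * L) (lam * tau).
Proof.
move=> C eps C0 eps0.
have lam1 : 0 < lam + 1 by exact: ltr_wpDl.
pose e : R := Num.min 1 (eps / (2 * (lam + 1))).
have e0 : 0 < e by rewrite lt_min ltr01 divr_gt0// mulr_gt0.
have C20 : 0 < 2 * C by rewrite mulr_gt0.
(* Slicing doubles the bound on the window lengths; the assumption on [f] is therefore used at
   [2 * C], which is why [near_count] quantifies over [C]. *)
have [eta1 eta10 near1] := nearf C20 e0.
have [th0 th00 sg] := slice_good a lam C0 eta10.
pose Y : R := `|a| + 1; have Y1 : 1 <= Y by rewrite lerDr.
have Y20 : 0 < Y ^+ 2 by rewrite exprn_gt0// (lt_le_trans _ Y1).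
pose K3 : R := (tau + 1) * (2 * C + 1) + `|L| * (2 * C + 1) + M * ((2 * C + 1) * C) + M * C + 1.
have C21 : 0 <= 2 * C + 1 by rewrite addr_ge0// ltW.
have K30 : 0 < K3.
  have t1 : 0 <= (tau + 1) * (2 * C + 1) by apply: mulr_ge0 => //; exact: addr_ge0.
  have t2 : 0 <= `|L| * (2 * C + 1) by exact: mulr_ge0.
  have t3 : 0 <= M * ((2 * C + 1) * C) by apply: mulr_ge0 => //; apply: mulr_ge0 => //; exact: ltW.
  have t4 : 0 <= M * C by apply: mulr_ge0 => //; exact: ltW.
  by rewrite ltr_wpDl// !addr_ge0.
pose th : R := Num.min th0 (eps / (2 * K3)).
have th_gt0 : 0 < th by rewrite lt_min th00 divr_gt0// mulr_gt0.
have th_le0 : th <= th0 by rewrite ge_min lexx.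
have thK : th * K3 <= eps / 2.
  apply: (@le_trans _ _ (eps / (2 * K3) * K3)).
    by apply: ler_wpM2r; [exact: ltW|rewrite ge_min lexx orbT].
  by rewrite invfM mulrA mulfVK// gt_eqF.
have [eta2 /andP[eta20 eta2th] ps] := projection_sparse th_gt0.
have [eta3 eta30 qn] := height_density_near a th_gt0.
have [eta4 eta40 q1] := @height_density_le1 R.
(* In order: the projection lemma, the density near [a], densities at most 1 in dimensions [d] and
   [d - 1] (whence the half), [2 * Y ^+ 2 <= d], windows within 1 of [a], and [d >= 6]. *)
pose eta : R := Num.min (Num.min eta2 eta3) (Num.min (eta4 / 2)
  (Num.min (1 / (2 * Y ^+ 2)) (Num.min 1 (1 / 6)))).
have eta0 : 0 < eta by rewrite !lt_min; do ?[apply/andP; split] => //; rewrite divr_gt0// mulr_gt0.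
have : eta <= eta by [].
rewrite {2}/eta !le_min => /and3P[/andP[l2 l3] l4 /and3P[l5 l6 l7]].
exists eta => // d mu n x A B gd.
have [[mu_unif d1 n1] sp mB hB hl] := gd.
have dbig (b : R) : 0 < b -> eta <= 1 / b -> b <= d%:R.
  move=> b0 hb; have : 1 <= 1 / b * d%:R by apply: (le_trans d1); exact: ler_wpM2r.
  by rewrite mul1r ler_pdivlMl// mulr1.
have d6 : (6 <= d)%N by rewrite -(ler_nat R); exact: dbig.
have [k dk] := ge6_succ d6; clear d6; subst d.
have d2Y : 2 * Y ^+ 2 <= (k.+1.+4)%:R by apply: dbig l5; rewrite mulr_gt0.
have cA : (#|A| <= n)%N by rewrite -[leqRHS](card_ord n); exact: max_card.
have n1' : 1 <= eta2 * n%:R by apply: (le_trans n1); exact: ler_wpM2r.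
have hA : {in A, forall i, dotp (x i) (x i) = 1} by move=> i /hB[].
have [J [S [JA AJ HS]]] := ps _ n A _ n1' cA (gram_like_dotp hA) (sparse_corr_le l2 sp).
have eta_th : eta <= th by exact: le_trans l2 eta2th.
have yY y : `|y - a| <= eta -> `|y| <= Y.
  move=> ya; have := ler_normD (y - a) a; rewrite subrK => h; apply: (le_trans h).
  by rewrite /Y addrC lerD2l; exact: le_trans l6.
have tot := @step_total k n mu x A B C eta th e C0 th_gt0 eta_th e0 gd _ _ _ _ J S JA AJ _ _.
apply: le_trans (tot _ _ _ _ _ _) _.
- move=> y; apply: q1; apply: (le_trans d1); apply: ler_wpM2r => //.
  apply: (le_trans l4); exact: half_le.
- move=> y; apply: q1; apply: (le_trans d1).
  apply: (@le_trans _ _ (eta4 / 2 * (2 * k.+4%:R))).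
    apply: ler_pM => //; [exact: ltW|rewrite -natrM ler_nat; exact: leq_double4].
  by rewrite mulrA mulfVK.
- move=> y ya; apply: qn; last exact: le_trans l3.
  by apply: (le_trans d1); exact: ler_wpM2r.
- move=> y /yY ya; rewrite ler_pdivrMr ?ltr0n//.
  have y2 : y ^+ 2 <= Y ^+ 2.
    rewrite -(real_normK (num_real y)) ler_pXn2r ?nnegrE//; exact: le_trans ya.
  by apply: step_arith4 y2 d2Y _.
- by move=> t tJ; have [[h1 h2 _ _] [h3 _]] := HS t tJ; split.
- move=> j jJ P nu y fr nu_unif By.
  have [[h1 h2 h3 h4] [h5 h6]] := HS j jJ.
  have jA : j \in A by exact: (fintype.subsetP JA).
  exact: near1 (sg eta th eta_th th_le0 k mu n x A B j (S j) P nu y gd jA h1 h3 h4 h6 fr nu_unif By).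
apply: step_arith3 => //.
- by rewrite ge_min lexx.
- apply: (@le_trans _ _ (eps / (2 * (lam + 1)) * (lam + 1))).
    by apply: ler_wpM2r; [exact: ltW|rewrite ge_min lexx orbT].
  by rewrite invfM mulrA mulfVK// gt_eqF.
- exact: ltW.
Qed.

End Step.

(** * Factorial moments and point probabilities *)

Section NearCount.
Context {R : realType}.
Variables (a lam : R).
Implicit Types (f g h : nat -> R) (L tau : R).

Lemma integrable_hits d (mu : probability (borel_rV R d) R) n (x : 'I_n -> 'rV[R]_d) A B f :
  (forall i, measurable (B i)) -> mu.-integrable setT (EFin \o (fun u => f (hits A B x u))).
Proof.
move=> mB; apply: (bounded_integrable mu (M := \sum_(w < n.+1) `|f w|)).
  exact: measurable_hits.
move=> u; have hn : (hits A B x u < n.+1)%N.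
  rewrite ltnS; apply: leq_trans (hits_le _ _ _ _) _.
  by rewrite -[leqRHS](card_ord n); exact: max_card.
by rewrite (bigD1 (Ordinal hn))//= lerDl; apply: sumr_ge0.
Qed.

Lemma near_count_eq f g L tau : f =1 g -> near_count a lam f L tau -> near_count a lam g L tau.
Proof. by move=> fg; have -> : g = f by apply/funext => w; rewrite fg. Qed.

Lemma near_count_scale (c : R) f L tau : near_count a lam f L tau ->
  near_count a lam (fun w => c * f w) (c * L) (`|c| * tau).
Proof.
move=> nf C eps C0 e0; have c1 : 0 < `|c| + 1 by rewrite ltr_wpDl.
have [eta eta0 H] := nf C (eps / (`|c| + 1)) C0 (divr_gt0 e0 c1).
exists eta => // d mu n x A B gd; have [_ _ mB _ _] := gd.
rewrite RintegralZl//; last exact: integrable_hits.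
rewrite -mulrBr normrM; apply: (@le_trans _ _ (`|c| * (tau + eps / (`|c| + 1)))).
  by apply: ler_wpM2l => //; exact: H.
rewrite mulrDr lerD2l mulrCA ger_pMr// ler_pdivrMr// mul1r lerDl; exact: ler01.
Qed.

Lemma near_count_add f g L L' tau tau' : near_count a lam f L tau -> near_count a lam g L' tau' ->
  near_count a lam (fun w => f w + g w) (L + L') (tau + tau').
Proof.
move=> nf ng C eps C0 e0; have e2 : 0 < eps / 2 by rewrite divr_gt0.
have [eta1 eta10 H1] := nf C _ C0 e2; have [eta2 eta20 H2] := ng C _ C0 e2.
exists (Num.min eta1 eta2); first by rewrite lt_min eta10.
move=> d mu n x A B gd; have [_ _ mB _ _] := gd.
have g1 : good a C lam eta1 mu x A B by apply: good_le gd; rewrite ge_min lexx.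
have g2 : good a C lam eta2 mu x A B by apply: good_le gd; rewrite ge_min lexx orbT.
rewrite RintegralD//; [|exact: integrable_hits|exact: integrable_hits].
rewrite opprD addrACA; apply: le_trans (ler_normD _ _) _.
have := H1 _ _ _ _ _ _ g1; have := H2 _ _ _ _ _ _ g2; lra.
Qed.

Lemma near_count_sandwich f g h L L' tau tau' : (forall w, `|f w - g w| <= h w) ->
  near_count a lam g L tau -> near_count a lam h L' tau' ->
  near_count a lam f L (tau + (L' + tau')).
Proof.
move=> fg ng nh C eps C0 e0; have e2 : 0 < eps / 2 by rewrite divr_gt0.
have [eta1 eta10 H1] := ng C _ C0 e2; have [eta2 eta20 H2] := nh C _ C0 e2.
exists (Num.min eta1 eta2); first by rewrite lt_min eta10.
move=> d mu n x A B gd; have [_ _ mB _ _] := gd.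
have g1 : good a C lam eta1 mu x A B by apply: good_le gd; rewrite ge_min lexx.
have g2 : good a C lam eta2 mu x A B by apply: good_le gd; rewrite ge_min lexx orbT.
have If := integrable_hits mu x A f mB.
have Ig := integrable_hits mu x A g mB.
have Ih := integrable_hits mu x A h mB.
have D : `|\int[mu]_u f (hits A B x u) - \int[mu]_u g (hits A B x u)| <= \int[mu]_u h (hits A B x u).
  rewrite -RintegralB//.
  have Ifg := integrable_hits mu x A (fun w => f w - g w) mB.
  apply: le_trans (le_normr_Rintegral _ _) _ => //.
  apply: le_Rintegral => //; exact: (integrable_hits mu x A (fun w => `|f w - g w|) mB).
have := H1 _ _ _ _ _ _ g1; have := H2 _ _ _ _ _ _ g2; move: D.
move: (\int[mu]_u f _) (\int[mu]_u g _) (\int[mu]_u h _) => s1 s2 s3.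
rewrite !ler_norml => /andP[a1 a2] /andP[a3 a4] /andP[a5 a6]; apply/andP; split; lra.
Qed.

Lemma near_count_shift f L L' tau tau' : `|L - L'| + tau <= tau' -> near_count a lam f L tau ->
  near_count a lam f L' tau'.
Proof.
move=> h nf C eps C0 e0; have [eta eta0 H] := nf C eps C0 e0; exists eta => // d mu n x A B gd.
have := H _ _ _ _ _ _ gd; move: (\int[mu]_u f _) => s hs.
have -> : s - L' = (s - L) + (L - L') by ring.
apply: le_trans (ler_normD _ _) _; lra.
Qed.

Lemma near_count_limit f L : (forall tau, 0 < tau -> near_count a lam f L tau) ->
  near_count a lam f L 0.
Proof.
move=> nf C eps C0 e0; have e2 : 0 < eps / 2 by rewrite divr_gt0.
have [eta eta0 H] := nf _ e2 C _ C0 e2; exists eta => // d mu n x A B gd.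
by apply: le_trans (H _ _ _ _ _ _ gd) _; rewrite -splitr add0r.
Qed.

Lemma near_count_one : near_count a lam (fun=> 1) 1 0.
Proof.
move=> C eps C0 e0; exists 1 => // d mu n x A B gd.
by rewrite Rintegral_prob_cst subrr normr0 add0r ltW.
Qed.

Hypothesis lam0 : 0 <= lam.

Lemma near_count_id : near_count a lam (fun w => w%:R) lam 0.
Proof.
have b (w : nat) : 0 <= (1 : R) <= 1 by rewrite ler01 lexx.
have := near_count_step lam0 (lexx 0) (f := fun=> 1) b near_count_one; rewrite mulr1 mulr0.
by apply: near_count_eq => w; rewrite mulr1.
Qed.

(** Markov's inequality: more than [N] hits occur with probability about [lam / N.+1%:R] at most. *)
Lemma near_count_trunc N : near_count a lam (fun w => (w <= N)%:R) 1 (lam / N.+1%:R).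
Proof.
have h w : `|(w <= N)%:R - 1| <= N.+1%:R^-1 * w%:R :> R.
  case: leqP => wN; first by rewrite subrr normr0 mulr_ge0// invr_ge0.
  by rewrite sub0r normrN normr1 ler_pdivlMl ?ltr0n// mulr1 ler_nat.
have := near_count_sandwich h near_count_one (near_count_scale N.+1%:R^-1 near_count_id).
by rewrite mulr0 addr0 add0r mulrC.
Qed.

(** The step shifts the truncation along with the function, from [w <= N + k] to [w <= N + k.+1],
    and multiplies limit and error by [lam]. *)
Lemma near_count_ffact k N : near_count a lam (fun w => (w ^_ k)%:R * (w <= N + k)%:R)
  (lam ^+ k) (lam ^+ k.+1 / N.+1%:R).
Proof.
elim: k => [|k IH].
  rewrite expr0 expr1; apply: near_count_eq (near_count_trunc N) => w.
  by rewrite ffactn0 mul1r addn0.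
have b (w : nat) : 0 <= ((w ^_ k)%:R * (w <= N + k)%N%:R : R) <= (\sum_(v < (N + k).+1) v ^_ k)%N%:R.
  rewrite mulr_ge0//=; case: leqP => wN; last by rewrite mulr0.
  by rewrite mulr1 ler_nat (bigD1 (Ordinal (wN : w < (N + k).+1)%N))//= leq_addr.
have t0 : 0 <= lam ^+ k.+1 / N.+1%:R by rewrite divr_ge0// exprn_ge0.
have := near_count_step lam0 t0 b IH; rewrite -exprS mulrA -exprS.
apply: near_count_eq => w; rewrite ffactnS natrM -mulrA.
by case: w => [|w]; rewrite ?mul0r// addnS ltnS.
Qed.

Lemma alternating_binomial_sum w K :
  \sum_(k < K.+1) (-1) ^+ k * 'C(w.+1, k)%:R = (-1) ^+ K * 'C(w, K)%:R :> R.
Proof.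
elim: K => [|K IH]; first by rewrite big_ord1 !bin0.
by rewrite big_ord_recr/= IH binS natrD exprS; ring.
Qed.

(** The error is the first omitted term. Truncation is harmless: for [w > N] every term vanishes,
    including the indicator of 0. *)
Lemma bonferroni K N w : `|(w == 0%N)%:R - \sum_(k < K.+1) (-1) ^+ k / k`!%:R * ((w ^_ k)%:R * (w <= N)%:R)|
  <= K.+1`!%:R^-1 * ((w ^_ K.+1)%:R * (w <= N)%:R) :> R.
Proof.
have r0 : 0 <= K.+1`!%:R^-1 * ((w ^_ K.+1)%:R * (w <= N)%:R) :> R.
  by rewrite mulr_ge0 ?invr_ge0// mulr_ge0.
have [wN|wN] := leqP w N; last first.
  rewrite big1 => [|k _]; last by rewrite !mulr0.
  have -> : (w == 0%N) = false by rewrite eqn0Ngt (leq_ltn_trans _ wN).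
  by rewrite subrr normr0 !mulr0.
under eq_bigr do rewrite mulr1.
have E k : (-1) ^+ k / k`!%:R * (w ^_ k)%:R = (-1) ^+ k * 'C(w, k)%:R :> R.
  by rewrite -bin_ffact natrM; field; rewrite pnatr_eq0 -lt0n fact_gt0.
under eq_bigr do rewrite E.
have -> : K.+1`!%:R^-1 * ((w ^_ K.+1)%:R * 1) = 'C(w, K.+1)%:R :> R.
  by rewrite mulr1 -bin_ffact natrM; field; rewrite pnatr_eq0 -lt0n fact_gt0.
case: w {wN r0 E} => [|w].
  rewrite big_ord_recl big1 => [|k _]; last by rewrite bin_small// mulr0.
  by rewrite expr0 mul1r bin0 addr0 subrr normr0.
rewrite alternating_binomial_sum sub0r normrN normrM normrX normrN1 expr1n mul1r ger0_norm//.
by rewrite ler_nat binS leq_addl.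
Qed.

Lemma near_count_big (c L t : nat -> R) (G : nat -> nat -> R) (K : nat) :
  (forall k, (k < K)%N -> near_count a lam (G k) (L k) (t k)) ->
  near_count a lam (fun w => \sum_(k < K) c k * G k w) (\sum_(k < K) c k * L k)
    (\sum_(k < K) `|c k| * t k).
Proof.
elim: K => [|K IH] H.
  rewrite !big_ord0; have := near_count_scale 0 near_count_one; rewrite mul0r mulr0.
  by apply: near_count_eq => w; rewrite big_ord0.
rewrite !big_ord_recr/=; have IH' := IH (fun k kK => H k (ltnW kK)).
have := near_count_add IH' (near_count_scale (c K) (H K (ltnSn K))).
by apply: near_count_eq => w; rewrite big_ord_recr.
Qed.

Lemma near_count_zero : near_count a lam (fun w => (w == 0%N)%:R) (expR (- lam)) 0.
Proof.
apply: near_count_limit => tau tau0; have tau4 : 0 < tau / 4 by rewrite divr_gt0.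
pose c (k : nat) : R := (-1) ^+ k / k`!%:R.
have c1 : series (exp_coeff (- lam)) @ \oo --> expR (- lam) := is_cvg_series_exp_coeff (- lam).
have /cvgrPdist_le/(_ _ tau4)[N1 _ H1] := c1.
have /cvgrPdist_le/(_ _ tau4)[N2 _ H2] := @cvg_exp_coeff R lam.
(* Past [K] both the partial sum of [exp (- lam)] and the first omitted moment are within [tau / 4]
   of their limits; the other [tau / 2] is left to truncation. *)
pose K := maxn N1 N2.
have hK1 : `|\sum_(k < K.+1) c k * lam ^+ k - expR (- lam)| <= tau / 4.
  have := H1 K.+1; rewrite /= leqW ?leq_maxl// => /(_ isT); rewrite distrC.
  congr (`|_ - _| <= _); rewrite /series/= big_mkord; apply: eq_bigr => k _.
  by rewrite /exp_coeff/= /c [in LHS]exprNn mulrAC.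
have hK2 : K.+1`!%:R^-1 * lam ^+ K.+1 <= tau / 4.
  have := H2 K.+1; rewrite /= leqW ?leq_maxr// => /(_ isT).
  rewrite sub0r normrN ger0_norm ?divr_ge0 ?exprn_ge0//.
  by rewrite /exp_coeff/= mulrC.
(* [Mx / N0.+1%:R] is the sum of the truncation errors of the [K.+2] moments involved, and [N0]
   makes it at most [tau / 2]. *)
pose Mx : R := \sum_(k < K.+2) k`!%:R^-1 * lam ^+ k.+1.
have Mx0 : 0 <= Mx by apply: sumr_ge0 => k _; rewrite mulr_ge0 ?invr_ge0 ?exprn_ge0.
pose N0 := Num.bound (2 * Mx / tau).
pose t (k : nat) : R := lam ^+ k.+1 / N0.+1%:R.
pose G (k w : nat) : R := (w ^_ k)%:R * (w <= N0 + K.+1)%N%:R.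
(* Bonferroni needs a common truncation [N0 + K.+1] for all moments; for the [k]-th one this is
   [near_count_ffact] at [N0 + (K.+1 - k)], whose error is at most [t k]. *)
have HG k : (k < K.+2)%N -> near_count a lam (G k) (lam ^+ k) (t k).
  rewrite ltnS => kK; have := near_count_ffact k (N0 + (K.+1 - k)).
  rewrite -addnA subnK//; apply: near_count_shift; rewrite subrr normr0 add0r.
  apply: ler_wpM2l; first exact: exprn_ge0.
  by rewrite lef_pV2 ?posrE ?ltr0n// ler_nat ltnS leq_addr.
have S1 := near_count_big c (fun k kK => HG k (ltnW kK)).
have S2 := near_count_scale K.+1`!%:R^-1 (HG K.+1 (ltnSn _)).
apply: near_count_shift (near_count_sandwich (bonferroni K (N0 + K.+1)) S1 S2).
have cn k : `|c k| = k`!%:R^-1 by rewrite normrM normrX normrN1 expr1n mul1r ger0_norm// invr_ge0.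
have -> : `| K.+1`!%:R^-1 | = K.+1`!%:R^-1 :> R by rewrite ger0_norm// invr_ge0.
have hM : \sum_(k < K.+1) `|c k| * t k + K.+1`!%:R^-1 * t K.+1 <= tau / 2.
  apply: (@le_trans _ _ (Mx / N0.+1%:R)).
    rewrite /Mx mulr_suml [leRHS]big_ord_recr/= le_eqVlt; apply/orP; left; apply/eqP.
    by congr (_ + _); [apply: eq_bigr => k _; rewrite cn /t mulrA|rewrite /t mulrA].
  rewrite ler_pdivrMr ?ltr0n// -ler_pdivrMl ?divr_gt0//.
  have := archi_boundP (_ : 0 <= 2 * Mx / tau); rewrite divr_ge0 ?mulr_ge0 ?(ltW tau0)// => /(_ isT).
  rewrite -/N0 => h; have : N0%:R <= N0.+1%:R :> R by rewrite ler_nat.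
  rewrite invf_div mulrAC; lra.
move: hK1 hK2 hM; set s1 := \sum_(k < K.+1) c k * _; set s2 := \sum_(k < K.+1) _.
set s3 := _^-1 * lam ^+ _; set s4 := _^-1 * t _; lra.
Qed.

(** The induction carries the factor [w ^_ k], equal to [k!] where [w = k], because the step maps
    the function for [k] exactly to the one for [k.+1]. *)
Lemma near_count_point k : near_count a lam (fun w => (w == k)%:R) (expR (- lam) * lam ^+ k / k`!%:R) 0.
Proof.
suff H : near_count a lam (fun w => (w ^_ k)%:R * (w == k)%:R) (lam ^+ k * expR (- lam)) 0.
  have := near_count_scale k`!%:R^-1 H; rewrite mulr0 mulrC [_ * expR _]mulrC.
  apply: near_count_eq => w; have [->|wk] := eqVneq w k; last by rewrite !mulr0.
  by rewrite mulr1 ffactnn mulVf// pnatr_eq0 -lt0n fact_gt0.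
elim: k => [|k IH].
  rewrite expr0 mul1r; apply: near_count_eq near_count_zero => w.
  by rewrite ffactn0 mul1r.
have b (w : nat) : 0 <= ((w ^_ k)%:R * (w == k)%:R : R) <= k`!%:R.
  rewrite mulr_ge0//=; have [->|wk] := eqVneq w k; last by rewrite mulr0.
  by rewrite mulr1 ffactnn.
have := near_count_step lam0 (lexx 0) b IH; rewrite mulr0 mulrA -exprS.
apply: near_count_eq => w; rewrite ffactnS natrM -mulrA.
by case: w => [|w]; rewrite ?mul0r.
Qed.

End NearCount.

(** * The effect of discarding a few points *)

Section FewRemovedPoints.
Context {R : realType}.
Local Notation leb := (@lebesgue_measure R).

Lemma hits_restrict d n (A : {set 'I_n}) (B : 'I_n -> set R) (x : 'I_n -> 'rV[R]_d) u k :
  `|(hits [set: 'I_n] B x u == k)%:R - (hits A B x u == k)%:R| <=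
    \sum_(j in (~: A)%SET) (hit (B j) (x j) u)%:R :> R.
Proof.
have hE : hits [set: 'I_n] B x u =
    (hits A B x u + \sum_(j in (~: A)%SET) hit (B j) (x j) u)%N.
  rewrite /hits (bigID (mem A))/=; congr (_ + _)%N; apply: eq_bigl => j.
    by rewrite finset.in_setT.
  by rewrite finset.in_setT finset.in_setC.
rewrite -natr_sum hE; move: (hits A B x u) (\sum_(j in _) _)%N => p [|q].
  by rewrite addn0 subrr normr0.
apply: (@le_trans _ _ 1); last by rewrite ler1n.
by case: eqP => _; case: eqP => _; rewrite ?subrr ?subr0 ?sub0r ?normrN ?normr0 ?normr1.
Qed.

Lemma hits_restrict_Rintegral d n (mu : probability (borel_rV R d) R) (A : {set 'I_n})
    (B : 'I_n -> set R) (x : 'I_n -> 'rV[R]_d) k (c : R) : (6 <= d)%N ->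
  (forall y : R, height_density d y <= 1) ->
  uniform_on_sphere mu -> (forall j, dotp (x j) (x j) = 1) ->
  (forall j, measurable (B j)) -> (forall j, (leb (B j) <= c%:E)%E) ->
  `|\int[mu]_u (hits [set: 'I_n] B x u == k)%:R - \int[mu]_u (hits A B x u == k)%:R|
    <= #|(~: A)%SET|%:R * c.
Proof.
move=> d6 q1 mu_unif x1 mB lB.
have [p dE] := ge6_succ d6; subst d.
have ih C : mu.-integrable setT (EFin \o (fun u => (hits C B x u == k)%:R)).
  exact: (integrable_hits mu x C (fun w => (w == k)%:R) mB).
have ihB : mu.-integrable setT (EFin \o (fun u =>
    (hits [set: 'I_n] B x u == k)%:R - (hits A B x u == k)%:R)).
  exact: (integrableB measurableT (ih _) (ih _)).
rewrite -RintegralB//.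
have mh j : measurable_fun setT (fun u : borel_rV R p.+1.+4 => (hit (B j) (x j) u)%:R : R).
  by apply: measurable_boolr; exact: measurable_hit.
have bh j (u : borel_rV R p.+1.+4) : `|(hit (B j) (x j) u)%:R| <= (1 : R).
  by rewrite ger0_norm// lern1 leq_b1.
have [is1 Es] := @Rintegral_bounded_sum _ (borel_rV R p.+1.+4) R mu 'I_n (index_enum 'I_n)
   (fun j => j \in (~: A)%SET) _ 1 mh bh.
apply: (@le_trans _ _ (\int[mu]_u (\sum_(j in (~: A)%SET) (hit (B j) (x j) u)%:R))).
  apply: le_trans (le_normr_Rintegral _ _) _ => //.
  apply: le_Rintegral => //.
    by have /integrable_norm := ihB; apply.
  by move=> u _; exact: hits_restrict.
rewrite Es mulr_natl -sumr_const; apply: ler_sum => j _.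
rewrite (Rintegral_hit mu_unif (x1 j) (mB j)) -lee_fin -height_measure_fin//.
by apply: le_trans (lB j); exact: height_measure_le_leb.
Qed.

End FewRemovedPoints.

(** * From the correlation hypothesis to a good configuration *)

Section FiniteConfiguration.
Context {R : realType}.
Local Notation leb := (@lebesgue_measure R).

(** Since [c ^+ 2 <= |c|], weights with [1 - c^2] are dominated by those with [1 - |c|]. *)
Lemma wt_le_pair_weight N (c : R) : (0 < N)%N -> `|c| <= 1 -> wt N c <= pair_weight N c.
Proof.
move=> N0 c1; rewrite /pair_weight; case: eqP => [_|/eqP cn1]; first exact: wt_le_nat.
have NR : 0 < N%:R :> R by rewrite ltr0n.
have c0 : 0 < 1 - `|c| by rewrite subr_gt0 lt_neqAle cn1.
have s0 : 0 < Num.sqrt (1 - `|c|) by rewrite sqrtr_gt0.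
rewrite le_min wt_le_nat// andbT lef_pV2 ?posrE//; last by rewrite lt_max invr_gt0 NR orbT.
rewrite le_max ler_wsqrtr// lerD2l lerN2 -(real_normK (num_real c)) expr2.
by rewrite -[leRHS]mulr1; apply: ler_wpM2l.
Qed.

(** The heights [y] with [n (y - a)] in [I], written in the affine form of [lebesgue_affine]. *)
Definition zoom (a : R) (n : nat) (I : set R) : set R :=
  (fun y : R => - (n%:R * a) + n%:R * y) @^-1` I.

Lemma sum_degree_le d n (x : 'I_n -> 'rV[R]_d) (eta : R) : (0 < n)%N ->
  (forall j, dotp (x j) (x j) = 1) ->
  \sum_(i < n) \sum_(j < n | (i != j) && (eta <= `|dotp (x i) (x j)|)) wt n (dotp (x i) (x j))
    <= 2 * correlation_sum x eta.
Proof.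
move=> n0 x1; pose c i j := dotp (x i) (x j).
have c1 i j : `|c i j| <= 1.
  by rewrite -(@ler_pXn2r _ 2%N) ?nnegrE// real_normK ?num_real// expr1n; exact: dotp_sqr_le1.
pose F i j := if eta <= `|c i j| then wt n (c i j) else 0.
have up : \sum_(i < n) \sum_(j < n | (i < j)%N) F i j <= correlation_sum x eta.
  apply: ler_sum => i _; rewrite [leRHS]big_mkcondr; apply: ler_sum => j _.
  by rewrite /F; case: ifP => // _; apply: wt_le_pair_weight.
have -> : \sum_(i < n) \sum_(j < n | (i != j) && (eta <= `|c i j|)) wt n (c i j) =
    \sum_(i < n) \sum_(j < n | (i < j)%N) F i j + \sum_(i < n) \sum_(j < n | (j < i)%N) F i j.
  rewrite -big_split; apply: eq_bigr => i _ /=; rewrite big_mkcondr.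
  rewrite (bigID (fun j : 'I_n => (i < j)%N))/=; congr (_ + _).
    apply: eq_bigl => j; case: (ltnP i j) => ij; rewrite ?andbF// andbT.
    by rewrite neq_ltn ij.
  apply: eq_bigl => j; rewrite -leqNgt ltn_neqAle eq_sym; congr (_ && _).
rewrite [X in _ + X <= _](exchange_big_dep xpredT)//= mulr_natl mulr2n; apply: lerD => //.
apply: le_trans up; rewrite le_eqVlt; apply/orP; left; apply/eqP.
by apply: eq_bigr => i _; apply: eq_bigr => j _; rewrite /F /c dotpC.
Qed.

Variables (a : R) (I : set R) (r : R).
Hypotheses (mI : measurable I) (Ir : forall y, I y -> `|y| <= r).
Local Notation mes := (fine (leb I)).

Let lI : leb I = mes%:E.
Proof.
rewrite fineK// ge0_fin_numE//; apply: (@le_lt_trans _ _ (leb `[- r, r]%classic)).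
  apply: le_measure; [exact/mem_set|by apply/mem_set; exact: measurable_itv|].
  by move=> y /Ir; rewrite /= in_itv/= ler_norml.
by rewrite lebesgue_measure_itv/=; case: ifPn => // _; rewrite -EFinB ltry.
Qed.

Let mes0 : 0 <= mes. Proof. exact: fine_ge0. Qed.

Lemma lebesgue_zoom n : (0 < n)%N -> leb (zoom a n I) = (mes / n%:R)%:E.
Proof.
by move=> n0; rewrite lebesgue_affine ?ltr0n// [X in (_ * X)%E]lI -EFinM mulrC.
Qed.

(** The correlation sum enters at the single threshold [eta] attached to [k] and [eps]. It controls
    degrees only on average, so the points of large degree are discarded first. *)
Lemma point_probability k (eps : R) : 0 < eps -> exists2 eta : R, 0 < eta &
  exists2 delta : R, 0 < delta &
  forall d n (x : 'I_n -> 'rV[R]_d) (mu : probability (borel_rV R d) R),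
    uniform_on_sphere mu -> (forall j, dotp (x j) (x j) = 1) ->
    1 <= delta * d%:R -> 1 <= delta * n%:R ->
    correlation_sum x eta <= delta * n%:R ^+ 2 ->
    `|\int[mu]_u (hits [set: 'I_n] (fun=> zoom a n I) x u == k)%:R -
      expR (- (phi a * mes)) * (phi a * mes) ^+ k / k`!%:R| <= eps.
Proof.
move=> eps0; have e2 : 0 < eps / 2 by rewrite divr_gt0.
have lam0 : 0 <= phi a * mes by rewrite mulr_ge0// ltW// phi_gt0.
have C0 : 0 < mes + 1 by rewrite ltr_wpDl.
have [eta eta0 H] := near_count_point a lam0 k C0 e2.
have [eta4 eta40 q1] := @height_density_le1 R.
exists eta => //.
have r0 : 0 < `|r| + 1 by rewrite ltr_wpDl.
(* Among the demands on [delta]: [eta / (|r| + 1)] puts the windows within [eta] of [a], and the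
   last two entries make the length lost with the discarded points cost at most [eta], and their
   hits at most [eps / 2]. *)
pose delta : R := Num.min (Num.min eta (eta / (`|r| + 1))) (Num.min (Num.min eta4 (1 / 6))
  (Num.min (eta / 2 * (eta / (mes + 1))) (eta / 2 * (eps / 2 / (mes + 1))))).
have delta0 : 0 < delta.
  have p1 : 0 < eta / (`|r| + 1) by exact: divr_gt0.
  have p2 : 0 < eta / (mes + 1) by exact: divr_gt0.
  have p3 : 0 < eps / 2 / (mes + 1) by exact: divr_gt0.
  have p4 : 0 < eta / 2 by exact: divr_gt0.
  by rewrite !lt_min eta0 p1 eta40 divr_gt0 ?(mulr_gt0 p4)//=.
have : delta <= delta by [].
rewrite {2}/delta !le_min => /andP[/andP[l1 l2] /andP[/andP[l3 l4] /andP[l5 l6]]].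
exists delta => // d n x mu mu_unif x1 d1 n1 corr.
have n0 : (0 < n)%N by rewrite lt0n; apply/eqP => n0; move: n1; rewrite n0 mulr0 ler10.
have nR : 0 < n%:R :> R by rewrite ltr0n.
have d6 : (6 <= d)%N.
  rewrite -(ler_nat R); have : 1 <= 1 / 6 * d%:R :> R by apply: (le_trans d1); exact: ler_wpM2r.
  by rewrite mul1r ler_pdivlMl// mulr1.
pose c i j := dotp (x i) (x j).
pose D i := \sum_(j | (i != j) && (eta <= `|c i j|)) wt n (c i j).
have D0 i : 0 <= D i by apply: sumr_ge0 => j _; exact: wt_ge0.
(* By Markov's inequality for the degrees, at most [2 * delta / eta * n] points lie outside [A]. *)
pose A := [set i | D i <= eta * n%:R]%SET.
have cardA : #|~: A|%:R <= 2 * delta / eta * n%:R :> R.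
  have en : 0 < eta * n%:R by rewrite mulr_gt0.
  rewrite -(ler_pM2r en); apply: (@le_trans _ _ (2 * (delta * n%:R ^+ 2))); last first.
    rewrite le_eqVlt; apply/orP; left; apply/eqP; rewrite expr2; field; exact: lt0r_neq0.
  apply: le_trans (_ : 2 * correlation_sum x eta <= _); last by rewrite ler_pM2l.
  apply: le_trans (sum_degree_le eta n0 x1).
  rewrite mulr_natl -sumr_const [leRHS](bigID (mem (~: A)%SET))/= -[leLHS]addr0.
  apply: lerD; last by apply: sumr_ge0 => i _; exact: D0.
  apply: ler_sum => i; rewrite finset.in_setC finset.in_set -ltNge => /ltW; exact.
have mz : measurable (zoom a n I) by exact: measurable_affine.
have gd : good a (mes + 1) (phi a * mes) eta mu x A (fun=> zoom a n I).
  split.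
  - by split=> //; [apply: (le_trans d1)|apply: (le_trans n1)]; exact: ler_wpM2r.
  - move=> i; rewrite finset.in_set => Di; apply: le_trans Di.
    rewrite /D [leRHS](bigID (mem A))/= -[leLHS]addr0; apply: lerD.
      rewrite le_eqVlt; apply/orP; left; apply/eqP; apply: eq_bigl => j.
      by rewrite andbC.
    by apply: sumr_ge0 => j _; exact: wt_ge0.
  - by [].
  - move=> i _; split=> //.
      move=> y /Ir; have -> : - (n%:R * a) + n%:R * y = n%:R * (y - a) by ring.
      rewrite normrM ger0_norm// => h.
      have h2 : `|y - a| * 1 <= `|y - a| * (eta / (`|r| + 1) * n%:R).
        by apply: ler_wpM2l => //; apply: (le_trans n1); exact: ler_wpM2r.
      rewrite mulr1 in h2; apply: (le_trans h2).
      have -> : `|y - a| * (eta / (`|r| + 1) * n%:R) = (n%:R * `|y - a|) * (eta / (`|r| + 1)) by ring.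
      rewrite mulrA ler_pdivrMr// mulrC ler_pM2l//.
      by apply: (le_trans h); apply: (le_trans (ler_norm r)); rewrite lerDl.
    by rewrite lebesgue_zoom// lee_fin ler_pM2r ?invr_gt0// lerDl.
  - rewrite lebesgue_zoom//= sumr_const -[_ *+ #|_|]mulr_natr.
    have cc : #|A|%:R = n%:R - #|~: A|%:R :> R.
      have : (#|A| + #|~: A|)%:R = n%:R :> R by rewrite cardsC card_ord.
      by rewrite natrD => <-; rewrite addrK.
    have -> : phi a * (mes / n%:R * #|A|%:R) - phi a * mes = - (phi a * mes * (#|~: A|%:R / n%:R)).
      by rewrite cc; field; exact: lt0r_neq0.
    rewrite normrN ger0_norm; last by rewrite mulr_ge0// divr_ge0.
    apply: (@le_trans _ _ (1 * (mes + 1) * (2 * delta / eta))).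
      have v0 : 0 <= #|~: A|%:R / n%:R :> R by rewrite divr_ge0.
      have v1 : #|~: A|%:R / n%:R <= 2 * delta / eta :> R by rewrite ler_pdivrMr.
      have v2 : phi a * mes <= 1 * (mes + 1).
        by apply: ler_pM => //; [apply: ltW; exact: phi_gt0|exact: phi_le1|rewrite lerDl].
      exact: ler_pM.
    rewrite mul1r; apply: (@le_trans _ _ ((mes + 1) * (2 * (eta / 2 * (eta / (mes + 1))) / eta))).
      by apply: ler_wpM2l; [exact: ltW|apply: ler_wpM2r; [rewrite invr_ge0 ltW|rewrite ler_pM2l]].
    by rewrite le_eqVlt; apply/orP; left; apply/eqP; field; apply/andP; split; exact: lt0r_neq0.
have h1 := H _ _ _ _ _ _ gd; rewrite add0r in h1.
pose hA u := hits A (fun=> zoom a n I) x u; pose hT u := hits [set: 'I_n] (fun=> zoom a n I) x u.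
have dif : `|\int[mu]_u (hT u == k)%:R - \int[mu]_u (hA u == k)%:R| <= eps / 2.
  have zj (j : 'I_n) : (leb (zoom a n I) <= (mes / n%:R)%:E)%E by rewrite lebesgue_zoom.
  have q0 (y : R) : height_density d y <= 1.
    by apply: q1; apply: (le_trans d1); apply: ler_wpM2r.
  apply: le_trans (hits_restrict_Rintegral A k d6 q0 mu_unif x1 (fun=> mz) zj) _.
  apply: (@le_trans _ _ (2 * delta / eta * n%:R * (mes / n%:R))).
    by apply: ler_wpM2r => //; exact: divr_ge0.
  apply: (@le_trans _ _ (2 * (eta / 2 * (eps / 2 / (mes + 1))) / eta * (mes + 1))).
    have -> : 2 * delta / eta * n%:R * (mes / n%:R) = 2 * delta / eta * mes.
      by field; apply/andP; split; exact: lt0r_neq0.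
    apply: ler_pM => //; last by rewrite lerDl.
      by rewrite divr_ge0// ltW// mulr_gt0.
    by apply: ler_wpM2r; [rewrite invr_ge0 ltW|rewrite ler_pM2l].
  by rewrite le_eqVlt; apply/orP; left; apply/eqP; field; apply/andP; split; exact: lt0r_neq0.
rewrite -/hA in h1; rewrite -/hT.
move: h1 dif; move: (\int[mu]_u _) (\int[mu]_u _) => s1 s2 h1 h2.
by apply: (le_trans (ler_distD s2 _ _)); rewrite [leRHS]splitr; exact: lerD.
Qed.

End FiniteConfiguration.

(** * Convergence in distribution *)

Section CountableSupport.
Context {R : realType}.

Section OneLaw.
Context disp (T : measurableType disp) (P : probability T R) (N : T -> nat).
Hypothesis mN : forall f : nat -> R, measurable_fun setT (fun w => f (N w)).

(** Cutting the values at [K] costs at most [M] times the probability of the tail, here written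
    through point probabilities alone. *)
Lemma Rintegral_nat_le (f : nat -> R) (M : R) K : (forall k, `|f k| <= M) ->
  `|\int[P]_w f (N w) - \sum_(k < K) f k * \int[P]_w (N w == k)%:R|
    <= M * (1 - \sum_(k < K) \int[P]_w (N w == k)%:R).
Proof.
move=> fM; have M0 : 0 <= M by apply: le_trans (fM 0%N).
have m1 (k : 'I_K) : measurable_fun setT (fun w => (N w == k)%:R : R).
  exact: (mN (fun w => (w == k)%:R)).
have m2 (k : 'I_K) : measurable_fun setT (fun w => f k * (N w == k)%:R).
  exact: (mN (fun w => f k * (w == k)%:R)).
have b1 (k : 'I_K) w : `|(N w == k)%:R| <= (1 : R) by rewrite ger0_norm// lern1 leq_b1.
have b2 (k : 'I_K) w : `|f k * (N w == k)%:R| <= M.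
  by rewrite normrM -[leRHS]mulr1; apply: ler_pM.
have [_ E1] := Rintegral_bounded_sum P (index_enum 'I_K) xpredT m1 b1.
have [_ E2] := Rintegral_bounded_sum P (index_enum 'I_K) xpredT m2 b2.
have pw w : `|f (N w) - \sum_(k < K) f k * (N w == k)%:R| = `|f (N w)| * (K <= N w)%:R
  /\ \sum_(k < K) (N w == k)%:R = (N w < K)%N%:R :> R.
  have [NK|KN] := ltnP (N w) K.
    rewrite (bigD1 (Ordinal NK))//= big1 => [|k /eqP kN]; last first.
      by case: eqP => [e|_]; rewrite ?mulr0//; case: kN; apply/val_inj.
    rewrite eqxx mulr1 addr0 subrr normr0 mulr0; split => //.
    rewrite (bigD1 (Ordinal NK))//= big1 => [|k /eqP kN]; rewrite ?eqxx ?addr0//.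
    by case: eqP => [e|_] //; case: kN; apply/val_inj.
  have z (k : 'I_K) : (N w == k) = false.
    by apply/negbTE; rewrite neq_ltn (leq_trans (ltn_ord k) KN) orbT.
  rewrite big1 => [|k _]; last by rewrite z mulr0.
  by rewrite subr0 mulr1; split=> //; rewrite big1// => k _; rewrite z.
have ifN (g : nat -> R) C : (forall k, `|g k| <= C) -> P.-integrable setT (EFin \o (fun w => g (N w))).
  by move=> gC; apply: (bounded_integrable P (M := C)).
pose s1 (w : nat) : R := \sum_(k < K) (w == k)%:R; pose s2 (w : nat) : R := \sum_(k < K) f k * (w == k)%:R.
have is1 : P.-integrable setT (EFin \o (fun w => s1 (N w))).
  by apply: (bounded_integrable P (M := 1)) => // w; rewrite /s1 (pw w).2 ger0_norm// lern1 leq_b1.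
have is2 : P.-integrable setT (EFin \o (fun w => f (N w) - s2 (N w))).
  apply: (bounded_integrable P (M := M)); first exact: (mN (fun w => f w - s2 w)).
  by move=> w; rewrite /s2 (pw w).1 -[leRHS]mulr1; apply: ler_pM => //; rewrite lern1 leq_b1.
have isb : P.-integrable setT (EFin \o (fun w => s2 (N w))).
  have [h _] := Rintegral_bounded_sum P (index_enum 'I_K) xpredT m2 b2; exact: h.
have -> : \sum_(k < K) f k * \int[P]_w (N w == k)%:R = \int[P]_w s2 (N w).
  by rewrite E2; apply: eq_bigr => k _; rewrite RintegralZl//; apply: (ifN (fun w => (w == k)%:R) 1) => w;
    rewrite ger0_norm// lern1 leq_b1.
rewrite -E1 -RintegralB//; last exact: ifN fM.
apply: le_trans (le_normr_Rintegral _ _) _ => //.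
rewrite -[X in _ * (X - _)](Rintegral_prob_cst P 1) -RintegralB//; last first.
  by apply: (bounded_integrable P (M := 1)) => // w; rewrite normr1.
have i1 : P.-integrable setT (EFin \o (fun w => 1 - s1 (N w))).
  apply: (bounded_integrable P (M := 1)); first exact: (mN (fun w => 1 - s1 w)).
  by move=> w; rewrite /s1 (pw w).2; case: ltnP => _; rewrite ?subrr ?subr0 ?normr0 ?normr1.
rewrite -RintegralZl//; apply: le_Rintegral => //.
- by have /integrable_norm := is2; apply.
- apply: (bounded_integrable P (M := M)); first exact: (mN (fun w => M * (1 - s1 w))).
  move=> w; rewrite /s1 (pw w).2; case: ltnP => _;
    by rewrite ?subrr ?subr0 ?mulr0 ?mulr1 ?normr0// ger0_norm.
move=> w _; rewrite /s1 /s2 (pw w).1 (pw w).2; case: ltnP => _.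
  by rewrite subrr !mulr0.
by rewrite subr0 !mulr1.
Qed.

End OneLaw.

(** No mass escapes, because the limiting point probabilities add up to 1: finitely many values
    carry nearly all the mass of the limit, hence nearly all the mass of [N m] for large [m]. *)
Lemma cvg_Rintegral_nat (disp : nat -> measure_display) (T : forall m, measurableType (disp m))
    (P : forall m, probability (T m) R) (N : forall m, T m -> nat)
    disp' (S : measurableType disp') (Q : probability S R) (Z : S -> nat) (p f : nat -> R) (M : R) :
  (forall m (g : nat -> R), measurable_fun setT (fun w => g (N m w))) ->
  (forall g : nat -> R, measurable_fun setT (fun w => g (Z w))) ->
  (forall k, \int[P m]_w (N m w == k)%:R @[m --> \oo] --> p k) ->
  (forall k, \int[Q]_w (Z w == k)%:R = p k) ->
  series p @ \oo --> (1 : R) -> (forall k, `|f k| <= M) ->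
  \int[P m]_w f (N m w) @[m --> \oo] --> \int[Q]_w f (Z w).
Proof.
move=> mN mZ Np Zp p1 fM; have M0 : 0 <= M by apply: le_trans (fM 0%N).
have M1 : 0 < M + 1 by rewrite ltr_wpDl.
apply/cvgrPdist_le => eps eps0; pose e := eps / (4 * (M + 1)).
have e0 : 0 < e by rewrite divr_gt0// mulr_gt0.
have Me : M * e <= eps / 4.
  have -> : eps / 4 = (M + 1) * e by rewrite /e; field; exact: lt0r_neq0.
  by apply: ler_wpM2r; [exact: ltW|rewrite lerDl].
have /cvgrPdist_le/(_ _ e0)[K _ HK] := p1.
have {}HK : `|1 - \sum_(k < K) p k| <= e.
  by have := HK K (leqnn K); rewrite /series/= big_mkord.
have c1 : (fun m => \sum_(k < K) \int[P m]_w (N m w == k)%:R) @ \oo --> \sum_(k < K) p k.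
  by apply: cvg_big => [|k _]; [exact: add_continuous|exact: Np].
have c2 : (fun m => \sum_(k < K) f k * \int[P m]_w (N m w == k)%:R) @ \oo --> \sum_(k < K) f k * p k.
  by apply: cvg_big => [|k _]; [exact: add_continuous|apply: cvgMr; exact: Np].
have e4 : 0 < eps / 4 by rewrite divr_gt0.
have /cvgrPdist_le/(_ _ e0) h1 := c1; have /cvgrPdist_le/(_ _ e4) h2 := c2.
near=> m.
have h1m : `|\sum_(k < K) p k - \sum_(k < K) \int[P m]_w (N m w == k)%:R| <= e by near: m; exact: h1.
have h2m : `|\sum_(k < K) f k * p k - \sum_(k < K) f k * \int[P m]_w (N m w == k)%:R| <= eps / 4.
  by near: m; exact: h2.
have g1 := Rintegral_nat_le (P m) (mN m) K fM.
have := Rintegral_nat_le Q mZ K fM.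
under eq_bigr do rewrite Zp; under [X in 1 - X]eq_bigr do rewrite Zp.
move: HK h1m h2m g1; set s := \sum_(k < K) p k; set t := \sum_(k < K) \int[_]_w _.
set F := \sum_(k < K) f k * p k; set G := \sum_(k < K) f k * _.
move=> HK hs hF g1 g2.
have k1 : M * (1 - s) <= eps / 4.
  by apply: le_trans Me; apply: ler_wpM2l => //; exact: le_trans (ler_norm _) HK.
have k2 : M * (s - t) <= eps / 4.
  by apply: le_trans Me; apply: ler_wpM2l => //; exact: le_trans (ler_norm _) hs.
have k3 : M * (1 - t) <= eps / 2.
  have -> : M * (1 - t) = M * (1 - s) + M * (s - t) by ring.
  lra.
have := le_trans g1 k3; have := le_trans g2 k1; move: hF.
rewrite !ler_norml; lra.
Unshelve. all: by end_near. Qed.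

End CountableSupport.

Section PoissonLaw.
Context {R : realType}.
Variable lam : R.
Hypothesis lam0 : 0 <= lam.

Lemma Rintegral_poisson_point k :
  \int[poisson_prob lam 0%N]_w ((w : nat) == k)%:R = expR (- lam) * lam ^+ k / k`!%:R.
Proof.
have mk : measurable [set k] by [].
rewrite /Rintegral (_ : (fun w : nat => _) = (fun w : nat => (\1_[set k] w)%:E)); last first.
  by apply/funext => w; rewrite indicE in_set1.
rewrite integral_indic// setIT.
suff E : poisson_prob lam 0%N [set k] = (expR (- lam) * lam ^+ k / k`!%:R)%:E :> \bar R.
  exact: (congr1 fine E).
rewrite /poisson_prob; case: ltP => [lp|ln].
  by rewrite esum_set1 ?lee_fin ?poisson_pmf_ge0//= /poisson_pmf lp [in LHS]mulrC mulrA.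
(* At [lam = 0] the law is the point mass at 0, in agreement with the formula because
   [0 ^+ 0 = 1]. *)
have -> : lam = 0 by apply/eqP; rewrite eq_le ln.
rewrite diracE oppr0 expR0 mul1r; case: k mk => [|k] mk.
  by rewrite mem_set// expr0 fact0 divr1.
by rewrite memNset// expr0n mul0r.
Qed.

Lemma series_poisson : series (fun k => expR (- lam) * lam ^+ k / k`!%:R) @ \oo --> (1 : R).
Proof.
have c1 : series (exp_coeff lam) @ \oo --> expR lam := is_cvg_series_exp_coeff lam.
have -> : series (fun k => expR (- lam) * lam ^+ k / k`!%:R) =
    (fun n => expR (- lam) * series (exp_coeff lam) n).
  by apply/funext => n; rewrite /series/= mulr_sumr; apply: eq_bigr => k _; rewrite /exp_coeff/= mulrA.
have -> : nbhs (1 : R) = nbhs (expR (- lam) * expR lam) by rewrite -expRD addNr expR0.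
exact: cvgMr.
Qed.

End PoissonLaw.

Section PointProcess.
Context {R : realType}.

Lemma xi_hits d n (x : 'I_n -> 'rV[R]_d) (a : R) (u : 'rV[R]_d) (I : set R) :
  fine (xi x a u I) = (hits [set: 'I_n] (fun=> zoom a n I) x u)%:R.
Proof.
rewrite /xi /hits natr_sum (eq_bigl xpredT) => [|j]; last by rewrite finset.in_setT.
rewrite -[RHS]/(fine (\sum_(j < n) (hit (zoom a n I) (x j) u)%:R)%:E) -sumEFin.
congr fine; apply: eq_bigr => j _; rewrite diracE; congr (_%:R)%:E.
by rewrite dotpZr mulrBr addrC.
Qed.

End PointProcess.

Theorem mainTheorem1 (R : realType) (d n : nat -> nat)
    (d_gt0 : forall m, (0 < d m)%N) (n_gt0 : forall m, (0 < n m)%N)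
    (d_cvg : d m @[m --> \oo] --> \oo) (n_cvg : n m @[m --> \oo] --> \oo)
    (x : forall m, 'I_(n m) -> 'rV[R]_(d m))
    (x_sphere : forall m (j : 'I_(n m)), unit_sphere (x m j))
    (x_corr : forall eps : R, 0 < eps ->
       (fun m => correlation_sum (x m) eps) =o_\oo
         (fun m => (n m)%:R ^+ 2 : R))
    (disp : nat -> measure_display) (Omega : forall m, measurableType (disp m))
    (P : forall m, probability (Omega m) R)
    (U : forall m, {RV (P m) >-> borel_rV R (d m)})
    (U_unif : forall m, uniform_on_sphere (distribution (P m) (U m)))
    (a : R) (I : set R) (I_borel : measurable I) (I_bounded : bounded_set I) :
  cvg_in_distribution P (fun m w => fine (xi (x m) a (U m w) I))
    (Pois (phi a * fine (lebesgue_measure I))).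
Proof.
have lam0 : 0 <= phi a * fine (lebesgue_measure I).
  by apply: mulr_ge0; [apply: ltW; exact: phi_gt0|exact: fine_ge0].
have mz m : measurable (zoom a (n m) I) by exact: measurable_affine.
pose N m (u : borel_rV R (d m)) : nat := hits [set: 'I_(n m)] (fun=> zoom a (n m) I) (x m) u.
have mN m (g : nat -> R) : measurable_fun setT (fun u => g (N m u)).
  by apply: measurable_hits => j; exact: mz.
have mNU m (g : nat -> R) : measurable_fun setT (fun w => g (N m (U m w))).
  exact: (measurableT_comp (mN m g) (measurable_funPT (U m))).
have push m k : \int[distribution (P m) (U m)]_u (N m u == k)%:R =
    \int[P m]_w (N m (U m w) == k)%:R.
  rewrite /Rintegral integral_pushforward//.
    by apply/measurable_EFinP; exact: (mN m (fun w => (w == k)%:R)).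
  apply: (bounded_integrable _ (M := 1)); first exact: (mNU m (fun w => (w == k)%:R)).
  by move=> w; rewrite ger0_norm// lern1 leq_b1.
split=> [m|f cf [M fM]].
  under eq_fun do rewrite xi_hits.
  exact: (mNU m (fun k => k%:R)).
have [r Ir] : exists r : R, forall y, I y -> `|y| <= r.
  have [r [_ hr]] := I_bounded; exists (r + 1) => y Iy.
  by apply: hr Iy; rewrite ltrDl.
under eq_fun do under eq_Rintegral do rewrite xi_hits.
have -> : \int[Pois (phi a * fine (lebesgue_measure I))]_y f y =
    \int[poisson_prob (phi a * fine (lebesgue_measure I)) 0%N]_k f (k : nat)%:R.
  have mf : measurable_fun setT f by exact: continuous_measurable_fun.
  rewrite /Rintegral integral_pushforward//; first exact/measurable_EFinP.
  apply: (bounded_integrable _ (M := M)) => [|k]; last exact: fM.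
  exact: measurableT_comp mf (@measurable_nat_real R).
apply: (cvg_Rintegral_nat (N := fun m w => N m (U m w)) (Z := id) (M := M)
  (p := fun k => expR (- (phi a * fine (lebesgue_measure I))) *
     (phi a * fine (lebesgue_measure I)) ^+ k / k`!%:R) (f := fun k => f k%:R)) => //.
- move=> k; apply/cvgrPdist_le => eps eps0.
  (* [k] and [eps] determine [eta] and [delta]; the little-o hypothesis at threshold [eta] is then
     tested against the constant [delta]. *)
  have [eta eta0 [delta delta0 H]] := point_probability a I_borel Ir k eps0.
  have /eqoP/(_ _ delta0) corr := x_corr _ eta0.
  have large (k' : nat -> nat) : k' m @[m --> \oo] --> \oo -> \forall m \near \oo, 1 <= delta * (k' m)%:R.
    move=> /cvgnyPge/(_ (Num.bound delta^-1)); apply: filterS => m hm.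
    rewrite -ler_pdivrMl// mulr1; apply: (@le_trans _ _ (Num.bound delta^-1)%:R); last by rewrite ler_nat.
    by apply: ltW; apply: archi_boundP; rewrite invr_ge0 ltW.
  have dl := large _ d_cvg; have nl := large _ n_cvg.
  near=> m; rewrite distrC -(push m k); apply: H => //.
  + by move=> j; exact: x_sphere.
  + by near: m.
  + by near: m.
  + have : `|correlation_sum (x m) eta| <= delta * `|(n m)%:R ^+ 2 : R| by near: m.
    by rewrite [X in _ <= _ * X]ger0_norm ?exprn_ge0//; exact: le_trans (ler_norm _).
- by move=> k; exact: Rintegral_poisson_point.
- exact: series_poisson.
Unshelve. all: by end_near.
Qed.
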